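(* Let $K$ and $K'$ be complete discretely valued fields of the same odd residue characteristic $p$, with residue fields both identified with a field $k$, and with fixed choices (of $k^{\mathrm{sep}}$, uniformisers $\pi,\pi'$ and compatible systems of roots $\pi^{1/n},(\pi')^{1/n}$ for $n$ coprime to $p$) determining the isomorphism $\Psi:G_K^{\mathrm t}\to G_{K'}^{\mathrm t}$ and the relations $\sim_{K,K'}$ and $\sim_{\mathrm{sq}}$ defined in the context. Let $E/K: y^2=f(x)$ and $E'/K': y^2=f'(x)$ be elliptic curves, where $f\in K[x]$ and $f'\in K'[x]$ are separable cubic polynomials (here $f'$ is just a name, not the derivative of $f$), and let $\mathcal R$ and $\mathcal R'$ be their sets of roots. Assume that $\mathcal R\subset K^{\mathrm t}$ and $\mathcal R'\subset (K')^{\mathrm t}$. Suppose that (1) the leading coefficients $c_f$ of $f$ and $c_{f'}$ of $f'$ satisfy $c_f\sim_{\mathrm{sq}}c_{f'}$; (2) there is a $\Psi$-equivariant bijection $\phi:\mathcal R\to\mathcal R'$ (i.e. $\phi(\sigma(r))=\Psi(\sigma)(\phi(r))$ for all $\sigma\in G_K^{\mathrm t}$, $r\in\mathcal R$) such that $r-s\sim_{K,K'}\phi(r)-\phi(s)$ for all distinct $r,s\in\mathcal R$. Then the actions of $G_K$ on $T_2E$ and of $G_{K'}$ on $T_2E'$ factor through $G_K^{\mathrm t}$ and $G_{K'}^{\mathrm t}$, respectively, and $$T_2E\cong\Psi^*T_2E'$$ as $\mathbb Z_2[G_K^{\mathrm t}]$-modules.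
   Context: $K$ and $K'$ are complete discretely valued fields of the same odd residue characteristic $p$, with a fixed identification of their residue fields with a field $k$. $G_K$, $G_{K'}$ are the absolute Galois groups. $K^{\mathrm t}$ and $(K')^{\mathrm t}$ are the maximal tamely ramified extensions, $G_K^{\mathrm t}=\mathrm{Gal}(K^{\mathrm t}/K)$ and $G_{K'}^{\mathrm t}=\mathrm{Gal}((K')^{\mathrm t}/K')$. Choices: fix a separable closure $k^{\mathrm{sep}}$ of $k$ (with which the residue fields of $K^{\mathrm t}$ and $(K')^{\mathrm t}$ are identified), uniformisers $\pi$ of $K$ and $\pi'$ of $K'$, and compatible choices of $n$-th roots $\pi^{1/n}\in K^{\mathrm t}$ and $(\pi')^{1/n}\in(K')^{\mathrm t}$ for every $n\ge 1$ coprime to $p$ (compatible means $(\pi^{1/mn})^m=\pi^{1/n}$, and likewise for $\pi'$). The prime-to-$p$ roots of unity in $K^{\mathrm t}$ and in $(K')^{\mathrm t}$ are identified through their reductions in $k^{\mathrm{sep}}$; write $\zeta_n\leftrightarrow\zeta_n'$ for corresponding primitive $n$-th roots of unity. These choices determine an isomorphism $\Psi:G_K^{\mathrm t}\xrightarrow{\sim}G_{K'}^{\mathrm t}$, characterised by: the actions of $\sigma$ and $\Psi(\sigma)$ on $k^{\mathrm{sep}}$ agree, and for every $n$ coprime to $p$, $\sigma(\pi^{1/n})=\zeta_n^b\pi^{1/n}$ if and only if $\Psi(\sigma)((\pi')^{1/n})=(\zeta_n')^b(\pi')^{1/n}$. Relations: $v_K$ and $v_{K'}$ are the valuations on $K^{\mathrm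 t}$ and $(K')^{\mathrm t}$ normalised by $v_K(\pi)=1$, $v_{K'}(\pi')=1$. For $0\ne x\in K^{\mathrm t}$ write $v_K(x)=m/n$ in lowest terms and put $\widetilde x_K=\overline{x/(\pi^{1/n})^m}\in(k^{\mathrm{sep}})^\times$, where the bar denotes reduction; define $\widetilde{x'}_{K'}$ similarly for $0\ne x'\in(K')^{\mathrm t}$ using $\pi'$. For $x\in K^{\mathrm t}$, $x'\in(K')^{\mathrm t}$, write $x\sim_{K,K'}x'$ if either $x=0$ and $x'=0$, or both are non-zero, $v_K(x)=v_{K'}(x')$ and $\widetilde x_K=\widetilde{x'}_{K'}$. For $c\in K^\times$ and $c'\in(K')^\times$, write $c\sim_{\mathrm{sq}}c'$ if $v_K(c)\equiv v_{K'}(c')\pmod 2$ and $\widetilde c_K/\widetilde{c'}_{K'}\in k^{\times 2}$. $T_2E=\varprojlim_n E[2^n]$ is the integral $2$-adic Tate module with its Galois action. $\Psi^*T_2E'$ is the $\mathbb Z_2$-module $T_2E'$ with $G_K^{\mathrm t}$-action $\sigma\cdot P=\Psi(\sigma)P$. *)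

(* Defs.v *)
From HB Require Import structures.
From mathcomp Require Import all_boot all_order all_algebra all_field.
From mathcomp Require Import all_classical.

Set Implicit Arguments.
Unset Strict Implicit.
Unset Printing Implicit Defensive.

Import Order.TTheory GRing.Theory Num.Theory.

Local Open Scope classical_set_scope.
Local Open Scope ring_scope.

(** * Valuations and residue fields

    The value at [0] is junk; [vge v M x] reads [v(x) >= M] with the
    convention [v(0) = +oo]. *)

Section Valuation.
Variables (F : fieldType) (V : realDomainType) (v : F -> V).

Definition valuation : Prop :=
  (forall x y, x != 0 -> y != 0 -> v (x * y) = v x + v y) /\
  (forall x y, x != 0 -> y != 0 -> x + y != 0 ->
     Num.min (v x) (v y) <= v (x + y)).

Definition vge (M : V) (x : F) : bool := (x == 0) || (M <= v x).

Definition vintegral (x : F) : bool := vge 0 x.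

(* [red] presents [kappa] as the residue field of [v]; its values outside the
   valuation ring are junk. *)
Definition residue_map (kappa : fieldType) (red : F -> kappa) : Prop :=
  [/\ red 1 = 1,
      forall x y, vintegral x -> vintegral y -> red (x + y) = red x + red y,
      forall x y, vintegral x -> vintegral y -> red (x * y) = red x * red y,
      forall a, exists2 x, vintegral x & red x = a
    & forall x, vintegral x -> (red x = 0 <-> (x == 0) || (0 < v x))].

Definition vcomplete : Prop :=
  forall u : nat -> F,
    (forall M : V, exists N : nat, forall m n : nat,
       (N <= m)%N -> (N <= n)%N -> vge M (u m - u n)) ->
    exists l : F, forall M : V, exists N : nat, forall n : nat,
      (N <= n)%N -> vge M (u n - l).

End Valuation.

(* Complete discretely valued fields with residue field identified with [k]. *)
Record cdvField (k : fieldType) := CdvField {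
  cdv_sort :> fieldType;
  vK : cdv_sort -> int;
  redK : cdv_sort -> k;
  vK_valuation : valuation vK;
  vK_normalized : exists2 x, x != 0 & vK x = 1;
  vK_complete : vcomplete vK;
  redK_residue : residue_map vK redK }.

(** * Separable closures and Galois groups *)

Definition separable_over (F L : fieldType) (i : {rmorphism F -> L}) : Prop :=
  forall x : L, exists2 q : {poly F}, separable_poly q & root (map_poly i q) x.

Definition separable_closure (F L : fieldType) (i : {rmorphism F -> L}) : Prop :=
  separable_over i /\
  (forall q : {poly L}, (1 < size q)%N -> separable_poly q ->
     exists x, root q x).

(* [galAut i] is the group of automorphisms of [L] over [F]; it is used for
   infinite Galois extensions. *)
Section GaloisGroup.
Variables (F L : fieldType) (i : {rmorphism F -> L}).

Record galAut := GalAut {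
  gal_fun :> L -> L;
  gal_zmod : zmod_morphism gal_fun;
  gal_monoid : GRing.monoid_morphism gal_fun;
  gal_bij : bijective gal_fun;
  gal_fix : forall a, gal_fun (i a) = i a }.

HB.instance Definition _ (s : galAut) :=
  GRing.isZmodMorphism.Build L L (gal_fun s) (gal_zmod s).
HB.instance Definition _ (s : galAut) :=
  GRing.isMonoidMorphism.Build L L (gal_fun s) (gal_monoid s).

HB.instance Definition _ := gen_eqMixin galAut.
HB.instance Definition _ := gen_choiceMixin galAut.

Lemma galAut_eq (s t : galAut) : s =1 t -> s = t.
Proof.
move=> /funext; case: s t => [s ? ? ? ?] [t ? ? ? ?] /= st; subst t.
by congr GalAut; apply: Prop_irrelevance.
Qed.

Definition gal_one : galAut.
Proof.
by exists id => //; exists id.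
Defined.

Definition gal_mul (s t : galAut) : galAut.
Proof.
exists (s \o t).
- by move=> x y /=; rewrite !gal_zmod.
- by split=> [|x y] /=; rewrite ?(gal_monoid t).1 ?(gal_monoid s).1 ?(gal_monoid t).2 ?(gal_monoid s).2.
- by apply: bij_comp; apply: gal_bij.
- by move=> a /=; rewrite !gal_fix.
Defined.

Lemma gal_inv_ex (s : galAut) : exists t : galAut, cancel s t /\ cancel t s.
Proof.
have [t st ts] := gal_bij s.
have tB : zmod_morphism t.
  by move=> x y; apply: (bij_inj (gal_bij s)); rewrite gal_zmod !ts.
have tM : GRing.monoid_morphism t.
  split=> [|x y]; apply: (bij_inj (gal_bij s)); first by rewrite (gal_monoid s).1 ts.
  by rewrite (gal_monoid s).2 !ts.
have tbij : bijective t by exists s.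
have tfix a : t (i a) = i a by apply: (bij_inj (gal_bij s)); rewrite ts gal_fix.
by exists (GalAut tB tM tbij tfix).
Qed.

Definition gal_inv (s : galAut) : galAut := sval (cid (gal_inv_ex s)).

Lemma gal_mulA : associative gal_mul.
Proof. by move=> s t u; apply: galAut_eq. Qed.

Lemma gal_mul1 : left_id gal_one gal_mul.
Proof. by move=> s; apply: galAut_eq. Qed.

Lemma gal_mulr1 : right_id gal_one gal_mul.
Proof. by move=> s; apply: galAut_eq. Qed.

Lemma gal_mulV : left_inverse gal_one gal_inv gal_mul.
Proof.
move=> s; apply: galAut_eq => x /=; rewrite /gal_inv.
by case: cid => t [st ts] /=; exact: st.
Qed.

Lemma gal_mulrV : right_inverse gal_one gal_inv gal_mul.
Proof.
move=> s; apply: galAut_eq => x /=; rewrite /gal_inv.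
by case: cid => t [st ts] /=; exact: ts.
Qed.

HB.instance Definition _ := isGroup.Build galAut
  gal_mulA gal_mul1 gal_mulr1 gal_mulV gal_mulrV.

End GaloisGroup.

(** * Tame ramification *)

Section Tame.
Variables (p : nat) (k : fieldType) (K : cdvField k).

(* A finite extension [L] of [K] is tamely ramified when its ramification index
   [e] is prime to [p] and its residue extension [kL / k] is separable.  As [K]
   is complete, the valuation [w] of [L] extending that of [K] is unique. *)
Definition tamely_ramified (L : fieldExtType K) : Prop :=
  exists (w : L -> rat) (kL : fieldType) (redL : L -> kL)
         (ikL : {rmorphism k -> kL}) (e : nat),
  [/\ valuation w /\ (forall a : K, a != 0 -> w a%:A = (vK a)%:~R),
      residue_map w redL /\
        (forall a : K, vintegral (@vK _ K) a -> redL a%:A = ikL (redK a)),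
      (0 < e)%N /\
        (forall q : rat,
           (exists2 x, x != 0 & w x = q) <-> exists z : int, q = z%:~R / e%:R),
      coprime e p
    & separable_over ikL].

Definition in_tame_ext (M : fieldType) (i : {rmorphism K -> M}) (x : M) : Prop :=
  exists (L : fieldExtType K) (h : {rmorphism L -> M}),
  [/\ forall a : K, h a%:A = i a, tamely_ramified L & exists y, h y = x].

End Tame.

(* A separable closure [Ks] of [K], the maximal tamely ramified extension [Kt]
   of [K] inside it, with residue field identified with [ksep], and a choice of
   a uniformiser [unif] and of compatible roots [rt n] = unif^(1/n), [n] prime
   to [p]. *)
Record tameChoice (p : nat) (k ksep : fieldType) (ik : {rmorphism k -> ksep})
    (K : cdvField k) := TameChoice {
  Ks : fieldType;
  iKs : {rmorphism K -> Ks};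
  Ks_closure : separable_closure iKs;
  Kt : fieldType;
  iKt : {rmorphism K -> Kt};
  jKt : {rmorphism Kt -> Ks};
  jKt_iKt : forall a : K, jKt (iKt a) = iKs a;
  Kt_max : forall x : Ks, (exists y, jKt y = x) <-> in_tame_ext p iKs x;
  vt : Kt -> rat;
  vt_valuation : valuation vt;
  vt_vK : forall a : K, a != 0 -> vt (iKt a) = (vK a)%:~R;
  redt : Kt -> ksep;
  redt_residue : residue_map vt redt;
  redt_redK : forall a : K,
    vintegral (@vK _ K) a -> redt (iKt a) = ik (redK a);
  unif : K;
  unif_neq0 : unif != 0;
  vK_unif : vK unif = 1;
  rt : nat -> Kt;
  rtX : forall n, (0 < n)%N -> coprime n p -> rt n ^+ n = iKt unif;
  rt_compat : forall m n, (0 < m)%N -> (0 < n)%N -> coprime m p -> coprime n p ->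
    rt (m * n)%N ^+ m = rt n }.

Arguments iKs {p k ksep ik K} _.
Arguments iKt {p k ksep ik K} _.
Arguments jKt {p k ksep ik K} _.
Arguments vt {p k ksep ik K} _ _.
Arguments redt {p k ksep ik K} _ _.
Arguments rt {p k ksep ik K} _ _.

Section Relations.
Variables (p : nat) (k ksep : fieldType) (ik : {rmorphism k -> ksep}).

Definition absGal (K : cdvField k) (D : tameChoice p ik K) := galAut (iKs D).
Definition tameGal (K : cdvField k) (D : tameChoice p ik K) := galAut (iKt D).

(* [denq] is positive and coprime to [numq]. *)
Definition tilde (K : cdvField k) (D : tameChoice p ik K) (x : Kt D) : ksep :=
  redt D (x / rt D `|denq (vt D x)|%N ^ numq (vt D x)).

Variables (K K' : cdvField k) (D : tameChoice p ik K) (D' : tameChoice p ik K').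

Definition sim (x : Kt D) (x' : Kt D') : Prop :=
  (x = 0 /\ x' = 0) \/
  [/\ x != 0, x' != 0, vt D x = vt D' x' & tilde x = tilde x'].

Definition sim_sq (c : K) (c' : K') : Prop :=
  (vK c = vK c' %[mod 2])%Z /\
  exists2 a : k, a != 0 & tilde (iKt D c) / tilde (iKt D' c') = ik (a ^+ 2).

(* The residual action of [s] sends [redt x] to [redt (s x)]; corresponding
   roots of unity are those with the same reduction. *)
Definition tame_identification (Psi : tameGal D -> tameGal D') : Prop :=
  [/\ {morph Psi : s t / (s * t)%g},
      bijective Psi,
      forall (s : tameGal D) (x : Kt D) (x' : Kt D'),
        vintegral (vt D) x -> vintegral (vt D') x' ->
        redt D x = redt D' x' -> redt D (s x) = redt D' (Psi s x')
    & forall (s : tameGal D) (n : nat) (zeta : Kt D) (zeta' : Kt D') (b : nat),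
        (0 < n)%N -> coprime n p ->
        n.-primitive_root zeta -> n.-primitive_root zeta' ->
        redt D zeta = redt D' zeta' ->
        (s (rt D n) = zeta ^+ b * rt D n <->
         Psi s (rt D' n) = zeta' ^+ b * rt D' n)].

End Relations.

(** * The elliptic curve [y ^ 2 = g(x)] and its 2-adic Tate module *)

(* Elements of the inverse limit of the Z/2^n, by least nonnegative
   representatives. *)
Definition Z2 : set (nat -> nat) :=
  [set a | forall n, (a n < 2 ^ n)%N /\ a n.+1 = a n %[mod 2 ^ n]].

Section Curve.
Variables (L : fieldType) (g : {poly L}).

(* [None] is the point at infinity. *)
Definition ec_point : Type := option (L * L).

Definition on_curve (P : ec_point) : Prop :=
  if P is Some (x, y) then y ^+ 2 = g.[x] else True.

(* Chord and tangent law with neutral element [None]; the line of slope [l]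
   through P and Q meets the curve in three points whose abscissas add up to
   (l ^ 2 - g_2) / g_3. *)
Definition ec_add (P Q : ec_point) : ec_point :=
  match P, Q with
  | None, _ => Q
  | _, None => P
  | Some (x1, y1), Some (x2, y2) =>
      if (x1 == x2) && (y1 == - y2) then None
      else
        let l := if x1 == x2 then g^`().[x1] / (y1 *+ 2)
                 else (y2 - y1) / (x2 - x1) in
        let x3 := (l ^+ 2 - g`_2) / g`_3 - x1 - x2 in
        Some (x3, - (y1 + l * (x3 - x1)))
  end.

Definition ec_muln (n : nat) (P : ec_point) : ec_point := iter n (ec_add P) None.

Definition ec_torsion (m : nat) : set ec_point :=
  [set P | on_curve P /\ ec_muln m P = None].

Definition tate2 : set (nat -> ec_point) :=
  [set P | forall n, ec_torsion (2 ^ n) (P n) /\ ec_muln 2 (P n.+1) = P n].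

Definition tate_add (P Q : nat -> ec_point) : nat -> ec_point :=
  fun n => ec_add (P n) (Q n).

Definition tate_scale (a : nat -> nat) (P : nat -> ec_point) : nat -> ec_point :=
  fun n => ec_muln (a n) (P n).

Definition tate_map (s : L -> L) (P : nat -> ec_point) : nat -> ec_point :=
  fun n => omap (fun xy => (s xy.1, s xy.2)) (P n).

End Curve.

Definition Z2_linear (L L' : fieldType) (g : {poly L}) (g' : {poly L'})
    (Phi : (nat -> ec_point L) -> nat -> ec_point L') : Prop :=
  [/\ set_fun (tate2 g) (tate2 g') Phi,
      forall P Q, tate2 g P -> tate2 g Q ->
        Phi (tate_add g P Q) = tate_add g' (Phi P) (Phi Q)
    & forall a P, Z2 a -> tate2 g P ->
        Phi (tate_scale g a P) = tate_scale g' a (Phi P)].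

Section TateModule.
Variables (p : nat) (k ksep : fieldType) (ik : {rmorphism k -> ksep}).
Variables (K : cdvField k) (D : tameChoice p ik K) (f : {poly K}).

Definition curve_Ks : {poly Ks D} := map_poly (iKs D) f.

(* [rho] makes [tate2] a module over the group ring of [tameGal D], and the
   action of [absGal D] on [tate2] is the one induced from [rho] by the
   restriction map absGal D -> tameGal D. *)
Definition tame_tate_action
    (rho : tameGal D -> (nat -> ec_point (Ks D)) -> nat -> ec_point (Ks D)) :
    Prop :=
  [/\ forall t, Z2_linear curve_Ks curve_Ks (rho t),
      forall P, tate2 curve_Ks P -> rho 1%g P = P,
      forall t u P, tate2 curve_Ks P -> rho (t * u)%g P = rho t (rho u P)
    & forall s : absGal D, exists2 t : tameGal D,
        forall x : Kt D, jKt D (t x) = s (jKt D x)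
        & forall P, tate2 curve_Ks P -> tate_map s P = rho t P].

Definition roots_Kt : set (Kt D) := [set r | root (map_poly (iKt D) f) r].

End TateModule.

Arguments curve_Ks {p k ksep ik K} D f.
Arguments roots_Kt {p k ksep ik K} D f.

(* Main.v *)
(** Over the maximal tame extension both curves become
    [y ^ 2 = (x - a)(x - b)(x - c)], where square roots exist.  If [P] has order
    greater than 2, then [2P = (X, Y)] determines [P] up to the choice of square
    roots [Ra, Rb, Rc] of [X - a, X - b, X - c] with product [Y], through
    [x - a = (Ra + Rb)(Ra + Rc)] and [y = (Ra + Rb)(Rb + Rc)(Rc + Ra)].
    Relating the points of the two curves by requiring recursively that the
    [R]'s have the same leading terms gives an equivariant bijection of 2-power
    torsion points: no information is lost in [Ra + Rb], because
    [(Ra + Rb)(Ra - Rb) = b - a] and, the residue characteristic being odd, at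
    most one of the two factors cancels.

    It is additive.  As [Ra(P + Q)] and [Ra(P - Q)] are, up to sign, the
    difference and the sum of the same two products of [R]'s, divided by
    [x(2Q) - x(2P)], at least one of them keeps its leading term; hence (there
    being three roots), by induction on the order, the bijection respects
    [P + Q] or [P - Q] for any [P] and [Q].  If it failed on [(P, Q)], then it
    would fail on [(P, 2Q)], and so on [(P, 4Q)], ..., ending with [(P, 0)]. *)

Require Import Defs.
From HB Require Import structures.
From mathcomp Require Import all_boot all_order all_algebra all_field.
From mathcomp Require Import all_classical.
From mathcomp Require Import cyclic.
From mathcomp Require Import ring lra.

Set Implicit Arguments.
Unset Strict Implicit.
Unset Printing Implicit Defensive.

Import Order.TTheory GRing.Theory Num.Theory.

Local Open Scope classical_set_scope.
Local Open Scope ring_scope.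

(** * The group law on a monic cubic *)

(** The delicate step is the division by [x(2Q) - x(2P)], whose own leading term must be carried
    over. For each root [e] it is [(Re Q - Re P)(Re Q + Re P)]. If a factor cancelled for every [e],
    then [Q] would share all three leading terms with some [P1] satisfying [2 P1 = 2P] or
    [2 P1 = - 2P], and the addition formula would put [2(P1 - Q)] so close to infinity that its
    [x - a], [x - b], [x - c] have one common leading term. Doubling preserves this closeness and
    never reaches zero, which is impossible for 2-power torsion. Cancellation concerns a single
    field, so an internal relation [N] accompanies the relation [S] between the two fields, and the
    argument uses only abstract properties of both. Torsion points arise from the roots by square
    roots alone. As [p] is odd, these exist in the tame extension, so the whole Tate module is
    defined there and the actions factor. Equivariance requires automorphisms to preserve the
    valuation: this is uniqueness of its extension, a consequence of completeness. *)

Section GroupLaw.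
Variables (L : fieldType) (G : {poly L}) (A B C : L).
Hypothesis two_neq0 : 2%:R != 0 :> L.
Hypothesis hornerG : forall x, G.[x] = x ^+ 3 + A * x ^+ 2 + B * x + C.
Hypothesis horner_derivG : forall x, G^`().[x] = 3%:R * x ^+ 2 + 2%:R * A * x + B.
Hypothesis coefG2 : G`_2 = A.
Hypothesis coefG3 : G`_3 = 1.
Hypothesis smoothG : forall x, G.[x] = 0 -> G^`().[x] != 0.
Hypothesis sqrtL : forall x : L, exists y, y ^+ 2 = x.
Hypothesis infL : forall s : seq L, exists x, x \notin s.

Local Notation pt := (ec_point L).
Local Notation on := (on_curve G).
Local Notation add := (ec_add G).

Definition ec_opp (F : fieldType) (P : ec_point F) : ec_point F :=
  if P is Some (x, y) then Some (x, - y) else None.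

(** The second equation compares coefficients of [X] in [G - (y1 + l (X - x1))^2 = (X - x1)(X -
    x2)(X - x3)], where [x3 = l^2 - A - x1 - x2]. Being free of division, it covers chords and
    tangents alike. *)
Definition chord (x1 y1 x2 y2 l : L) : Prop :=
  y2 = y1 + l * (x2 - x1) /\
  B = 2%:R * l * y1 - x1 ^+ 2 - A * x1 - l ^+ 2 * x1 + x2 * (l ^+ 2 - A - x1 - x2).

Lemma chord_exists x1 y1 x2 y2 :
  on (Some (x1, y1)) -> on (Some (x2, y2)) -> (x1, y1) <> (x2, - y2) ->
  exists l, chord x1 y1 x2 y2 l /\
    add (Some (x1, y1)) (Some (x2, y2)) =
      Some (l ^+ 2 - A - x1 - x2, - (y1 + l * (l ^+ 2 - A - x1 - x2 - x1))).
Proof.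
move=> /= h1 h2 ne.
have [e12|n12] := eqVneq x1 x2; last first.
  exists ((y2 - y1) / (x2 - x1)); rewrite coefG2 coefG3 divr1; split=> //.
  have nz : x2 - x1 != 0 by rewrite subr_eq0 eq_sym.
  split; first by rewrite divfK // addrC subrK.
  set l := _ / _; have hl : l * (x2 - x1) = y2 - y1 by rewrite divfK.
  apply: (mulfI nz); move: h1 h2; rewrite !hornerG => h1 h2.
  have {}hl : y2 = y1 + l * (x2 - x1) by rewrite hl addrC subrK.
  have -> : (x2 - x1) * B =
      y2 ^+ 2 - y1 ^+ 2 - (x2 ^+ 3 - x1 ^+ 3) - A * (x2 ^+ 2 - x1 ^+ 2).
    by rewrite h1 h2; ring.
  by rewrite hl; ring.
subst x2; have /eqP : (y2 - y1) * (y2 + y1) = 0.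
  by rewrite -subr_sqr h1 h2 subrr.
rewrite mulf_eq0 subr_eq0 => /orP[/eqP y21|]; last first.
  by rewrite addr_eq0 => /eqP y21; case: ne; rewrite y21 opprK.
subst y2.
have y0 : y1 != 0.
  by apply/eqP => y0; apply: ne; rewrite y0 oppr0.
have y1N : (y1 == - y1) = false.
  apply/negbTE; rewrite -subr_eq0 opprK -mulr2n -mulr_natl.
  by rewrite mulf_neq0.
rewrite y1N coefG2 coefG3 divr1; exists (G^`().[x1] / (y1 *+ 2)); split=> //.
have y2n : y1 *+ 2 != 0 by rewrite -mulr_natl mulf_neq0.
set l := _ / _; have hl : l * (y1 *+ 2) = G^`().[x1] by rewrite divfK.
split; first by rewrite subrr mulr0 addr0.
move: hl; rewrite horner_derivG => hl.
have -> : B = l * (y1 *+ 2) - 3%:R * x1 ^+ 2 - 2%:R * A * x1 by rewrite hl; ring.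
by ring.
Qed.

Lemma on_opp P : on P -> on (ec_opp P).
Proof. by case: P => [[x y]|] //=; rewrite sqrrN. Qed.

Lemma ec_add0 P : add None P = P. Proof. by []. Qed.
Lemma ec_addN P : add P (ec_opp P) = None.
Proof. by case: P => [[x y]|] //=; rewrite opprK !eqxx. Qed.

Lemma eq_pair_None x1 y1 x2 y2 :
  (x1, y1) = (x2, - y2) -> add (Some (x1, y1)) (Some (x2, y2)) = None.
Proof. by case=> -> -> /=; rewrite !eqxx. Qed.

Lemma chord_third x1 y1 x2 y2 l :
  on (Some (x1, y1)) -> chord x1 y1 x2 y2 l ->
  on (Some (l ^+ 2 - A - x1 - x2, - (y1 + l * (l ^+ 2 - A - x1 - x2 - x1)))).
Proof.
move=> /=; rewrite !hornerG => h1 [_ hB].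
have -> : C = y1 ^+ 2 - x1 ^+ 3 - A * x1 ^+ 2 - B * x1 by rewrite h1; ring.
by rewrite hB; ring.
Qed.

Lemma on_add P Q : on P -> on Q -> on (add P Q).
Proof.
case: P Q => [[x1 y1]|] [[x2 y2]|] // h1 h2.
have [e|/eqP ne] := eqVneq (x1, y1) (x2, - y2); first by rewrite eq_pair_None.
by have [l [ch ->]] := chord_exists h1 h2 ne; apply: chord_third ch.
Qed.

Lemma chord_sym x1 y1 x2 y2 l : chord x1 y1 x2 y2 l -> chord x2 y2 x1 y1 l.
Proof.
case=> -> hB; split; first by ring.
by rewrite {1}hB; ring.
Qed.

Lemma chord_uniq x1 y1 x2 y2 l l' :
  (x1, y1) <> (x2, - y2) -> chord x1 y1 x2 y2 l -> chord x1 y1 x2 y2 l' -> l = l'.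
Proof.
move=> ne [e1 e2] [e1' e2']; apply/eqP; rewrite -subr_eq0.
have [x12|n12] := eqVneq x1 x2.
  subst x2.
  have y12 : y2 = y1 by rewrite e1 subrr mulr0 addr0.
  have y0 : y1 != 0 by apply/eqP => y0; apply: ne; rewrite y12 y0 oppr0.
  have /eqP : (l - l') * (2%:R * y1) = 0.
    apply: etrans (subrr B); rewrite {2}e2' e2; ring.
  by rewrite !mulf_eq0 (negbTE two_neq0) (negbTE y0) !orbF.
have /eqP : (l - l') * (x2 - x1) = 0.
  by apply: etrans (subrr y2); rewrite {2}e1' e1; ring.
by rewrite mulf_eq0 [_ - x1 == 0]subr_eq0 eq_sym [x2 == x1]eq_sym (negbTE n12) orbF eq_sym.
Qed.

Lemma addE x1 y1 x2 y2 l :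
  on (Some (x1, y1)) -> on (Some (x2, y2)) -> (x1, y1) <> (x2, - y2) ->
  chord x1 y1 x2 y2 l ->
  add (Some (x1, y1)) (Some (x2, y2)) =
      Some (l ^+ 2 - A - x1 - x2, - (y1 + l * (l ^+ 2 - A - x1 - x2 - x1))).
Proof.
move=> h1 h2 ne ch; have [l' [ch' ->]] := chord_exists h1 h2 ne.
by rewrite (chord_uniq ne ch ch').
Qed.

Lemma ec_addC P Q : on P -> on Q -> add P Q = add Q P.
Proof.
case: P Q => [[x1 y1]|] [[x2 y2]|] // h1 h2.
have [e|/eqP ne] := eqVneq (x1, y1) (x2, - y2).
  by rewrite !eq_pair_None //; case: e => -> ->; rewrite opprK.
have ne' : (x2, y2) <> (x1, - y1).
  by case=> e1 e2; apply: ne; rewrite e1 e2 opprK.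
have [l [ch ->]] := chord_exists h1 h2 ne.
rewrite (addE h2 h1 ne' (chord_sym ch)).
case: ch => -> _; congr Some; congr pair; ring.
Qed.

Lemma ec_addK P Q : on P -> on Q -> add (add P Q) (ec_opp Q) = P.
Proof.
case: P Q => [[x1 y1]|] [[x2 y2]|] // h1 h2; last by rewrite /= opprK !eqxx.
have [e|/eqP ne] := eqVneq (x1, y1) (x2, - y2).
  by rewrite (eq_pair_None e) /= e.
have [l [ch e3]] := chord_exists h1 h2 ne.
have h3 := chord_third h1 ch; have h2' : on (Some (x2, - y2)) by exact: (on_opp h2).
rewrite e3; move: h3; set x3 := _ - x2; set y3 := - (y1 + _) => h3.
have y3E : y3 = - (y1 + l * (x3 - x1)) by [].
have ch3 : chord x3 y3 x2 (- y2) (- l).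
  case: ch => e1 eB; split; first by rewrite y3E e1; ring.
  by rewrite {1}eB y3E /x3; ring.
have [e|/eqP ne3] := eqVneq (x3, y3) (x2, - (- y2)); last first.
  rewrite (addE h3 h2' ne3 ch3); congr Some; congr pair; rewrite ?y3E /x3; ring.
(* Here [P + Q = Q]. The line takes at [x2] both the values [y2] and [- y2], so [y2 = 0]; then [x2]
   is a double root of [G], against smoothness. *)
case: e => ex ey; exfalso.
have y20 : y2 = 0.
  apply/eqP; have /eqP : 2%:R * y2 = 0.
    have -> : 2%:R * y2 = y3 + y2 by rewrite ey opprK; ring.
    by rewrite y3E ex; case: ch => -> _; ring.
  by rewrite mulf_eq0 (negbTE two_neq0).
have : G^`().[x2] != 0 by apply: smoothG; rewrite -h2 y20 expr0n.
rewrite horner_derivG => /eqP; apply.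
have x1E : x1 = l ^+ 2 - A - x2 *+ 2.
  by have -> : x1 = x1 + x3 - x2; [rewrite ex addrK | rewrite /x3; ring].
have [+ ->] := chord_sym ch; rewrite y20 => _.
rewrite x1E; ring.
Qed.

(* The slope of the chord through [P + Q] and [U] is [m^-1 - l]. *)
Lemma ec_addA_generic x1 y1 x2 y2 x3 y3 l :
  on (Some (x1, y1)) -> on (Some (x2, y2)) -> on (Some (x3, y3)) ->
  (x1, y1) <> (x2, - y2) -> chord x1 y1 x2 y2 l ->
  x3 != x1 -> x3 != x2 ->
  l ^+ 2 - A - x1 - x2 != x3 ->
  (forall y, add (Some (x2, y2)) (Some (x3, y3)) <> Some (x1, y)) ->
  add (add (Some (x1, y1)) (Some (x2, y2))) (Some (x3, y3)) =
  add (Some (x1, y1)) (add (Some (x2, y2)) (Some (x3, y3))).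
Proof.
move=> h1 h2 h3 ne ch n31 n32 n43 n1.
rewrite (addE h1 h2 ne ch).
have h4 := chord_third h1 ch.
have n31' : x3 - x1 != 0 by rewrite subr_eq0.
have n32' : x3 - x2 != 0 by rewrite subr_eq0.
(* Newton interpolation: [m] is the second divided difference of the ordinates. In terms of [l] and
   [m] the three curve equations can be solved polynomially for [A], [B] and [C], so that the rest
   is identities of rational functions. *)
pose m := (y3 - y1 - l * (x3 - x1)) / ((x3 - x1) * (x3 - x2)).
have y3E : y3 = y1 + l * (x3 - x1) + m * ((x3 - x1) * (x3 - x2)).
  by rewrite divfK ?mulf_neq0 //; ring.
clearbody m; have [y2E BE] := ch.
have CE : C = y1 ^+ 2 - x1 ^+ 3 - A * x1 ^+ 2 - B * x1.
  by move: h1; rewrite /= hornerG => ->; ring.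
have AE : A = m * (y1 + y3) + l ^+ 2 + l * m * (x3 - x1) - x1 - x2 - x3.
  apply: (mulfI (mulf_neq0 n31' n32')).
  have /= := h3; rewrite hornerG CE => h.
  have {h} : y3 ^+ 2 - x3 ^+ 3 - B * x3 - (y1 ^+ 2 - x1 ^+ 3 - B * x1)
     = A * (x3 ^+ 2 - x1 ^+ 2) by rewrite h; ring.
  rewrite {}BE => h; apply: (addIr (- (A * (x3 ^+ 2 - x1 ^+ 2)))).
  rewrite -{2}h y3E; ring.
(* The abscissa of [P + Q] is [x3 - m W], so the assumption that it differs from [x3] makes [m]
   invertible. *)
set W := y3 + y1 + l * (x3 - x1).
have x43 : l ^+ 2 - A - x1 - x2 = x3 - m * W by rewrite AE /W; ring.
have mW : m * W != 0.
  by apply/eqP => e; move: n43; rewrite x43 e subr0 eqxx.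
move: (mW); rewrite mulf_eq0 negb_or => /andP[m0 W0].
move: h4; rewrite x43 => h4.
have n4 : (x3 - m * W, - (y1 + l * (x3 - m * W - x1))) <> (x3, - y3).
  by case=> /eqP; rewrite -subr_eq0 addrAC subrr add0r oppr_eq0 (negbTE mW).
have ch4 : chord (x3 - m * W) (- (y1 + l * (x3 - m * W - x1))) x3 y3 (m^-1 - l).
  split; first by rewrite /W; field.
  rewrite /W BE AE y3E; field => //.
rewrite (addE h4 h3 n4 ch4).
have ne23 : (x2, y2) <> (x3, - y3) by case=> e; move: n32; rewrite e eqxx.
have ch23 : chord x2 y2 x3 y3 (l + m * (x3 - x1)).
  split; first by rewrite y2E y3E; ring.
  by rewrite BE AE y2E y3E; ring.
move: n1; rewrite (addE h2 h3 ne23 ch23).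
have h5 := chord_third h2 ch23; move: h5.
set x5 := _ - x3; set y5 := - (y2 + _) => h5 n1.
have n51 : x5 != x1 by apply/eqP => e; apply: (n1 y5); rewrite e.
have ne15 : (x1, y1) <> (x5, - y5) by case=> e; move: n51; rewrite e eqxx.
have ch15 : chord x1 y1 x5 y5 (m^-1 - (l + m * (x3 - x1))).
  split; first by rewrite /y5 /x5 AE ?y2E y3E; field.
  by rewrite BE /y5 /x5 AE ?y2E y3E; field.
rewrite (addE h1 h5 ne15 ch15); congr Some; congr pair.
  by rewrite /x5 /W AE y3E; field.
by rewrite /x5 /W AE y3E; field.
Qed.

Definition abscissas (P : pt) : seq L := if P is Some (x, _) then [:: x] else [::].

(** Infinity never counts as generic, so that a generic [U] is affine. *)
Definition avoids (s : seq L) (U : pt) : Prop :=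
  if U is Some (x, _) then x \notin s else False.

Lemma avoids_cat s t U : avoids (s ++ t) U -> avoids s U /\ avoids t U.
Proof. by case: U => [[x y]|] //=; rewrite mem_cat negb_or => /andP. Qed.

Lemma avoids_exists s : exists2 U, on U & avoids s U.
Proof.
have [x xs] := infL s; have [y yx] := sqrtL G.[x].
by exists (Some (x, y)).
Qed.

Lemma on_same_abscissa x y y' :
  on (Some (x, y)) -> on (Some (x, y')) -> y' = y \/ y' = - y.
Proof.
move=> /= <- /eqP; rewrite eqf_sqr => /orP[] /eqP ->; by [left | right].
Qed.

Lemma ec_add_sub P U : on P -> on U -> U = add (add P U) (ec_opp P).
Proof. by move=> hP hU; rewrite (ec_addC hP hU) ec_addK. Qed.

(** The generic formula can only fail when [U] has the abscissa of [P], [Q] or [P + Q], or that of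
    [P - Q] or [- P - Q], where [Q + U] would lie above the abscissa of [P]. When [P + Q = 0],
    [ec_addK] suffices and nothing is excluded. *)
Lemma ec_addA_near P Q : on P -> on Q ->
  exists s, forall U, on U -> avoids s U -> add (add P Q) U = add P (add Q U).
Proof.
case: P => [[x1 y1]|]; last by exists [::].
case: Q => [[x2 y2]|]; last by exists [::].
move=> h1 h2.
have [e|/eqP ne] := eqVneq (x1, y1) (x2, - y2).
  exists [::] => U hU _; rewrite (eq_pair_None e) ec_add0.
  rewrite (ec_addC h2 hU) ec_addC //; last exact: on_add.
  by rewrite e -[Some (_, - _)]/(ec_opp (Some (x2, y2))) ec_addK.
have [l [ch e4]] := chord_exists h1 h2 ne.
pose Q' := ec_opp (Some (x2, y2)).
exists ([:: x1; x2; l ^+ 2 - A - x1 - x2] ++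
  abscissas (add (Some (x1, y1)) Q') ++ abscissas (add (Some (x1, - y1)) Q')).
move=> [[x3 y3]|] // h3 /avoids_cat[a0 /avoids_cat[a1 a2]]; move: a0 => /=.
rewrite !inE !negb_or => /and3P[n1 n2 n4].
apply: (@ec_addA_generic _ _ _ _ _ _ l) => //; first by rewrite eq_sym.
move=> y e; have h5 := on_add h2 h3; rewrite e in h5.
have := ec_add_sub h2 h3; rewrite e.
by case: (on_same_abscissa h1 h5) => ->; [move: a1 | move: a2];
  rewrite -/Q' => + e3; rewrite -e3 /= inE eqxx.
Qed.

(** As [U = (R + U) - R], a forbidden abscissa [x] of [R + U] leaves for [U] only the two points
    above [x], translated by [- R]. Excluding the abscissa of [- R] keeps [R + U] affine. *)
Lemma avoids_translate R s : on R ->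
  exists t, forall U, on U -> avoids t U -> avoids s (add R U).
Proof.
move=> hR; have hR' := on_opp hR.
have [r rE] := choice (fun x => sqrtL G.[x]).
pose bad x := abscissas (add (Some (x, r x)) (ec_opp R)) ++
              abscissas (add (Some (x, - r x)) (ec_opp R)).
exists (abscissas (ec_opp R) ++ flatten (map bad s)) => U hU.
move=> /avoids_cat[a1 a2]; have UE := ec_add_sub hR hU.
have := on_add hR hU; case: (add R U) UE => [[x y]|] UE hx; last first.
  by move: a1; rewrite -[ec_opp R]ec_add0 -UE; case: (U) => [[? ?]|] //=; rewrite inE eqxx.
apply/negP => xs; have hx' : on (Some (x, r x)) by exact: rE.
case: U UE hU a1 a2 => [[u v]|] // UE hU _ /negP; apply.
apply/flattenP; exists (bad x); first exact: map_f.
rewrite mem_cat; case: (on_same_abscissa hx' hx) => ey; rewrite ey in UE;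
  by rewrite -UE /= !inE eqxx ?orbT.
Qed.

(* Any relation between sums holding for generic [U] can be cancelled, so it is
   enough to know associativity when the last point is generic. *)
Lemma ec_addA P Q R : on P -> on Q -> on R ->
  add P (add Q R) = add (add P Q) R.
Proof.
move=> hP hQ hR.
have hPQ := on_add hP hQ; have hQR := on_add hQ hR.
have [s1 g1] := ec_addA_near hPQ hR.
have [s2 g2] := ec_addA_near hP hQ.
have [s3 g3] := ec_addA_near hQ hR.
have [s4 g4] := ec_addA_near hP hQR.
have [t2 g5] := avoids_translate s2 hR.
have [U hU /avoids_cat[a1 /avoids_cat[a2 /avoids_cat[a3 a4]]]] :=
  avoids_exists (s1 ++ t2 ++ s3 ++ s4).
have hRU := on_add hR hU.
have e : add (add (add P Q) R) U = add (add P (add Q R)) U.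
  by rewrite g1 // g2 //; [rewrite -g3 // -g4 | exact: g5].
rewrite -[LHS](ec_addK (on_add hP hQR) hU) -e ec_addK //; exact: on_add.
Qed.

End GroupLaw.

(** * Half roots *)

Definition splits3 (L : fieldType) (G : {poly L}) (a b c : L) : Prop :=
  [/\ G = ('X - a%:P) * ('X - b%:P) * ('X - c%:P), a != b, b != c & a != c].

(** Both [Kt] and [Ks] give instances: leading terms live over the first, the Tate module over the
    second. Square roots serve for halving points, and infinitely many elements for the generic
    points behind associativity. *)
Record mcurve := MCurve {
  mfield :> fieldType;
  mpol : {poly mfield};
  mpol_splits : exists a b c, splits3 mpol a b c;
  mfield2 : 2%:R != 0 :> mfield;
  mfield_sqrt : forall x : mfield, exists y, y ^+ 2 = x;
  mfield_inf : forall s : seq mfield, exists x, x \notin s }.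

Section Splits.
Variables (L : fieldType) (G : {poly L}).

Lemma splits3_rot a b c : splits3 G a b c -> splits3 G b c a.
Proof.
by case=> -> ab bc ac; split; rewrite // 1?eq_sym //; ring.
Qed.

Lemma splits3_swap a b c : splits3 G a b c -> splits3 G a c b.
Proof.
by case=> -> ab bc ac; split; rewrite // 1?eq_sym //; ring.
Qed.

Lemma splits3_root a b c x :
  splits3 G a b c -> root G x = [|| x == a, x == b | x == c].
Proof. by case=> -> *; rewrite !rootM !root_XsubC orbA. Qed.

Lemma splits3_complete a b c e :
  splits3 G a b c -> root G e -> exists b' c', splits3 G e b' c'.
Proof.
move=> s; rewrite (splits3_root _ s) => /or3P[] /eqP ->; first by exists b, c.
  by exists c, a; exact: splits3_rot.
by exists a, b; do 2! apply: splits3_rot.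
Qed.

Lemma splits3_distinct_roots a b c x y z : splits3 G a b c ->
  root G x -> root G y -> root G z -> x != y -> y != z -> x != z -> splits3 G x y z.
Proof.
move=> s rx ry rz xy yz xz; have [v [w s']] := splits3_complete s rx.
move: ry rz; rewrite !(splits3_root _ s') [y == x]eq_sym [z == x]eq_sym.
rewrite (negbTE xy) (negbTE xz) /= => /orP[] /eqP ey /orP[] /eqP ez.
- by rewrite ey ez eqxx in yz.
- by rewrite ey ez.
- by rewrite ey ez; apply: splits3_swap.
- by rewrite ey ez eqxx in yz.
Qed.

Lemma splits3_horner a b c x :
  splits3 G a b c -> G.[x] = (x - a) * (x - b) * (x - c).
Proof. by case=> -> *; rewrite !(hornerM, hornerXsubC). Qed.

Lemma splits3_deriv a b c x : splits3 G a b c ->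
  G^`().[x] = (x - b) * (x - c) + (x - a) * (x - c) + (x - a) * (x - b).
Proof.
by case=> -> *; rewrite !derivM !derivXsubC !(hornerD, hornerM, hornerN, hornerX, hornerC); ring.
Qed.

Lemma splits3_expand a b c : splits3 G a b c ->
  G = 'X^3 + (- (a + b + c)) *: 'X^2 + (a * b + b * c + c * a) *: 'X +
      (- (a * b * c))%:P.
Proof.
case=> -> _ _ _; rewrite -!mul_polyC !(rmorphN, rmorphD, rmorphM) /=; ring.
Qed.

Lemma splits3_coef2 a b c : splits3 G a b c -> G`_2 = - (a + b + c).
Proof.
move=> /splits3_expand ->.
by rewrite !coefD !coefZ !coefXn coefX coefC /= !mulr0 mulr1 add0r !addr0.
Qed.

Lemma splits3_coef3 a b c : splits3 G a b c -> G`_3 = 1.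
Proof.
move=> /splits3_expand ->.
by rewrite !coefD !coefZ !coefXn coefX coefC /= !mulr0 !addr0.
Qed.

Lemma splits3_smooth a b c x : splits3 G a b c -> G.[x] = 0 -> G^`().[x] != 0.
Proof.
move=> s /eqP; rewrite -/(root G x) => /(splits3_complete s)[b' [c' s']].
rewrite (splits3_deriv _ s') subrr !mul0r !addr0 mulf_neq0 // subr_eq0.
  by case: s'.
by case: s'.
Qed.

End Splits.

(* Parametrising [u ^+ 2 - p ^+ 2 = v ^+ 2 - q ^+ 2 = w ^+ 2 - r ^+ 2] by the
   differences [u - p], [v - q], [w - r] makes all the quantities rational. *)
Lemma halves_add_formula (L : fieldType) (a b c p q r u v w : L) :
  2%:R != 0 :> L ->
  b = a + p ^+ 2 - q ^+ 2 -> c = a + p ^+ 2 - r ^+ 2 ->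
  b = a + u ^+ 2 - v ^+ 2 -> c = a + u ^+ 2 - w ^+ 2 ->
  u ^+ 2 - p ^+ 2 != 0 ->
  exists l ta tb tc,
  [/\ ta * (u ^+ 2 - p ^+ 2) = p * v * w - u * q * r,
      b = a + ta ^+ 2 - tb ^+ 2, c = a + ta ^+ 2 - tc ^+ 2 &
      let x1 := a + (p + q) * (p + r) in
      let y1 := (p + q) * (q + r) * (r + p) in
      let x2 := a + (u + v) * (u + w) in
      let y2 := (u + v) * (v + w) * (w + u) in
      let x3 := a + (ta + tb) * (ta + tc) in
      [/\ y2 - y1 = l * (x2 - x1), l ^+ 2 + (a + b + c) - x1 - x2 = x3 &
          - (y1 + l * (x3 - x1)) = (ta + tb) * (tb + tc) * (tc + ta)]].
Proof.
move=> two bP cP bQ cQ.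
set D := u ^+ 2 - p ^+ 2 => D0.
set m1 := u - p; set m2 := v - q; set m3 := w - r.
have D1 : D = m1 * (u + p) by rewrite /D /m1; ring.
have D2 : D = m2 * (v + q).
  have -> : D = v ^+ 2 - q ^+ 2 + (b - b) by rewrite {1}bQ bP /D; ring.
  by rewrite /m2; ring.
have D3 : D = m3 * (w + r).
  have -> : D = w ^+ 2 - r ^+ 2 + (c - c) by rewrite {1}cQ cP /D; ring.
  by rewrite /m3; ring.
have m10 : m1 != 0 by apply: contraNneq D0 => e; rewrite D1 e mul0r.
have m20 : m2 != 0 by apply: contraNneq D0 => e; rewrite D2 e mul0r.
have m30 : m3 != 0 by apply: contraNneq D0 => e; rewrite D3 e mul0r.
have half (x y m d : L) : m != 0 -> d = m * (y + x) -> m = y - x ->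
    x = (d / m - m) / 2%:R /\ y = (d / m + m) / 2%:R.
  move=> m0 -> mE; have -> : y = x + m by rewrite mE; ring.
  by split; field; apply/andP.
have [pE uE] := half _ _ _ _ m10 D1 erefl.
have [qE vE] := half _ _ _ _ m20 D2 erefl.
have [rE wE] := half _ _ _ _ m30 D3 erefl.
rewrite bP cP {bP cP bQ cQ D1 D2 D3 b c}.
clearbody D m1 m2 m3; subst p q r u v w.
exists ((D / m1 + D / m2 + D / m3 + m1 * m2 * m3 / D) / 2%:R).
(* This is [(p v w - u q r) / D] expanded in [D], [m1], [m2], [m3]; the next two witnesses are its
   cyclic permutations. *)
exists ((D * m2 / (m1 * m3) + D * m3 / (m1 * m2) - D * m1 / (m2 * m3) - m1 * m2 * m3 / D) / 4%:R).
exists ((D * m3 / (m2 * m1) + D * m1 / (m2 * m3) - D * m2 / (m3 * m1) - m1 * m2 * m3 / D) / 4%:R).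
exists ((D * m1 / (m3 * m2) + D * m2 / (m3 * m1) - D * m3 / (m1 * m2) - m1 * m2 * m3 / D) / 4%:R).
have four : 4%:R != 0 :> L by rewrite (natrM _ 2 2) mulf_neq0.
split; [|..| split]; cbv zeta; field; do ?[apply/andP; split] => //.
Qed.

(** * The group of points of a split monic cubic, and its half roots *)

Section Points.
Variable C : mcurve.
Local Notation G := (mpol C).

Lemma mcurve_addC P Q : on_curve G P -> on_curve G Q ->
  ec_add G P Q = ec_add G Q P.
Proof.
have [a [b [c s]]] := mpol_splits C.
apply: (@ec_addC _ _ (- (a + b + c)) (a * b + b * c + c * a) (- (a * b * c))).
- exact: mfield2.
- by move=> x; rewrite (splits3_horner _ s); ring.
- by move=> x; rewrite (splits3_deriv _ s); ring.
- exact: splits3_coef2 s.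
- exact: splits3_coef3 s.
Qed.

Lemma mcurve_on_add P Q : on_curve G P -> on_curve G Q ->
  on_curve G (ec_add G P Q).
Proof.
have [a [b [c s]]] := mpol_splits C.
apply: (@on_add _ _ (- (a + b + c)) (a * b + b * c + c * a) (- (a * b * c))).
- exact: mfield2.
- by move=> x; rewrite (splits3_horner _ s); ring.
- by move=> x; rewrite (splits3_deriv _ s); ring.
- exact: splits3_coef2 s.
- exact: splits3_coef3 s.
Qed.

Lemma mcurve_addA P Q R : on_curve G P -> on_curve G Q -> on_curve G R ->
  ec_add G P (ec_add G Q R) = ec_add G (ec_add G P Q) R.
Proof.
have [a [b [c s]]] := mpol_splits C.
apply: (@ec_addA _ _ (- (a + b + c)) (a * b + b * c + c * a) (- (a * b * c))).
- exact: mfield2.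
- by move=> x; rewrite (splits3_horner _ s); ring.
- by move=> x; rewrite (splits3_deriv _ s); ring.
- exact: splits3_coef2 s.
- exact: splits3_coef3 s.
- by move=> x; apply: splits3_smooth s.
- exact: mfield_sqrt.
- exact: mfield_inf.
Qed.

Record mpoint := MPoint { mval :> ec_point C; mvalP : on_curve G mval }.

HB.instance Definition _ := gen_eqMixin mpoint.
HB.instance Definition _ := gen_choiceMixin mpoint.

Lemma mval_inj : injective mval.
Proof.
by case=> P hP [Q hQ] /= e; subst Q; congr MPoint; apply: Prop_irrelevance.
Qed.

Definition mzero : mpoint := @MPoint None I.
Definition madd (P Q : mpoint) : mpoint := MPoint (mcurve_on_add (mvalP P) (mvalP Q)).
Definition mopp (P : mpoint) : mpoint := MPoint (on_opp (mvalP P)).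

Lemma maddA : associative madd.
Proof. by move=> P Q R; apply: mval_inj; apply: mcurve_addA; apply: mvalP. Qed.
Lemma maddC : commutative madd.
Proof. by move=> P Q; apply: mval_inj; apply: mcurve_addC; apply: mvalP. Qed.
Lemma madd0 : left_id mzero madd.
Proof. by move=> P; apply: mval_inj. Qed.
Lemma maddN : left_inverse mzero mopp madd.
Proof. by move=> P; rewrite maddC; apply: mval_inj; apply: ec_addN. Qed.

HB.instance Definition _ := GRing.isZmodule.Build mpoint maddA maddC madd0 maddN.

Lemma mvalD (P Q : mpoint) : mval (P + Q) = ec_add G P Q. Proof. by []. Qed.
Lemma mvalN (P : mpoint) : mval (- P) = ec_opp P. Proof. by []. Qed.
Lemma mval0 : mval 0 = None. Proof. by []. Qed.
Lemma mval_eq0 (P : mpoint) : mval P = None -> P = 0.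
Proof. by move=> e; apply: mval_inj. Qed.

Definition xc (P : mpoint) : C := if mval P is Some (x, _) then x else 0.
(** The default 0 at infinity makes [yc P = 0] equivalent to [P *+ 2 = 0] for all [P]. *)
Definition yc (P : mpoint) : C := if mval P is Some (_, y) then y else 0.

Lemma mval_neq0 (P : mpoint) : P != 0 -> mval P = Some (xc P, yc P).
Proof.
move=> P0; rewrite /xc /yc; case e: (mval P) => [[x y]|] //.
by rewrite (mval_eq0 e) eqxx in P0.
Qed.

Lemma mpoint_eqn (P : mpoint) : P != 0 -> yc P ^+ 2 = G.[xc P].
Proof. by move=> /mval_neq0 e; have := mvalP P; rewrite e. Qed.

Lemma yc_double (P : mpoint) : (P *+ 2 == 0) = (yc P == 0).
Proof.
have [->|P0] := eqVneq P 0; first by rewrite mul0rn !eqxx.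
have e := mval_neq0 P0; apply/eqP/eqP => [P2|y0].
  have : P = - P by apply/eqP; rewrite -subr_eq0 opprK -mulr2n P2.
  move/(congr1 mval); rewrite mvalN e /= => -[/eqP].
  rewrite -addr_eq0 -mulr2n -mulr_natl mulf_eq0 (negbTE (mfield2 C)) => /eqP //.
by apply: mval_inj; rewrite mulr2n mvalD e y0 /= oppr0 !eqxx.
Qed.

Lemma xc_opp (P : mpoint) : xc (- P) = xc P.
Proof. by rewrite /xc mvalN; case: (mval P) => [[]|]. Qed.

Lemma yc_opp (P : mpoint) : yc (- P) = - yc P.
Proof. by rewrite /yc mvalN; case: (mval P) => [[]|] //=; rewrite oppr0. Qed.

Lemma xc_inj (P Q : mpoint) : P != 0 -> Q != 0 -> xc P = xc Q -> Q = P \/ Q = - P.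
Proof.
move=> P0 Q0 e; have /eqP : yc Q ^+ 2 = yc P ^+ 2.
  by rewrite !mpoint_eqn // e.
rewrite eqf_sqr => /orP[] /eqP ey; [left | right]; apply: mval_inj.
  by rewrite (mval_neq0 P0) (mval_neq0 Q0) e ey.
by rewrite mvalN (mval_neq0 P0) (mval_neq0 Q0) e ey.
Qed.

Lemma mvalD_chord (P Q : mpoint) : P != 0 -> Q != 0 -> xc P != xc Q ->
  P + Q != 0 /\ forall l a b c, splits3 G a b c -> yc Q - yc P = l * (xc Q - xc P) ->
  xc (P + Q) = l ^+ 2 + (a + b + c) - xc P - xc Q /\
  yc (P + Q) = - (yc P + l * (xc (P + Q) - xc P)).
Proof.
move=> P0 Q0 nx; have : mval (P + Q) = ec_add G (Some (xc P, yc P)) (Some (xc Q, yc Q)).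
  by rewrite mvalD !mval_neq0.
rewrite [RHS]/= (negbTE nx) [RHS]/= => e; split.
  by apply/eqP => e0; rewrite e0 in e.
move=> l a b c s lE; have {}lE : (yc Q - yc P) / (xc Q - xc P) = l.
  by rewrite lE mulfK // subr_eq0 eq_sym.
rewrite {1 4}/xc {1}/yc e lE (splits3_coef2 s) (splits3_coef3 s).
by rewrite divr1 opprK.
Qed.

Lemma mvalD_tangent (P : mpoint) l : yc P != 0 -> l * (2%:R * yc P) = G^`().[xc P] ->
  P *+ 2 != 0 /\ forall a b c, splits3 G a b c ->
  xc (P *+ 2) = l ^+ 2 + (a + b + c) - xc P - xc P /\
  yc (P *+ 2) = - (yc P + l * (xc (P *+ 2) - xc P)).
Proof.
move=> y0 lE; split; first by rewrite yc_double.
have P0 : P != 0 by apply/eqP => P0; rewrite P0 eqxx in y0.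
have : mval (P *+ 2) = ec_add G (Some (xc P, yc P)) (Some (xc P, yc P)).
  by rewrite mulr2n mvalD !mval_neq0.
have yN : (yc P == - yc P) = false.
  by apply/negbTE; rewrite -subr_eq0 opprK -mulr2n -mulr_natl mulf_neq0 ?mfield2.
rewrite [RHS]/= !eqxx yN [RHS]/= => e a b c s.
have {}lE : G^`().[xc P] / (yc P *+ 2) = l.
  by rewrite -mulr_natl -lE mulfK // mulf_neq0 ?mfield2.
rewrite {1 4}/xc {1}/yc e lE (splits3_coef2 s) (splits3_coef3 s).
by rewrite divr1 opprK.
Qed.

Lemma mpoint_exists x y : y ^+ 2 = G.[x] ->
  exists P : mpoint, [/\ P != 0, xc P = x & yc P = y].
Proof.
move=> e; exists (@MPoint (Some (x, y)) e); split => //.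
by apply/eqP => /(congr1 mval).
Qed.

Lemma tpoint_exists e : root G e ->
  exists T : mpoint, [/\ T != 0, xc T = e & yc T = 0].
Proof. by move=> /eqP r; apply: mpoint_exists; rewrite r expr0n. Qed.

Lemma tpoint_root (P : mpoint) : P != 0 -> P *+ 2 = 0 -> root G (xc P) /\ yc P = 0.
Proof.
move=> P0 /eqP; rewrite yc_double => /eqP y0; split => //.
by rewrite /root -mpoint_eqn // y0 expr0n.
Qed.

(* [halfroot e P] is the square root of [xc (P *+ 2) - e] that, up to a factor,
   is the value at [e] of the tangent line at [P]. *)
Definition halfroot (e : C) (P : mpoint) : C :=
  G^`().[xc P] / (2%:R * yc P) - yc P / (xc P - e).

Lemma halfroot_opp e P : halfroot e (- P) = - halfroot e P.
Proof.
rewrite /halfroot xc_opp yc_opp mulrN invrN mulrN !mulNr opprB opprK addrC.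
by [].
Qed.

Section Triple.
Variables a b c : C.
Hypothesis s : splits3 G a b c.

Lemma yc_neq0 (P : mpoint) : yc P != 0 ->
  [/\ P != 0, xc P - a != 0, xc P - b != 0, xc P - c != 0 &
      yc P ^+ 2 = (xc P - a) * (xc P - b) * (xc P - c)].
Proof.
move=> y0; have P0 : P != 0 by apply/eqP => P0; rewrite P0 eqxx in y0.
have e := mpoint_eqn P0; rewrite (splits3_horner _ s) in e.
have : (xc P - a) * (xc P - b) * (xc P - c) != 0 by rewrite -e expf_neq0.
move: (P0) e; clear; set u := _ - a; set v := _ - b; set w := _ - c => P0 e nz.
by move: nz; rewrite mulf_eq0 negb_or => /andP[+ nc]; rewrite mulf_eq0 negb_or => /andP[na nb]; split.
Qed.

(** Logarithmic derivative: [G' / G] is the sum of the three [1 / (x - e)], and [G = y^2]. *)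
Lemma halfrootE P : yc P != 0 ->
  2%:R * halfroot a P = yc P / (xc P - b) + yc P / (xc P - c) - yc P / (xc P - a).
Proof.
move=> y0; have [P0 na nb nc e] := yc_neq0 y0; have n2 := mfield2 C.
rewrite /halfroot (splits3_deriv _ s).
have -> : ((xc P - b) * (xc P - c) + (xc P - a) * (xc P - c) +
      (xc P - a) * (xc P - b)) / (2 * yc P) =
    ((xc P - b) * (xc P - c) + (xc P - a) * (xc P - c) +
      (xc P - a) * (xc P - b)) * yc P / (2 * yc P ^+ 2) by field; apply/andP.
rewrite e; field; do ?[apply/andP; split] => //.
Qed.

Lemma halfrootD P : yc P != 0 -> halfroot a P + halfroot b P = yc P / (xc P - c).
Proof.
move=> y0; have [P0 na nb nc e] := yc_neq0 y0; have n2 := mfield2 C.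
rewrite /halfroot (splits3_deriv _ s).
set t := _ / (2 * _); have : 2 * t = (xc P - b) * (xc P - c) / yc P
     + (xc P - a) * (xc P - c) / yc P + (xc P - a) * (xc P - b) / yc P.
  by rewrite /t; field; apply/andP.
have inv d q : yc P ^+ 2 = d * q -> q != 0 -> d / yc P = yc P / q.
  move=> eq q0; apply: (mulfI y0); rewrite mulrCA divff // mulr1.
  by rewrite mulrA -expr2 eq mulfK.
rewrite (inv _ (xc P - a)) ?e //; last by ring.
rewrite (inv _ (xc P - b)) ?e //; last by ring.
rewrite (inv _ (xc P - c)) ?e // => h.
have -> : t - yc P / (xc P - a) + (t - yc P / (xc P - b)) =
   2 * t - yc P / (xc P - a) - yc P / (xc P - b) by ring.
by rewrite h; ring.
Qed.

(** There is an [X] with [X - a = p^2], [X - b = q^2], [X - c = r^2]; here [X] is eliminated. *)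
Definition halves (p q r : C) : Prop :=
  b = a + p ^+ 2 - q ^+ 2 /\ c = a + p ^+ 2 - r ^+ 2.

Lemma halves_sum_neq0 p q r :
  halves p q r -> [/\ p + q != 0, p + r != 0 & q + r != 0].
Proof.
case: s => _ ab bc ac [bE cE]; split; apply/eqP => e.
- by case/eqP: ab; rewrite bE -addrA subr_sqr e mulr0 addr0.
- by case/eqP: ac; rewrite cE -addrA subr_sqr e mulr0 addr0.
- case/eqP: bc; apply/eqP; rewrite -subr_eq0 bE cE; apply/eqP.
  have -> : a + p ^+ 2 - q ^+ 2 - (a + p ^+ 2 - r ^+ 2) = (r - q) * (q + r) by ring.
  by rewrite e mulr0.
Qed.

Lemma halfroot_of P p q r : halves p q r ->
  xc P = a + (p + q) * (p + r) -> yc P = (p + q) * (q + r) * (r + p) ->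
  [/\ yc P != 0, halfroot a P = p, halfroot b P = q & halfroot c P = r].
Proof.
move=> h xE yE; have [pq pr qr] := halves_sum_neq0 h; have n2 := mfield2 C.
have rp : r + p != 0 by rewrite addrC.
have [bE cE] := h; split; first by rewrite yE !mulf_neq0.
all: rewrite /halfroot (splits3_deriv _ s) xE yE.
- have -> : a + (p + q) * (p + r) - a = (p + q) * (p + r) by ring.
  rewrite ?bE ?cE; field; do ?[apply/andP; split] => //.
- have -> : a + (p + q) * (p + r) - b = (p + q) * (q + r) by rewrite bE; ring.
  rewrite ?bE ?cE; field; do ?[apply/andP; split] => //.
- have -> : a + (p + q) * (p + r) - c = (p + r) * (q + r) by rewrite cE; ring.
  rewrite ?bE ?cE; field; do ?[apply/andP; split] => //.
Qed.

Lemma halves_exist p q r : halves p q r ->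
  exists P, [/\ yc P != 0, halfroot a P = p, halfroot b P = q & halfroot c P = r].
Proof.
move=> h; have [|P [P0 xE yE]] := @mpoint_exists
  (a + (p + q) * (p + r)) ((p + q) * (q + r) * (r + p)).
  by have [bE cE] := h; rewrite (splits3_horner _ s) bE cE; ring.
by exists P; apply: halfroot_of.
Qed.

End Triple.

Section HalfRoots.
Variables a b c : C.
Hypothesis s : splits3 G a b c.
Variable P : mpoint.
Hypothesis y0 : yc P != 0.
Local Notation p := (halfroot a P).
Local Notation q := (halfroot b P).
Local Notation r := (halfroot c P).

(** By [halfrootD], [p + q = y / (x - c)] and [p + r = y / (x - b)]; their product is [x - a] since
    [y^2 = (x - a)(x - b)(x - c)]. *)
Lemma halfroot_coords : [/\ xc P = a + (p + q) * (p + r),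
  yc P = (p + q) * (q + r) * (r + p) & halves a b c p q r].
Proof.
have s1 := splits3_rot s; have s2 := splits3_rot s1.
have [P0 na nb nc e] := yc_neq0 s y0.
have epq := halfrootD s y0; have eqr := halfrootD s1 y0.
have erp := halfrootD s2 y0; have epr := erp; rewrite addrC in epr.
have xa : xc P - a = (p + q) * (p + r).
  by rewrite epq epr mulf_div -expr2 e; field; apply/andP.
have xb : xc P - b = (p + q) * (q + r).
  by rewrite epq eqr mulf_div -expr2 e; field; apply/andP.
have xcc : xc P - c = (p + r) * (q + r).
  by rewrite epr eqr mulf_div -expr2 e; field; apply/andP.
split.
- by rewrite -xa addrC subrK.
- rewrite epq eqr erp; apply: (mulIf (mulf_neq0 (mulf_neq0 na nb) nc)).
  rewrite -{1}e; field; do ?[apply/andP; split] => //.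
- split.
    transitivity (a + (xc P - a) - (xc P - b)); first by ring.
    by rewrite xa xb; ring.
  transitivity (a + (xc P - a) - (xc P - c)); first by ring.
  by rewrite xa xcc; ring.
Qed.

Lemma halfroot_double :
  xc (P *+ 2) = a + p ^+ 2 /\ yc (P *+ 2) = p * q * r.
Proof.
have [xE yE h] := halfroot_coords; have [bE cE] := h.
have lE : (p + q + r) * (2%:R * yc P) = G^`().[xc P].
  rewrite (splits3_deriv _ s) yE xE.
  move: bE cE; set p' := p; set q' := q; set r' := r => bE cE.
  by rewrite bE cE; ring.
have [_ /(_ _ _ _ s)[e1 e2]] := mvalD_tangent y0 lE.
have {}e1 : xc (P *+ 2) = a + p ^+ 2.
  rewrite e1 xE; move: bE cE; set p' := p; set q' := q; set r' := r => bE cE.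
  by rewrite bE cE; ring.
split=> //; rewrite e2 e1 yE xE; ring.
Qed.

End HalfRoots.

Lemma halfroot_inj a b c P Q : splits3 G a b c -> yc P != 0 -> yc Q != 0 ->
  halfroot a P = halfroot a Q -> halfroot b P = halfroot b Q ->
  halfroot c P = halfroot c Q -> P = Q.
Proof.
move=> s yP yQ ea eb ec.
have [xP yPE _] := halfroot_coords s yP; have [xQ yQE _] := halfroot_coords s yQ.
have [P0 _ _ _ _] := yc_neq0 s yP; have [Q0 _ _ _ _] := yc_neq0 s yQ.
by apply: mval_inj; rewrite !mval_neq0 // xP xQ yPE yQE ea eb ec.
Qed.

(** Since [2(P + T) = 2P], half roots can only change sign, and their product is fixed. The
    computation rests on the chord through [P] and [T], of slope [y / (x - a)], the sum of the half
    roots at [b] and [c]. *)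
Lemma halfroot_translate a b c P T : splits3 G a b c -> yc P != 0 ->
  T != 0 -> xc T = a -> yc T = 0 ->
  [/\ yc (P + T) != 0, halfroot a (P + T) = halfroot a P,
      halfroot b (P + T) = - halfroot b P & halfroot c (P + T) = - halfroot c P].
Proof.
move=> s y0 T0 xT yT; have [xE yE h] := halfroot_coords s y0.
have [P0 na _ _ _] := yc_neq0 s y0; have [bE cE] := h.
have nx : xc P != xc T by rewrite xT -subr_eq0.
have [|x3] := (proj2 (mvalD_chord P0 T0 nx)) (halfroot b P + halfroot c P) _ _ _ s.
  by rewrite yT xT yE xE; ring.
move: x3.
move: xE yE bE cE h; set p := halfroot a P; set q := halfroot b P.
set r := halfroot c P => xE yE bE cE h x3 y3.
have {}x3 : xc (P + T) = a + (p + - q) * (p + - r).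
  by rewrite x3 xT xE {1}bE {1}cE; ring.
apply: (halfroot_of s) => //; first by split; rewrite sqrrN.
by rewrite y3 x3 yE xE; ring.
Qed.

Lemma halfroot_add a b c P Q : splits3 G a b c -> yc P != 0 -> yc Q != 0 ->
  xc (Q *+ 2) != xc (P *+ 2) ->
  yc (P + Q) != 0 /\ halfroot a (P + Q) * (xc (Q *+ 2) - xc (P *+ 2)) =
    halfroot a P * halfroot b Q * halfroot c Q -
    halfroot a Q * halfroot b P * halfroot c P.
Proof.
move=> s yP yQ n2; have [xPE yPE [bP cP]] := halfroot_coords s yP.
have [xQE yQE [bQ cQ]] := halfroot_coords s yQ.
have [P0 _ _ _ _] := yc_neq0 s yP; have [Q0 _ _ _ _] := yc_neq0 s yQ.
have nx : xc P != xc Q.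
  apply: contraNneq n2 => /(xc_inj P0 Q0)[] -> //.
  by rewrite mulNrn xc_opp.
have [xP2 _] := halfroot_double s yP; have [xQ2 _] := halfroot_double s yQ.
move: n2; rewrite xP2 xQ2 -subr_eq0 => n2.
have [_ chE] := mvalD_chord P0 Q0 nx; move: chE.
rewrite xPE yPE xQE yQE.
move: bP cP bQ cQ n2; set p := halfroot a P; set q := halfroot b P.
set r := halfroot c P; set u := halfroot a Q; set v := halfroot b Q.
set w := halfroot c Q => bP cP bQ cQ n2 chE.
have D0 : u ^+ 2 - p ^+ 2 != 0 by move: n2; rewrite opprD addrACA subrr add0r.
have [l [ta [tb [tc [taE tb2 tc2 [lE x3E y3E]]]]]] :=
  halves_add_formula (mfield2 C) bP cP bQ cQ D0.
have [x3 y3] := chE l a b c s lE.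
rewrite x3E in x3; rewrite x3 y3E in y3.
have h : halves a b c ta tb tc by [].
have [-> -> _ _] := halfroot_of s h x3 y3; split=> //.
by rewrite -taE; ring.
Qed.

End Points.

(** * Leading terms *)

(* [S x x'] abstracts "x and x' have the same leading term", and [N] is the
   corresponding relation within the first field. *)
Record leading (L L' : fieldType) (N : L -> L -> Prop) (S : L -> L' -> Prop)
    : Prop := Leading {
  lead00 : S 0 0;
  lead0l : forall x', S 0 x' -> x' = 0;
  lead0r : forall x, S x 0 -> x = 0;
  leadM : forall x y x' y', S x x' -> S y y' -> S (x * y) (x' * y');
  leadV : forall x x', S x x' -> S x^-1 x'^-1;
  leadN : forall x x', S x x' -> S (- x) (- x');
  leadD : forall x y x' y', S x x' -> S y y' -> S (x + y) (x' + y') \/ N x (- y);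
  lead_sqr : forall x x', S (x ^+ 2) (x' ^+ 2) -> S x x' \/ S x (- x');
  lead_trans : forall x y x', N x y -> S y x' -> S x x';
  lead_sign : forall x x', S x x' -> S x (- x') -> x = 0 }.

(** In terms of residues, [lead_double] says that 2 differs from 1, and [lead_sign] that 1 differs
    from -1. *)
Record lead_equiv (L : fieldType) (N : L -> L -> Prop) : Prop := LeadEquiv {
  lead_N : leading N N;
  lead_refl : forall x, N x x;
  lead_sym : forall x y, N x y -> N y x;
  lead_double : forall x, N (x + x) x -> x = 0 }.

(** The relations are carried in both directions so that a matching can be reversed; totality and
    uniqueness of partners then give surjectivity and injectivity. Only differences of roots are
    compared, as the roots themselves need not have related leading terms. *)
Record matching (C C' : mcurve) := Matching {
  mN : C -> C -> Prop;
  mN' : C' -> C' -> Prop;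
  mS : C -> C' -> Prop;
  mS' : C' -> C -> Prop;
  mrt : C -> C' -> Prop;
  mS_sym : forall x x', mS x x' <-> mS' x' x;
  mN_equiv : lead_equiv mN;
  mN'_equiv : lead_equiv mN';
  mS_lead : leading mN mS;
  mS'_lead : leading mN' mS';
  mrt_root : forall e e', mrt e e' -> root (mpol C) e /\ root (mpol C') e';
  mrt_l : forall e, root (mpol C) e -> exists e', mrt e e';
  mrt_r : forall e', root (mpol C') e' -> exists e, mrt e e';
  mrt_fun : forall e e1 e2, mrt e e1 -> mrt e e2 -> e1 = e2;
  mrt_inj : forall e' e1 e2, mrt e1 e' -> mrt e2 e' -> e1 = e2;
  mrt_diff : forall e d e' d', mrt e e' -> mrt d d' -> e != d -> mS (e - d) (e' - d') }.

Definition matching_flip C C' (X : matching C C') : matching C' C.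
Proof.
apply: (@Matching C' C (mN' X) (mN X) (mS' X) (mS X) (fun e e' => mrt X e' e)).
- by move=> x x'; split=> /mS_sym.
- exact: mN'_equiv.
- exact: mN_equiv.
- exact: mS'_lead.
- exact: mS_lead.
- by move=> e e' /mrt_root[].
- exact: mrt_r.
- exact: mrt_l.
- by move=> e e1 e2; apply: mrt_inj.
- by move=> e e1 e2; apply: mrt_fun.
- move=> e d e' d' he hd ed; apply/(mS_sym X); apply: mrt_diff => //.
  by apply: contraNneq ed => e0; rewrite e0 in he; rewrite (mrt_fun he hd).
Defined.

Section Leading.
Variables (L L' : fieldType) (N : L -> L -> Prop) (S : L -> L' -> Prop).
Hypotheses (HN : lead_equiv N) (HS : leading N S).

Lemma lead_opp_eq0 x : N x (- x) -> x = 0.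
Proof. by apply: (lead_sign (lead_N HN)); apply: lead_refl. Qed.

Lemma lead_eq0 x x' : S x x' -> (x == 0) = (x' == 0).
Proof.
move=> h; apply/eqP/eqP => e; rewrite e in h.
  exact: (lead0l HS).
exact: (lead0r HS).
Qed.

Lemma leadB x y x' y' : S x x' -> S y y' -> S (x - y) (x' - y') \/ N x y.
Proof.
move=> hx hy; rewrite -{2}[y]opprK; apply: (leadD HS) => //.
exact: (leadN HS).
Qed.

Lemma lead_cancel x y z z' : y != 0 -> S y z -> S (x * y) (z' * z) -> S x z'.
Proof.
move=> y0 yz h; have z0 : z != 0 by rewrite -(lead_eq0 yz).
rewrite -(mulfK y0 x) -(mulfK z0 z').
by apply: (leadM HS) => //; apply: (leadV HS).
Qed.

(* Only one of [x + y] and [x - y] can cancel, and their product is known. *)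
Lemma lead_add_of_sqr x y x' y' : S x x' -> S y y' ->
  x ^+ 2 - y ^+ 2 != 0 -> S (x ^+ 2 - y ^+ 2) (x' ^+ 2 - y' ^+ 2) ->
  S (x + y) (x' + y').
Proof.
move=> hx hy n0 h; have [//|nxy] := leadD HS hx hy.
have [hB|hB] := leadB hx hy; last first.
  have y0 : y = 0.
    by apply: lead_opp_eq0; apply: (lead_trans (lead_N HN)) nxy; apply: (lead_sym HN).
  rewrite y0 in hB; have x0 := lead0r (lead_N HN) hB.
  by move: n0; rewrite x0 y0 subrr eqxx.
apply: (lead_cancel _ hB).
  by apply: contraNneq n0 => e; rewrite subr_sqr e mul0r.
by rewrite mulrC [(x' + _) * _]mulrC -!subr_sqr.
Qed.

Lemma lead_third x y z x' y' z' : x != 0 -> y != 0 -> S x x' -> S y y' ->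
  S (x * y * z) (x' * y' * z') -> S z z'.
Proof.
move=> x0 y0 hx hy h; apply: (lead_cancel (mulf_neq0 x0 y0) (leadM HS hx hy)).
by rewrite mulrC [z' * _]mulrC.
Qed.

Lemma lead_sqr_exists x y : S (x ^+ 2) y -> (exists r, r ^+ 2 = y) ->
  exists2 r, r ^+ 2 = y & S x r.
Proof.
move=> h [r rE]; rewrite -rE in h.
by have [] := lead_sqr HS h; [exists r | exists (- r); rewrite ?sqrrN].
Qed.

(** [N x y] and [N x (- y)] together force [x = y = 0]. Nonvanishing is recorded because the known
    product of three half roots yields the third only when the other two are nonzero. *)
Lemma lead_addsub x y x' y' : S x x' -> S y y' -> (x != 0) || (y != 0) ->
  (S (x - y) (x' - y') /\ x - y != 0) \/ (S (x + y) (x' + y') /\ x + y != 0).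
Proof.
move=> hx hy n0; have [hB|nB] := leadB hx hy; have [hA|nA] := leadD HS hx hy.
- have [e|?] := eqVneq (x - y) 0; last by left.
  right; split=> //; apply: contraTneq n0 => e'.
  have x0 : x = 0.
    by apply: lead_opp_eq0; rewrite {1}(subr0_eq e) (addr0_eq e'); apply: lead_refl.
  by move: e'; rewrite x0 add0r => ->; rewrite eqxx.
- left; split=> //; apply: contraTneq n0 => /subr0_eq e.
  have x0 : x = 0 by apply: lead_opp_eq0; rewrite {2}e.
  by rewrite -e x0 eqxx.
- right; split=> //; apply: contraTneq n0 => /addr0_eq e.
  have x0 : x = 0 by apply: lead_opp_eq0; rewrite e.
  by rewrite -e x0 oppr0 eqxx.
- have x0 := lead_sign (lead_N HN) nB nA.
  rewrite x0 in nB; have y0 := lead0l (lead_N HN) nB.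
  by rewrite x0 y0 eqxx in n0.
Qed.

Lemma lead_sub0 x y x' y' : S x x' -> S y y' -> x = 0 \/ y = 0 ->
  S (x - y) (x' - y').
Proof.
move=> hx hy [] e; rewrite e in hx hy *.
  by rewrite (lead0l HS hx) !sub0r; apply: (leadN HS).
by rewrite (lead0l HS hy) !subr0.
Qed.

End Leading.

Section LeadEquiv.
Variables (L : fieldType) (N : L -> L -> Prop).
Hypothesis HN : lead_equiv N.

Lemma leadN_trans x y z : N x y -> N y z -> N x z.
Proof. by move=> xy yz; exact: (lead_trans (lead_N HN) xy yz). Qed.

(** On residues this is 1 + 1 - 1 = 1. Cancellation in the first sum would mean 1 = -1, and in the
    second 2 = 1. *)
Lemma lead_add_sub x y z : N x y -> N x z -> N (y + z - x) x.
Proof.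
move=> xy xz; have yx := lead_sym HN xy; have zx := lead_sym HN xz.
have zero : x = 0 -> N (y + z - x) x.
  move=> x0; rewrite x0 in xy xz *.
  rewrite (lead0l (lead_N HN) xy) (lead0l (lead_N HN) xz) subr0 addr0.
  exact: lead_refl.
have [h|h] := leadD (lead_N HN) yx zx; last first.
  apply: zero; apply: (lead_opp_eq0 HN); apply: (leadN_trans xy).
  by apply: (leadN_trans h); apply: (leadN (lead_N HN)).
have [|h2] := leadB (lead_N HN) h (lead_refl HN x); first by rewrite addrK.
apply: zero; apply: (lead_double HN); apply: (leadN_trans _ h2).
exact: lead_sym.
Qed.

End LeadEquiv.

(** * The pairing of 2-power torsion points *)

(** Half roots divide by [yc], so points with [yc = 0] form base cases, matched by abscissa. Each
    [thetaS] passes to the double, so that finite derivations reach 2-power torsion only. *)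
Inductive theta C C' (X : matching C C') : mpoint C -> mpoint C' -> Prop :=
| theta0 : theta X 0 0
| thetaT T T' of T != 0 & T' != 0 & yc T = 0 & yc T' = 0 & mrt X (xc T) (xc T') :
    theta X T T'
| thetaS P P' of yc P != 0 & yc P' != 0 & theta X (P *+ 2) (P' *+ 2) &
    (forall e e', mrt X e e' -> mS X (halfroot e P) (halfroot e' P')) :
    theta X P P'.

Lemma theta_flip C C' (X : matching C C') P P' :
  theta X P P' -> theta (matching_flip X) P' P.
Proof.
elim=> {P P'}.
- exact: theta0.
- by move=> T T' *; apply: thetaT.
- move=> P P' y0 y0' _ IH h; apply: thetaS => // e e' /h.
  by move=> /(mS_sym X).
Qed.

Section Theta.
Variables (C C' : mcurve) (X : matching C C').
Local Notation N := (mN X).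
Local Notation S := (mS X).
Local Notation m := (mrt X).
Local Notation G := (mpol C).
Local Notation G' := (mpol C').
Let HN := mN_equiv X.
Let HS := mS_lead X.
Let HNN := lead_N HN.

Lemma mrt_splits a b c : splits3 G a b c -> exists a' b' c',
  [/\ splits3 G' a' b' c', m a a', m b b' & m c c'].
Proof.
move=> s; have rt x := splits3_root x s.
have [|a' ma] := mrt_l X (e := a); first by rewrite rt eqxx.
have [|b' mb] := mrt_l X (e := b); first by rewrite rt eqxx orbT.
have [|c' mc] := mrt_l X (e := c); first by rewrite rt eqxx !orbT.
case: s => _ ab bc ac.
have ab' : a' != b'.
  by apply: contraNneq ab => e; rewrite e in ma; rewrite (mrt_inj ma mb).
have bc' : b' != c'.
  by apply: contraNneq bc => e; rewrite e in mb; rewrite (mrt_inj mb mc).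
have ac' : a' != c'.
  by apply: contraNneq ac => e; rewrite e in ma; rewrite (mrt_inj ma mc).
exists a', b', c'; split=> //.
have [_ ra] := mrt_root ma; have [_ rb] := mrt_root mb; have [_ rc] := mrt_root mc.
have [u [v [w s]]] := mpol_splits C'.
exact: splits3_distinct_roots s ra rb rc ab' bc' ac'.
Qed.

Lemma mrt_case a b c a' b' c' e e' : splits3 G a b c ->
  m a a' -> m b b' -> m c c' -> m e e' ->
  [\/ e = a /\ e' = a', e = b /\ e' = b' | e = c /\ e' = c'].
Proof.
move=> s ma mb mc me; have [re _] := mrt_root me.
move: re; rewrite (splits3_root _ s) => /or3P[] /eqP ee; rewrite ee in me *.
- by rewrite (mrt_fun me ma); constructor 1.
- by rewrite (mrt_fun me mb); constructor 2.
- by rewrite (mrt_fun me mc); constructor 3.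
Qed.

Lemma theta_torsion P P' : theta X P P' -> exists n, P *+ (2 ^ n) = 0.
Proof.
elim=> {P P'}.
- by exists 0%N; rewrite mulr1n.
- by move=> T T' _ _ /eqP y0 _ _; exists 1%N; apply/eqP; rewrite yc_double.
- by move=> P P' _ _ _ [n IH] _; exists n.+1; rewrite expnS mulrnA.
Qed.

Lemma theta_opp P P' : theta X P P' -> theta X (- P) (- P').
Proof.
elim=> {P P'}.
- by rewrite !oppr0; apply: theta0.
- move=> T T' T0 T0' y0 y0' h; apply: thetaT; rewrite ?oppr_eq0 ?xc_opp ?yc_opp //.
    by rewrite y0 oppr0.
  by rewrite y0' oppr0.
- move=> P P' y0 y0' _ IH h; apply: thetaS; rewrite ?mulNrn ?yc_opp ?oppr_eq0 //.
  by move=> e e' /h; rewrite !halfroot_opp; apply: (leadN HS).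
Qed.

Lemma theta_double P P' : theta X P P' -> theta X (P *+ 2) (P' *+ 2).
Proof.
case=> {P P'} //.
- by rewrite !mul0rn; apply: theta0.
move=> T T' _ _ /eqP; rewrite -yc_double => /eqP -> /eqP.
by rewrite -yc_double => /eqP -> _; apply: theta0.
Qed.

Lemma theta_neq0 P P' : theta X P P' -> P != 0 -> P' != 0.
Proof.
case=> {P P'} //; first by rewrite eqxx.
move=> P P' _ y0' _ _ _; apply: contraNneq y0' => ->.
by rewrite -yc_double mul0rn eqxx.
Qed.

Lemma theta_neq0r P P' : theta X P P' -> P' != 0 -> P != 0.
Proof.
case=> {P P'} //; first by rewrite eqxx.
move=> P P' y0 _ _ _ _; apply: contraNneq y0 => ->.
by rewrite -yc_double mul0rn eqxx.
Qed.

(** This feeds the next halving: the [xc P - e] are the squares of the half roots of a half of [P],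
    and [yc P] is their product. *)
Lemma theta_data P P' : theta X P P' -> P != 0 ->
  (forall e e', m e e' -> S (xc P - e) (xc P' - e')) /\ S (yc P) (yc P').
Proof.
case=> {P P'}; first by rewrite eqxx.
  move=> T T' T0 T0' -> -> mT _; split; last exact: (lead00 HS).
  move=> e e' me; have [ee|ne] := eqVneq (xc T) e.
    by rewrite -ee in me *; rewrite (mrt_fun me mT) !subrr; apply: (lead00 HS).
  exact: mrt_diff.
move=> P P' y0 y0' _ h _.
have key a b c a' b' c' : splits3 G a b c -> splits3 G' a' b' c' ->
    m a a' -> m b b' -> m c c' ->
    S (halfroot a P + halfroot b P) (halfroot a' P' + halfroot b' P').
  move=> s s' ma mb mc; apply: (lead_add_of_sqr HN HS); do ?exact: h.
  - have [_ _ [bE _]] := halfroot_coords s y0.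
    have -> : halfroot a P ^+ 2 - halfroot b P ^+ 2 = b - a by rewrite {2}bE; ring.
    by rewrite subr_eq0 eq_sym; case: s.
  - have [_ _ [bE _]] := halfroot_coords s y0.
    have [_ _ [bE' _]] := halfroot_coords s' y0'.
    have -> : halfroot a P ^+ 2 - halfroot b P ^+ 2 = b - a by rewrite {2}bE; ring.
    have -> : halfroot a' P' ^+ 2 - halfroot b' P' ^+ 2 = b' - a'.
      by rewrite {2}bE'; ring.
    by apply: mrt_diff => //; rewrite eq_sym; case: s.
have [a [b [c s]]] := mpol_splits C.
have [a' [b' [c' [s' ma mb mc]]]] := mrt_splits s.
have [xE yE _] := halfroot_coords s y0.
have [xE' yE' _] := halfroot_coords s' y0'.
have Sab := key _ _ _ _ _ _ s s' ma mb mc.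
have Sbc := key _ _ _ _ _ _ (splits3_rot s) (splits3_rot s') mb mc ma.
have Sca := key _ _ _ _ _ _ (splits3_rot (splits3_rot s))
  (splits3_rot (splits3_rot s')) mc ma mb.
split; last by rewrite yE yE'; do 2! apply: (leadM HS) => //.
move=> e e' me; have [re re'] := mrt_root me.
have [f [g t]] := splits3_complete s re.
have [e1 [f' [g' [t' me1 mf mg]]]] := mrt_splits t.
have ee := mrt_fun me me1; subst e1.
have [-> _ _] := halfroot_coords t y0; have [-> _ _] := halfroot_coords t' y0'.
have Sef := key _ _ _ _ _ _ t t' me mf mg.
have Sge := key _ _ _ _ _ _ (splits3_swap t) (splits3_swap t') me mg mf.
set u := _ + _ in Sef *; set v := _ + _ in Sge *.
have -> : e + u * v - e = u * v by rewrite addrC addKr.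
rewrite [e' + _]addrC addrK; exact: (leadM HS).
Qed.

Lemma theta_step P P' : theta X P P' -> yc P != 0 ->
  [/\ yc P' != 0, theta X (P *+ 2) (P' *+ 2) &
    forall e e', m e e' -> S (halfroot e P) (halfroot e' P')].
Proof.
case=> {P P'} //; first by rewrite /yc mval0 eqxx.
by move=> T T' _ _ ->; rewrite eqxx.
Qed.

Lemma theta_tors2 P P' : theta X P P' -> P != 0 -> yc P = 0 ->
  [/\ P' != 0, yc P' = 0 & m (xc P) (xc P')].
Proof.
case=> {P P'} //; first by rewrite eqxx.
by move=> P P' y0 _ _ _ _ /eqP; rewrite (negbTE y0).
Qed.

(** Inductively the doubles agree, so the half roots agree up to sign, and opposite signs would give
    opposite leading terms. *)
Lemma theta_fun P P1 P2 : theta X P P1 -> theta X P P2 -> P1 = P2.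
Proof.
move=> h; elim: h P2 => {P P1}.
- move=> P2 h; apply/eqP; apply: contraT; rewrite eq_sym => P2n.
  by have := theta_neq0r h P2n; rewrite eqxx.
- move=> T T' T0 T0' y0 y0' mT P2 /theta_tors2 -/(_ T0 y0)[P20 y20 m2].
  by apply: mval_inj; rewrite !mval_neq0 // (mrt_fun mT m2) y0' y20.
- move=> P P' y0 y0' th IH hr P2 /theta_step -/(_ y0)[H0 H1 H2].
  have d2 := IH _ H1.
  have [a [b [c s]]] := mpol_splits C.
  have [a' [b' [c' [s' ma mb mc]]]] := mrt_splits s.
  have key e f g e' f' g' : splits3 G e f g -> splits3 G' e' f' g' -> m e e' -> halfroot e' P' = halfroot e' P2.
    move=> t t' me; have [x1 _] := halfroot_double t' y0'.
    have [x2 _] := halfroot_double t' H0.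
    rewrite d2 x2 in x1; move/addrI/eqP: x1; rewrite eqf_sqr => /orP[] /eqP // e2.
    have S1 := hr _ _ me; have := H2 _ _ me; rewrite e2 => S2.
    have := lead_sign HS S1 S2 => e0; rewrite e0 in S1 S2.
    by rewrite (lead0l HS S1) oppr0.
  apply: (halfroot_inj s') => //.
  + exact: key s s' ma.
  + exact: key (splits3_rot s) (splits3_rot s') mb.
  + exact: key (splits3_rot (splits3_rot s)) (splits3_rot (splits3_rot s')) mc.
Qed.

Lemma theta_total n P : P *+ (2 ^ n) = 0 -> exists P', theta X P P'.
Proof.
elim: n P => [|n IH] P; first by rewrite mulr1n => ->; exists 0; apply: theta0.
rewrite expnS mulrnA => tP.
have [->|P0] := eqVneq P 0; first by exists 0; apply: theta0.
have [y0|y0] := eqVneq (yc P) 0.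
  have [|r _] := @tpoint_root _ P P0; first by apply/eqP; rewrite yc_double y0.
  have [e' me] := mrt_l X r; have [_ r'] := mrt_root me.
  have [T [T0 xT yT]] := tpoint_exists r'.
  by exists T; apply: thetaT => //; rewrite xT.
have [Q' th] := IH _ tP.
have P20 : P *+ 2 != 0 by rewrite yc_double.
have Q0 := theta_neq0 th P20; have [hx hy] := theta_data th P20.
have [a [b [c s]]] := mpol_splits C.
have [a' [b' [c' [s' ma mb mc]]]] := mrt_splits s.
have key e f g e' : splits3 G e f g -> m e e' ->
    exists2 r, r ^+ 2 = xc Q' - e' & S (halfroot e P) r.
  move=> t me; apply: (lead_sqr_exists HS); last exact: mfield_sqrt.
  have := hx _ _ me; have [-> _] := halfroot_double t y0.
  by rewrite [e + _]addrC addrK.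
have [p pE Sp] := key _ _ _ _ s ma.
have [q qE Sq] := key _ _ _ _ (splits3_rot s) mb.
have [r rE Sr] := key _ _ _ _ (splits3_rot (splits3_rot s)) mc.
have hv : halves a' b' c' p q r by split; rewrite ?pE ?qE ?rE; ring.
have [P' [yP' ep eq er]] := halves_exist s' hv.
have [x2 y2] := halfroot_double s' yP'; rewrite ep eq er in x2 y2.
have pqr : p * q * r = yc Q'.
  have [_ yE] := halfroot_double s y0.
  have Sy : S (yc (P *+ 2)) (p * q * r) by rewrite yE; do ?apply: (leadM HS).
  (* The square roots were chosen independently, so their product is [yc Q'] only up to sign. Both
     have the leading term of [yc (P *+ 2)], so a wrong sign forces zero, where it is harmless. *)
  have /eqP : (p * q * r) ^+ 2 = yc Q' ^+ 2.
    by rewrite !exprMn pE qE rE mpoint_eqn // (splits3_horner _ s').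
  rewrite eqf_sqr => /orP[] /eqP // e; rewrite e in Sy *.
  have y20 := lead_sign HS hy Sy; rewrite y20 in hy.
  by rewrite (lead0l HS hy) oppr0.
exists P'; apply: thetaS => //.
  suff -> : P' *+ 2 = Q' by [].
  apply: mval_inj; rewrite !mval_neq0 ?yc_double // x2 y2 pqr pE.
  by rewrite addrC subrK.
move=> e e' me; have [[-> ->]|[-> ->]|[-> ->]] := mrt_case s ma mb mc me.
- by rewrite ep.
- by rewrite eq.
- by rewrite er.
Qed.

(* The hypotheses say that [D] is close to the point at infinity; this is preserved
   by doubling, as 2 is a unit in the residue field. *)
Lemma not_near_infinity n (D : mpoint C) a b c : splits3 G a b c ->
  D *+ (2 ^ n) = 0 -> D != 0 ->
  N (xc D - a) (xc D - b) -> N (xc D - a) (xc D - c) -> False.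
Proof.
elim: n D => [|n IH] D s; first by rewrite mulr1n => ->; rewrite eqxx.
rewrite expnS mulrnA => tD D0 Nab Nac.
have [_ ab _ ac] := s.
have na : xc D - a != 0.
  apply: contraNneq ab => e; rewrite e in Nab.
  by rewrite -(subr0_eq e) (subr0_eq (lead0l HNN Nab)).
have nb : xc D - b != 0 by rewrite -(lead_eq0 HNN Nab).
have nc : xc D - c != 0 by rewrite -(lead_eq0 HNN Nac).
have y0 : yc D != 0.
  by rewrite -sqrf_eq0 mpoint_eqn // (splits3_horner _ s) !mulf_neq0.
have D20 : D *+ 2 != 0 by rewrite yc_double.
have Nba := lead_sym HN Nab; have Nca := lead_sym HN Nac.
have div u v : N u v -> N (yc D / u) (yc D / v).
  by move=> uv; apply: (leadM HNN); [apply: (lead_refl HN) | apply: (leadV HNN)].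
have s1 := splits3_rot s; have s2 := splits3_rot s1.
have rt e f g : splits3 G e f g -> N (xc D - e) (xc D - f) -> N (xc D - e) (xc D - g) ->
    N (2%:R * halfroot e D) (yc D / (xc D - e)).
  move=> t Nef Neg; rewrite (halfrootE t y0).
  by apply: (lead_add_sub HN); apply: div.
have ra := rt _ _ _ s Nab Nac.
have rb := rt _ _ _ s1 (leadN_trans HN Nba Nac) Nba.
have rc := rt _ _ _ s2 Nca (leadN_trans HN Nca Nab).
have fin u v e f : N (2%:R * u) (yc D / (xc D - e)) -> N (2%:R * v) (yc D / (xc D - f)) ->
    N (xc D - e) (xc D - f) -> N (u ^+ 2) (v ^+ 2).
  move=> hu hv hef; have huv : N (2%:R * u) (2%:R * v).
    apply: (leadN_trans HN hu); apply: (leadN_trans HN (div _ _ hef)).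
    exact: lead_sym.
  have {}huv : N u v.
    apply: (lead_cancel HNN (mfield2 C) (lead_refl HN _)).
    by rewrite mulrC [v * _]mulrC.
  by rewrite !expr2; apply: (leadM HNN).
have [xa _] := halfroot_double s y0.
have [xb _] := halfroot_double s1 y0.
have [xc' _] := halfroot_double s2 y0.
have sub e (u v : C) : u = e + v -> u - e = v by move=> ->; rewrite addrC addKr.
apply: (IH (D *+ 2) s tD D20).
  by rewrite (sub _ _ _ xa) (sub _ _ _ xb); apply: fin ra rb Nab.
by rewrite (sub _ _ _ xa) (sub _ _ _ xc'); apply: fin ra rc Nac.
Qed.

(** In the addition formula for [P + (- Q)] the two triple products then have the same leading term,
    that of the product [pi] of the half roots of [P], and they add up. So each half root of
    [P - Q], times [D], looks like [pi + pi]; the three have one common leading term, and squaring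
    them puts [2(P - Q)] near infinity. *)
Lemma halfroots_separate n (P Q : mpoint C) a b c : splits3 G a b c ->
  P *+ (2 ^ n) = 0 -> Q *+ (2 ^ n) = 0 -> yc P != 0 -> yc Q != 0 ->
  N (halfroot a P) (halfroot a Q) -> N (halfroot b P) (halfroot b Q) ->
  N (halfroot c P) (halfroot c Q) -> xc (P *+ 2) = xc (Q *+ 2).
Proof.
move=> s tP tQ yP yQ Na Nb Nc; apply/eqP; apply: contraT => nx.
have yQ' : yc (- Q) != 0 by rewrite yc_opp oppr_eq0.
have nx' : xc ((- Q) *+ 2) != xc (P *+ 2) by rewrite mulNrn xc_opp eq_sym.
have s1 := splits3_rot s; have s2 := splits3_rot s1.
set D := xc ((- Q) *+ 2) - xc (P *+ 2).
have D0 : D != 0 by rewrite subr_eq0.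
set pi := halfroot a P * halfroot b P * halfroot c P.
have nz e f g : splits3 G e f g -> N (halfroot e P) (halfroot e Q) -> halfroot e P != 0.
  move=> t h; apply: contraNneq nx => e0; rewrite e0 in h.
  have [-> _] := halfroot_double t yP; have [-> _] := halfroot_double t yQ.
  by rewrite e0 (lead0l HNN h).
have pi0 : pi != 0 by rewrite !mulf_neq0 ?(nz _ _ _ s) ?(nz _ _ _ s1) ?(nz _ _ _ s2).
have key e f g : splits3 G e f g ->
    halfroot e P * halfroot f P * halfroot g P = pi ->
    N (halfroot e P) (halfroot e Q) -> N (halfroot f P) (halfroot f Q) ->
    N (halfroot g P) (halfroot g Q) -> N (halfroot e (P - Q) * D) (pi + pi).
  move=> t piE Ne Nf Ng; have [_ ->] := halfroot_add t yP yQ' nx'.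
  rewrite !halfroot_opp.
  set x := _ * - _ * - _; set y := _ * _ * _.
  have xE : x = halfroot e P * halfroot f Q * halfroot g Q by rewrite /x; ring.
  have yE : - y = halfroot e Q * halfroot f P * halfroot g P by rewrite /y; ring.
  rewrite xE yE.
  have Nx : N (halfroot e P * halfroot f Q * halfroot g Q) pi.
    rewrite -piE; do ?apply: (leadM HNN); do ?exact: (lead_refl HN);
    exact: lead_sym.
  have Ny : N (halfroot e Q * halfroot f P * halfroot g P) pi.
    rewrite -piE; do ?apply: (leadM HNN); do ?exact: (lead_refl HN);
    exact: lead_sym.
  have [//|h] := leadD HNN Nx Ny.
  case/eqP: pi0; apply: (lead_opp_eq0 HN).
  apply: (leadN_trans HN (lead_sym HN Nx)); apply: (leadN_trans HN h).
  exact: (leadN HNN).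
have ka := key _ _ _ s erefl Na Nb Nc.
have kb : N (halfroot b (P - Q) * D) (pi + pi).
  by apply: (key _ _ _ s1) => //; rewrite /pi; ring.
have kc : N (halfroot c (P - Q) * D) (pi + pi).
  by apply: (key _ _ _ s2) => //; rewrite /pi; ring.
have can u v : N (u * D) (pi + pi) -> N (v * D) (pi + pi) -> N (u ^+ 2) (v ^+ 2).
  move=> hu hv; have huv : N u v.
    apply: (lead_cancel HNN D0 (lead_refl HN _)).
    by apply: (leadN_trans HN hu); apply: lead_sym.
  by rewrite !expr2; apply: (leadM HNN).
have [yD _] := halfroot_add s yP yQ' nx'.
have tD : (P - Q) *+ 2 *+ (2 ^ n) = 0.
  by rewrite -mulrnA mulnC mulrnA mulrnBl tP tQ subrr mul0rn.
have D20 : (P - Q) *+ 2 != 0 by rewrite yc_double.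
exfalso; apply: (not_near_infinity s tD D20);
  have sub e (u v : C) : u = e + v -> u - e = v by [move=> ->; rewrite addrC addKr | move=> ->; rewrite addrC addKr].
  rewrite (sub _ _ _ (halfroot_double s yD).1) (sub _ _ _ (halfroot_double s1 yD).1).
  exact: can.
rewrite (sub _ _ _ (halfroot_double s yD).1) (sub _ _ _ (halfroot_double s2 yD).1).
exact: can.
Qed.

End Theta.

Lemma theta_inj C C' (X : matching C C') P Q P' :
  theta X P P' -> theta X Q P' -> P = Q.
Proof. by move=> /theta_flip h /theta_flip; apply: theta_fun. Qed.

(** * Additivity of the pairing *)

Section ThetaAdd.
Variables (C C' : mcurve) (X : matching C C').
Local Notation N := (mN X).
Local Notation S := (mS X).
Local Notation m := (mrt X).
Local Notation G := (mpol C).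
Local Notation G' := (mpol C').
Local Notation theta := (theta X).
Let HN := mN_equiv X.
Let HS := mS_lead X.
Let HNN := lead_N HN.

Lemma theta_xc_neq (P Q : mpoint C) (P' Q' : mpoint C') :
  theta P P' -> theta Q Q' -> P != 0 -> Q != 0 -> xc Q != xc P -> xc Q' != xc P'.
Proof.
move=> hP hQ P0 Q0 nx; apply: contraNneq nx => /esym e.
have P0' := theta_neq0 hP P0; have Q0' := theta_neq0 hQ Q0.
have [e'|e'] := xc_inj P0' Q0' e; rewrite e' in hQ.
  by rewrite (theta_inj hP hQ).
by rewrite -(theta_inj (theta_opp hP) hQ) xc_opp.
Qed.

(** The difference is [(Re Q - Re P)(Re Q + Re P)] for every root [e], and one root without
    cancellation suffices. Otherwise each half root of [Q] has the leading term of plus or minus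
    that of [P], which [halfroots_separate] excludes. *)
Lemma theta_xc_diff P Q P' Q' : theta P P' -> theta Q Q' ->
  yc P != 0 -> yc Q != 0 -> xc (Q *+ 2) != xc (P *+ 2) ->
  S (xc (Q *+ 2) - xc (P *+ 2)) (xc (Q' *+ 2) - xc (P' *+ 2)).
Proof.
move=> hP hQ yP yQ nx.
have [yP' _ rP] := theta_step hP yP; have [yQ' _ rQ] := theta_step hQ yQ.
have [a [b [c s]]] := mpol_splits C.
have [a' [b' [c' [s' ma mb mc]]]] := mrt_splits X s.
have key e f g e' f' g' : splits3 G e f g -> splits3 G' e' f' g' -> m e e' ->
    S (xc (Q *+ 2) - xc (P *+ 2)) (xc (Q' *+ 2) - xc (P' *+ 2)) \/
    exists r, r ^+ 2 = halfroot e P ^+ 2 /\ N (halfroot e Q) r.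
  move=> t t' me; have [-> _] := halfroot_double t yP.
  have [-> _] := halfroot_double t yQ; have [-> _] := halfroot_double t' yP'.
  have [-> _] := halfroot_double t' yQ'.
  have dd (F : fieldType) (x y z : F) : x + y ^+ 2 - (x + z ^+ 2) = (y - z) * (y + z) by ring.
  rewrite !dd.
  have [hB|hB] := leadB HS (rQ _ _ me) (rP _ _ me); last first.
    by right; exists (halfroot e P).
  have [hA|hA] := leadD HS (rQ _ _ me) (rP _ _ me); last first.
    by right; exists (- halfroot e P); rewrite sqrrN.
  by left; apply: (leadM HS).
have s1 := splits3_rot s; have s2 := splits3_rot s1.
have [//|[p [pE Np]]] := key _ _ _ _ _ _ s s' ma.
have [//|[q [qE Nq]]] := key _ _ _ _ _ _ s1 (splits3_rot s') mb.
have [//|[r [rE Nr]]] := key _ _ _ _ _ _ s2 (splits3_rot (splits3_rot s')) mc.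
have [_ _ [bE cE]] := halfroot_coords s yP.
(* The signs are absorbed into a new point [P1]: [halves] involves squares only, so the half roots
   of [P] with changed signs are again those of a point, whose double is [2P] or [- 2P]. *)
have hv : halves a b c p q r by split; rewrite pE ?qE ?rE.
have [P1 [yP1 ep eq er]] := halves_exist s hv.
have [xP _] := halfroot_double s yP; have [xP1 _] := halfroot_double s yP1.
have eP1 : xc (P1 *+ 2) = xc (P *+ 2) by rewrite xP xP1 ep pE.
have [i tP] := theta_torsion hP; have [j tQ] := theta_torsion hQ.
have tP1 : P1 *+ (2 ^ i.+1) = 0.
  rewrite expnS mulrnA; have [||->|->] := @xc_inj _ (P *+ 2) (P1 *+ 2) _ _ (esym eP1);
    rewrite ?yc_double //.
    by rewrite -mulrnA mulnC mulrnA tP mul0rn.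
  by rewrite mulNrn -mulrnA mulnC mulrnA tP mul0rn oppr0.
case/eqP: nx; rewrite -eP1.
apply: (@halfroots_separate _ _ X (i.+1 + j) _ _ _ _ _ s) => //.
- by rewrite expnD mulnC mulrnA tQ mul0rn.
- by rewrite expnD mulrnA tP1 mul0rn.
- by rewrite ep.
- by rewrite eq.
- by rewrite er.
Qed.

Lemma theta_halfroots P P' a b c a' b' c' :
  splits3 G a b c -> m a a' -> m b b' -> m c c' ->
  yc P != 0 -> yc P' != 0 -> theta (P *+ 2) (P' *+ 2) ->
  S (halfroot a P) (halfroot a' P') -> S (halfroot b P) (halfroot b' P') ->
  S (halfroot c P) (halfroot c' P') -> theta P P'.
Proof.
move=> s ma mb mc y0 y0' h2 ha hb hc; apply: thetaS => // e e' me.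
by have [[-> ->]|[-> ->]|[-> ->]] := mrt_case s ma mb mc me.
Qed.

(** The product of the three half roots is [yc (P *+ 2)], whose leading term is known from the
    double; dividing by two nonzero factors gives the third. *)
Lemma theta_halfroots2 P P' a b c a' b' c' :
  splits3 G a b c -> splits3 G' a' b' c' -> m a a' -> m b b' -> m c c' ->
  yc P != 0 -> yc P' != 0 -> theta (P *+ 2) (P' *+ 2) ->
  halfroot a P != 0 -> halfroot b P != 0 ->
  S (halfroot a P) (halfroot a' P') -> S (halfroot b P) (halfroot b' P') ->
  theta P P'.
Proof.
move=> s s' ma mb mc y0 y0' h2 na nb ha hb.
apply: (theta_halfroots s ma mb mc) => //.
apply: (lead_third HS na nb ha hb).
have [_ <-] := halfroot_double s y0; have [_ <-] := halfroot_double s' y0'.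
by have [|] := theta_data h2 _; rewrite ?yc_double.
Qed.

(** Each root is good for the sum or for the difference. By the pigeonhole principle two of the
    three roots are good for the same one, and two are enough by [theta_halfroots2]. *)
Lemma theta_add_or_sub_generic P Q P' Q' : theta P P' -> theta Q Q' ->
  yc P != 0 -> yc Q != 0 -> xc (Q *+ 2) != xc (P *+ 2) ->
  theta ((P + Q) *+ 2) ((P' + Q') *+ 2) -> theta ((P - Q) *+ 2) ((P' - Q') *+ 2) ->
  theta (P + Q) (P' + Q') \/ theta (P - Q) (P' - Q').
Proof.
move=> hP hQ yP yQ nx hA hB.
have [yP' h2P rP] := theta_step hP yP; have [yQ' h2Q rQ] := theta_step hQ yQ.
have P20 : P *+ 2 != 0 by rewrite yc_double.
have Q20 : Q *+ 2 != 0 by rewrite yc_double.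
have nx' := theta_xc_neq h2P h2Q P20 Q20 nx.
have SD := theta_xc_diff hP hQ yP yQ nx.
set D := xc (Q *+ 2) - xc (P *+ 2) in SD.
set D' := xc (Q' *+ 2) - xc (P' *+ 2) in SD.
have D0 : D != 0 by rewrite subr_eq0.
have yNQ : yc (- Q) != 0 by rewrite yc_opp oppr_eq0.
have yNQ' : yc (- Q') != 0 by rewrite yc_opp oppr_eq0.
have nNx : xc ((- Q) *+ 2) != xc (P *+ 2) by rewrite mulNrn xc_opp.
have nNx' : xc ((- Q') *+ 2) != xc (P' *+ 2) by rewrite mulNrn xc_opp.
have [a [b [c s]]] := mpol_splits C.
have [a' [b' [c' [s' ma mb mc]]]] := mrt_splits X s.
have [yA _] := halfroot_add s yP yQ nx; have [yA' _] := halfroot_add s' yP' yQ' nx'.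
have [yB _] := halfroot_add s yP yNQ nNx; have [yB' _] := halfroot_add s' yP' yNQ' nNx'.
pose al e f g := halfroot e P * halfroot f Q * halfroot g Q.
pose be e f g := halfroot e Q * halfroot f P * halfroot g P.
pose al' e f g := halfroot e P' * halfroot f Q' * halfroot g Q'.
pose be' e f g := halfroot e Q' * halfroot f P' * halfroot g P'.
have addE e f g : splits3 G e f g -> halfroot e (P + Q) * D = al e f g - be e f g.
  by move=> t; have [_ ->] := halfroot_add t yP yQ nx.
have addE' e f g : splits3 G' e f g -> halfroot e (P' + Q') * D' = al' e f g - be' e f g.
  by move=> t; have [_ ->] := halfroot_add t yP' yQ' nx'.
have DN : xc ((- Q) *+ 2) - xc (P *+ 2) = D by rewrite mulNrn xc_opp.
have DN' : xc ((- Q') *+ 2) - xc (P' *+ 2) = D' by rewrite mulNrn xc_opp.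
have subE e f g : splits3 G e f g -> halfroot e (P - Q) * D = al e f g + be e f g.
  move=> t; have [_] := halfroot_add t yP yNQ nNx; rewrite DN => ->.
  by rewrite !halfroot_opp /al /be; ring.
have subE' e f g : splits3 G' e f g -> halfroot e (P' - Q') * D' = al' e f g + be' e f g.
  move=> t; have [_] := halfroot_add t yP' yNQ' nNx'; rewrite DN' => ->.
  by rewrite !halfroot_opp /al' /be'; ring.
have Sal e f g e' f' g' : m e e' -> m f f' -> m g g' -> S (al e f g) (al' e' f' g').
  by move=> *; do ?apply: (leadM HS); auto.
have Sbe e f g e' f' g' : m e e' -> m f f' -> m g g' -> S (be e f g) (be' e' f' g').
  by move=> *; do ?apply: (leadM HS); auto.
pose good e e' := S (halfroot e (P + Q)) (halfroot e' (P' + Q')) /\ halfroot e (P + Q) != 0.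
pose goodN e e' := S (halfroot e (P - Q)) (halfroot e' (P' - Q')) /\ halfroot e (P - Q) != 0.
have key e f g e' f' g' : splits3 G e f g -> splits3 G' e' f' g' ->
    m e e' -> m f f' -> m g g' ->
    [\/ good e e', goodN e e' | al e f g = 0 /\ be e f g = 0].
  move=> t t' me mf mg.
  have Sa := Sal _ _ _ _ _ _ me mf mg; have Sb := Sbe _ _ _ _ _ _ me mf mg.
  have [|] := boolP ((al e f g != 0) || (be e f g != 0)); last first.
    by rewrite negb_or !negbK => /andP[/eqP ? /eqP ?]; constructor 3.
  move=> /(lead_addsub HN HS Sa Sb)[].
    rewrite -(addE _ _ _ t) -(addE' _ _ _ t') => -[h n]; constructor 1; split.
      exact: (lead_cancel HS D0 SD h).
    by apply: contraNneq n => ->; rewrite mul0r.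
  rewrite -(subE _ _ _ t) -(subE' _ _ _ t') => -[h n]; constructor 2; split.
    exact: (lead_cancel HS D0 SD h).
  by apply: contraNneq n => ->; rewrite mul0r.
have s1 := splits3_rot s; have s2 := splits3_rot s1.
have s1' := splits3_rot s'; have s2' := splits3_rot s1'.
(* A double zero forces [P] and [Q] to have order 4, and then no cancellation
   occurs at all. *)
have zero e f g e' f' g' : splits3 G e f g -> splits3 G' e' f' g' ->
    m e e' -> m f f' -> m g g' -> al e f g = 0 -> be e f g = 0 ->
    theta (P + Q) (P' + Q').
  move=> t t' me mf mg.
  have diff u v w : splits3 G u v w -> halfroot u P = 0 -> halfroot u Q = 0 -> False.
    move=> tu uP uQ; case/eqP: nx.
    have [-> _] := halfroot_double tu yP; have [-> _] := halfroot_double tu yQ.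
    by rewrite uP uQ.
  have one R u v w : yc R != 0 -> splits3 G u v w -> halfroot u R = 0 -> halfroot v R = 0 -> False.
    move=> yR tu uR vR; have [_ _ [uv _]] := halfroot_coords tu yR.
    by case: tu => _ /eqP; rewrite uv uR vR expr0n addr0 subr0.
  have t1 := splits3_rot t; have t2 := splits3_rot t1.
  have t1' := splits3_rot t'; have t2' := splits3_rot t1'.
  have sub0 u v w u' v' w' : splits3 G u v w -> splits3 G' u' v' w' -> m u u' -> m v v' -> m w w' ->
      al u v w = 0 \/ be u v w = 0 -> S (halfroot u (P + Q)) (halfroot u' (P' + Q')).
    move=> tu tu' mu mv mw /(lead_sub0 HS) h.
    apply: (lead_cancel HS D0 SD); rewrite (addE _ _ _ tu) (addE' _ _ _ tu').
    by apply: h; [apply: Sal | apply: Sbe].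
  have fin u v w u' v' w' : splits3 G u v w -> splits3 G' u' v' w' -> m u u' -> m v v' -> m w w' ->
      halfroot v Q = 0 -> halfroot w P = 0 -> theta (P + Q) (P' + Q').
    move=> tu tu' mu mv mw vQ wP.
    have tu1 := splits3_rot tu; have tu2 := splits3_rot tu1.
    have tu1' := splits3_rot tu'; have tu2' := splits3_rot tu1'.
    apply: (theta_halfroots tu mu mv mw) => //.
    - by apply: (sub0 _ _ _ _ _ _ tu tu' mu mv mw); left; rewrite /al vQ mulr0 mul0r.
    - by apply: (sub0 _ _ _ _ _ _ tu1 tu1' mv mw mu); right; rewrite /be vQ !mul0r.
    - by apply: (sub0 _ _ _ _ _ _ tu2 tu2' mw mu mv); left; rewrite /al wP !mul0r.
  (* Nine choices of a vanishing factor in each product. [P] and [Q] cannot vanish at a common root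
     ([diff]), nor one point at two roots ([one]); there remains [Q] vanishing at one of [f], [g]
     and [P] at the other. Then at every root one of the two products is zero. *)
  move=> /eqP; rewrite !mulf_eq0 -orbA => /or3P[] /eqP e1;
  move=> /eqP; rewrite !mulf_eq0 -orbA => /or3P[] /eqP e2.
  - by case: (diff _ _ _ t).
  - by case: (one P _ _ _ yP t).
  - by case: (one P _ _ _ yP (splits3_swap t)).
  - by case: (one Q _ _ _ yQ t).
  - by case: (diff _ _ _ t1).
  - exact: (fin _ _ _ _ _ _ t t' me mf mg).
  - by case: (one Q _ _ _ yQ (splits3_swap t)).
  - exact: (fin _ _ _ _ _ _ (splits3_swap t) (splits3_swap t') me mg mf).
  - by case: (diff _ _ _ t2).
have yes u v w u' v' w' : splits3 G u v w -> splits3 G' u' v' w' -> m u u' -> m v v' -> m w w' ->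
    good u u' -> good v v' -> theta (P + Q) (P' + Q').
  move=> tu tu' mu mv mw [h1 n1] [h2 n2].
  exact: (theta_halfroots2 tu tu' mu mv mw).
have no u v w u' v' w' : splits3 G u v w -> splits3 G' u' v' w' -> m u u' -> m v v' -> m w w' ->
    goodN u u' -> goodN v v' -> theta (P - Q) (P' - Q').
  move=> tu tu' mu mv mw [h1 n1] [h2 n2].
  exact: (theta_halfroots2 tu tu' mu mv mw).
have [ga|ga|[a1 a2]] := key _ _ _ _ _ _ s s' ma mb mc; last first.
- by left; apply: (zero _ _ _ _ _ _ s s').
- have [gb|gb|[b1 b2]] := key _ _ _ _ _ _ s1 s1' mb mc ma; last first.
  + by left; apply: (zero _ _ _ _ _ _ s1 s1').
  + by right; apply: (no _ _ _ _ _ _ s s').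
  have [gc|gc|[c1 c2]] := key _ _ _ _ _ _ s2 s2' mc ma mb; last first.
  + by left; apply: (zero _ _ _ _ _ _ s2 s2').
  + by right; apply: (no _ _ _ _ _ _ s2 s2').
  by left; apply: (yes _ _ _ _ _ _ s1 s1').
have [gb|gb|[b1 b2]] := key _ _ _ _ _ _ s1 s1' mb mc ma; last first.
- by left; apply: (zero _ _ _ _ _ _ s1 s1').
- have [gc|gc|[c1 c2]] := key _ _ _ _ _ _ s2 s2' mc ma mb; last first.
  + by left; apply: (zero _ _ _ _ _ _ s2 s2').
  + by right; apply: (no _ _ _ _ _ _ s1 s1').
  by left; apply: (yes _ _ _ _ _ _ s2 s2').
by left; apply: (yes _ _ _ _ _ _ s s').
Qed.

(** On both curves translation changes the signs of corresponding half roots, by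
    [halfroot_translate]. If [Q] also has order 2 and differs from [T], the sum is the point above
    the remaining root. *)
Lemma theta_add_tors2 Q Q' T T' : theta Q Q' -> theta T T' -> T *+ 2 = 0 ->
  theta (Q + T) (Q' + T').
Proof.
move=> hQ hT T2; have [T0|T0] := eqVneq T 0.
  rewrite T0 in hT *; have := theta_fun (theta0 X) hT => <-.
  by rewrite !addr0.
have [Q0|Q0] := eqVneq Q 0.
  rewrite Q0 in hQ *; have := theta_fun (theta0 X) hQ => <-.
  by rewrite !add0r.
have [rT yT] := tpoint_root T0 T2.
have [T0' yT' mT] := theta_tors2 hT T0 yT.
have [yQ|yQ] := eqVneq (yc Q) 0; last first.
  have [yQ' h2 rQ] := theta_step hQ yQ.
  have [b [c s]] : exists b c, splits3 G (xc T) b c.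
    by have [u [v [w t]]] := mpol_splits C; exact: splits3_complete t rT.
  have [t' [b' [c' [s' mt mb mc]]]] := mrt_splits X s.
  have e := mrt_fun mt mT; subst t'.
  have [y1 ha hb hc] := halfroot_translate s yQ T0 erefl yT.
  have [y1' ha' hb' hc'] := halfroot_translate s' yQ' T0' erefl yT'.
  apply: (theta_halfroots s mt mb mc) => //.
  - rewrite !mulrnDl T2 addr0; have /eqP -> : T' *+ 2 == 0 by rewrite yc_double yT'.
    by rewrite addr0.
  - by rewrite ha ha'; apply: rQ.
  - by rewrite hb hb'; apply: (leadN HS); apply: rQ.
  - by rewrite hc hc'; apply: (leadN HS); apply: rQ.
have [Q0' yQ' mQ] := theta_tors2 hQ Q0 yQ.
have Q2 : Q *+ 2 = 0 by apply/eqP; rewrite yc_double yQ.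
have Q2' : Q' *+ 2 = 0 by apply/eqP; rewrite yc_double yQ'.
have T2' : T' *+ 2 = 0 by apply/eqP; rewrite yc_double yT'.
have [QT|QT] := eqVneq Q T.
  rewrite QT in hQ *; rewrite (theta_fun hQ hT) -!mulr2n T2 T2'; exact: theta0.
have third (F : mcurve) (U V : mpoint F) u v w : U != 0 -> V != 0 -> U *+ 2 = 0 -> V *+ 2 = 0 ->
    U != V -> splits3 (mpol F) u v w -> xc U = u -> xc V = v ->
    [/\ U + V != 0, yc (U + V) = 0 & xc (U + V) = w].
  move=> U0 V0 U2 V2 UV t xU xV.
  have W0 : U + V != 0.
    apply: contraNneq UV => /eqP; rewrite addr_eq0 => /eqP ->.
    by rewrite eq_sym -subr_eq0 opprK -mulr2n V2.
  have W2 : (U + V) *+ 2 = 0 by rewrite mulrnDl U2 V2 addr0.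
  have [rW yW] := tpoint_root W0 W2; split=> //.
  have not (R R1 : mpoint F) : R1 != 0 -> R *+ 2 = 0 -> R1 *+ 2 = 0 -> xc (R + R1) = xc R -> R + R1 != 0 -> R != 0 -> False.
    move=> R10 R2 R12 e n0 nR; have [e1|e1] := xc_inj nR n0 (esym e).
      by move: R10; rewrite -[R1](addKr R) e1 addNr eqxx.
    move: R10; have -> : R1 = - (R *+ 2) by rewrite mulr2n opprD -{1}e1 addrAC subrr add0r.
    by rewrite R2 oppr0 eqxx.
  move: rW; rewrite (splits3_root _ t) => /or3P[] /eqP // e.
    by case: (not U V) => //; rewrite e xU.
  by case: (not V U) => //; rewrite addrC // e xV.
have xne : xc Q != xc T.
  apply: contraNneq QT => e; apply/eqP.
  by apply: mval_inj; rewrite !mval_neq0 // e yQ yT.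
have [c s] : exists c, splits3 G (xc Q) (xc T) c.
  have [u [v [w t]]] := mpol_splits C.
  have [rQ _] := tpoint_root Q0 Q2.
  have [v' [w' t2]] := splits3_complete t rQ.
  move: rT; rewrite (splits3_root _ t2) eq_sym (negbTE xne) /= => /orP[] /eqP ->.
    by exists w'.
  by exists v'; apply: splits3_swap.
have [a' [b' [c' [s' ma mb mc]]]] := mrt_splits X s.
have QT' : Q' != T'.
  by apply: contraNneq QT => e; rewrite e in hQ; rewrite (theta_inj hQ hT).
have [n1 y1 x1] := third _ _ _ _ _ _ Q0 T0 Q2 T2 QT s erefl erefl.
have [n1' y1' x1'] := third _ _ _ _ _ _ Q0' T0' Q2' T2' QT' s' (mrt_fun mQ ma) (mrt_fun mT mb).
by apply: thetaT => //; rewrite x1 x1'.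
Qed.

(** When the doubles share an abscissa and the formula breaks down, [2Q = 2P] or [2Q = - 2P], so [Q]
    differs from [P] or [- P] by 2-torsion. *)
Lemma theta_add_or_sub P Q P' Q' : theta P P' -> theta Q Q' ->
  theta ((P + Q) *+ 2) ((P' + Q') *+ 2) -> theta ((P - Q) *+ 2) ((P' - Q') *+ 2) ->
  theta (P + Q) (P' + Q') \/ theta (P - Q) (P' - Q').
Proof.
move=> hP hQ hA hB.
have [yP|yP] := eqVneq (yc P) 0.
  left; rewrite addrC [P' + _]addrC; apply: theta_add_tors2 => //.
  by apply/eqP; rewrite yc_double yP.
have [yQ|yQ] := eqVneq (yc Q) 0.
  left; apply: theta_add_tors2 => //.
  by apply/eqP; rewrite yc_double yQ.
have [ex|nx] := eqVneq (xc (Q *+ 2)) (xc (P *+ 2)); last first.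
  exact: theta_add_or_sub_generic.
have P20 : P *+ 2 != 0 by rewrite yc_double.
have Q20 : Q *+ 2 != 0 by rewrite yc_double.
have key R R' : theta R R' -> (Q - R) *+ 2 = 0 -> theta (Q - R) (Q' - R').
  move=> hR T2; have [|T' hT] := @theta_total _ _ X 1 (Q - R); first by [].
  have := theta_add_tors2 hR hT T2; rewrite addrC subrK => h.
  by rewrite (theta_fun hQ h) addrAC subrr add0r.
have [e|e] := xc_inj P20 Q20 (esym ex).
  right; rewrite -(opprB Q) -(opprB Q'); apply: theta_opp; apply: key => //.
  by rewrite mulrnBl e subrr.
left; rewrite -[P]opprK -[P']opprK addrC [_ + Q']addrC; apply: key.
  exact: theta_opp.
by rewrite opprK mulrnDl e addNr.
Qed.

Lemma theta_add n P Q P' Q' : P *+ (2 ^ n) = 0 -> Q *+ (2 ^ n) = 0 ->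
  theta P P' -> theta Q Q' -> theta (P + Q) (P' + Q').
Proof.
elim: n P Q P' Q' => [|n IH] P Q P' Q'.
  rewrite !mulr1n => -> -> hP hQ; rewrite -(theta_fun (theta0 X) hP).
  by rewrite -(theta_fun (theta0 X) hQ) !addr0; apply: theta0.
move=> tP tQ hP hQ.
have alt U V U' V' : U *+ (2 ^ n.+1) = 0 -> V *+ (2 ^ n.+1) = 0 ->
    theta U U' -> theta V V' -> theta (U + V) (U' + V') \/ theta (U - V) (U' - V').
  rewrite expnS !mulrnA => tU tV hU hV.
  apply: theta_add_or_sub => //; rewrite ?mulrnDl ?mulrnBl; apply: IH => //;
    rewrite ?mulNrn ?tV ?oppr0 //; do ?apply: theta_opp; exact: theta_double.
(* A failure at [(P, Q)] propagates to [(P, Q *+ 2)], [(P, Q *+ 4)], and so on. *)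
apply: contrapT => bad.
have tQk k : Q *+ (2 ^ k) *+ (2 ^ n.+1) = 0.
  by rewrite -mulrnA mulnC mulrnA tQ mul0rn.
have hQk k : theta (Q *+ (2 ^ k)) (Q' *+ (2 ^ k)).
  elim: k => [|k IHk]; first by rewrite !mulr1n.
  by rewrite expnS mulnC !mulrnA; apply: theta_double.
have badk k : ~ theta (P + Q *+ (2 ^ k)) (P' + Q' *+ (2 ^ k)).
  elim: k => [|k IHk]; first by rewrite !mulr1n.
  rewrite expnS mulnC !mulrnA => h.
  move: IHk h (tQk k) (hQk k).
  move: (Q *+ _) (Q' *+ _) => W W' nW h tW hW.
  have tPW : (P + W) *+ (2 ^ n.+1) = 0 by rewrite mulrnDl tP tW addr0.
  (* [V'] is the true partner of [P + W]. Applying [alt] to [P + W] and [W] pairs [P + W *+ 2] with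
     [V' + W'], or [P] with [V' - W']. The partners of these points are known from [h] and [hP], so
     in both cases [V' = P' + W'], against [nW]. *)
  have [V' hV] := theta_total X tPW.
  have [h1|h1] := alt _ _ _ _ tPW tW hV hW.
    rewrite -addrA -mulr2n in h1; have := theta_fun h h1.
    rewrite mulr2n addrA => /addIr e; apply: nW.
    by rewrite e.
  rewrite addrK in h1; apply: nW.
  by rewrite (theta_fun hP h1) subrK.
apply: (badk n.+1).
have := hQk n.+1; rewrite tQ => h0.
by rewrite -(theta_fun (theta0 X) h0) !addr0.
Qed.

End ThetaAdd.

(** * Valuations on finite extensions of a complete field *)

Section ValuationTheory.
Variables (F : fieldType) (V : realDomainType) (v : F -> V).
Hypothesis hv : valuation v.

Lemma v_mul x y : x != 0 -> y != 0 -> v (x * y) = v x + v y.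
Proof. exact: hv.1. Qed.

Lemma v_one : v 1 = 0.
Proof.
have := v_mul (oner_neq0 F) (oner_neq0 F).
by rewrite mulr1 -{1}[v 1]addr0 => /addrI.
Qed.

Lemma v_opp x : v (- x) = v x.
Proof.
have [->|x0] := eqVneq x 0; first by rewrite oppr0.
have N1 : (-1 : F) != 0 by rewrite oppr_eq0 oner_neq0.
rewrite -mulN1r v_mul //; suff -> : v (-1) = 0 by rewrite add0r.
have := v_mul N1 N1; rewrite mulrNN mulr1 v_one -mulr2n => /esym/eqP.
by rewrite mulrn_eq0 => /eqP.
Qed.

Lemma v_inv x : x != 0 -> v x^-1 = - v x.
Proof.
move=> x0; have xV : x^-1 != 0 by rewrite invr_eq0.
apply/eqP; rewrite -addr_eq0 addrC -v_mul // divff //.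
by rewrite v_one.
Qed.

Lemma v_exp x n : x != 0 -> v (x ^+ n) = v x *+ n.
Proof.
move=> x0; elim: n => [|n IH]; first by rewrite expr0 v_one.
by rewrite exprS v_mul ?expf_neq0 // IH mulrS.
Qed.

Lemma v_expz x (n : int) : x != 0 -> v (x ^ n) = v x *~ n.
Proof.
move=> x0; case: n => n; first exact: v_exp.
by rewrite NegzE -invr_expz v_inv ?expfz_neq0 // mulrNz -exprnP v_exp.
Qed.

Lemma vge0 M : vge v M 0. Proof. by rewrite /vge eqxx. Qed.

Lemma vge_le M M' x : M' <= M -> vge v M x -> vge v M' x.
Proof. by rewrite /vge => h /orP[-> //|h2]; rewrite (le_trans h h2) orbT. Qed.

Lemma vgeN M x : vge v M (- x) = vge v M x.
Proof. by rewrite /vge oppr_eq0 v_opp. Qed.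

Lemma vgeD M x y : vge v M x -> vge v M y -> vge v M (x + y).
Proof.
rewrite /vge; have [->|x0] := eqVneq x 0; first by rewrite add0r.
have [->|y0] := eqVneq y 0; first by rewrite addr0 (negbTE x0).
have [//|xy0] /= := eqVneq (x + y) 0 => hx hy.
apply: le_trans (hv.2 _ _ x0 y0 xy0).
by rewrite le_min hx hy.
Qed.

Lemma vgeB M x y : vge v M x -> vge v M y -> vge v M (x - y).
Proof. by move=> hx hy; apply: vgeD; rewrite ?vgeN. Qed.

Lemma vgeM M M' x y : vge v M x -> vge v M' y -> vge v (M + M') (x * y).
Proof.
rewrite /vge mulf_eq0; have [//|x0] := eqVneq x 0; have [//|y0] := eqVneq y 0.
by move=> /= hx hy; rewrite v_mul // lerD.
Qed.

Lemma vge_sum I (r : seq I) (P : pred I) (E : I -> F) M :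
  (forall i, P i -> vge v M (E i)) -> vge v M (\sum_(i <- r | P i) E i).
Proof. by move=> h; elim/big_ind: _ => //; [apply: vge0 | apply: vgeD]. Qed.

Lemma vge_all_eq0 x : (forall M, vge v M x) -> x = 0.
Proof.
move=> h; apply/eqP; apply: contraT => x0; have := h (v x + 1).
by rewrite /vge (negbTE x0) /= gerDl ler10.
Qed.

Lemma vge_val x : vge v (v x) x.
Proof. by rewrite /vge lexx orbT. Qed.

Lemma valD_dominant x z : x != 0 -> z = 0 \/ v x < v z ->
  x + z != 0 /\ v (x + z) = v x.
Proof.
move=> x0 [->|xz]; first by rewrite addr0.
have [->|z0] := eqVneq z 0; first by rewrite addr0.
have n0 : x + z != 0.
  by apply: contraTneq xz => /addr0_eq <-; rewrite v_opp ltxx.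
split=> //; apply/eqP; rewrite eq_le; apply/andP; split; last first.
  by apply: le_trans (hv.2 _ _ x0 z0 n0); rewrite le_min lexx ltW.
have nz : - z != 0 by rewrite oppr_eq0.
have := hv.2 _ _ n0 nz; rewrite addrK v_opp => /(_ x0).
rewrite ge_min => /orP[//|h].
by have := lt_le_trans xz h; rewrite ltxx.
Qed.

Definition one_unit (d : V) (z : F) : bool := vge v d (z - 1).

Lemma one_unit_integral d z : 0 <= d -> one_unit d z -> vge v 0 z.
Proof.
move=> d0 h; rewrite -[z](subrK 1); apply: vgeD; first exact: vge_le h.
by rewrite /vge v_one lexx orbT.
Qed.

Lemma one_unitM d y z : 0 <= d -> one_unit d y -> one_unit d z -> one_unit d (y * z).
Proof.
move=> d0 hy hz; rewrite /one_unit; have -> : y * z - 1 = (y - 1) * z + (z - 1) by ring.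
apply: vgeD => //; rewrite -[d]addr0; apply: vgeM => //.
exact: one_unit_integral hz.
Qed.

Lemma one_unitX d z n : 0 <= d -> one_unit d z -> one_unit d (z ^+ n).
Proof.
move=> d0 hz; elim: n => [|n IH]; first by rewrite /one_unit subrr vge0.
by rewrite exprS one_unitM.
Qed.

End ValuationTheory.

Lemma rat_archi (M d : rat) : 0 < d -> exists n, M <= d *+ n.
Proof.
move=> d0; exists (Num.bound `|M / d|); rewrite -mulr_natr mulrC -ler_pdivrMr //.
by apply: le_trans (ler_norm _) (ltW (archi_boundP _)).
Qed.

(** * Roots of units close to 1, by successive approximation *)

Section Roots.
Variables (F : fieldType) (v : F -> rat).
Hypothesis hv : valuation v.
Hypothesis cv : vcomplete v.
Variable n : nat.
Hypothesis n0 : n%:R != 0 :> F.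
Hypothesis vn : v n%:R = 0.
Variables (a : F) (d : rat).
Hypothesis d0 : 0 < d.
Hypothesis ha : one_unit v d a.

(** Newton's iteration for [z^n = a], with the derivative frozen at its value [n] at 1. *)
Let step (z : F) : F := z - (z ^+ n - a) / n%:R.

Let nV : vge v 0 n%:R^-1.
Proof. by rewrite /vge (v_inv hv) // vn oppr0 lexx orbT. Qed.

Lemma root_step_unit z : one_unit v d z -> one_unit v d (step z).
Proof.
move=> hz; rewrite /one_unit /step addrAC; apply: (vgeB hv) => //.
rewrite -[d]addr0; apply: (vgeM hv) => //.
have -> : z ^+ n - a = (z ^+ n - 1) - (a - 1) by ring.
by apply: (vgeB hv) => //; apply: (one_unitX hv) => //; apply: ltW.
Qed.

(** [y^n - z^n = Q (y - z)], and [Q] is a sum of [n] products of elements congruent to 1, hence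
    congruent to [n]; the factor [1 - Q / n] has value at least [d]. *)
Lemma root_step_contract y z M : one_unit v d y -> one_unit v d z ->
  vge v M (y - z) -> vge v (d + M) (step y - step z).
Proof.
move=> hy hz hM; pose Q := \sum_(i < n) y ^+ (n.-1 - i) * z ^+ i.
have -> : step y - step z = - ((Q - n%:R) / n%:R) * (y - z).
  rewrite /step.
  have -> : y - (y ^+ n - a) / n%:R - (z - (z ^+ n - a) / n%:R) =
     (y - z) - (y ^+ n - z ^+ n) / n%:R by ring.
  rewrite subrXX.
  have -> : \sum_(i < n) y ^+ (n.-1 - i) * z ^+ i = Q by [].
  by field.
apply: (vgeM hv) => //; rewrite (vgeN hv) -[d]addr0; apply: (vgeM hv) => //.
have -> : Q - n%:R = \sum_(i < n) (y ^+ (n.-1 - i) * z ^+ i - 1).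
  by rewrite sumrB sumr_const card_ord.
apply: (vge_sum hv) => i _; apply: (one_unitM hv (ltW d0));
  exact: (one_unitX hv _ (ltW d0)).
Qed.

Lemma one_unit_root : exists2 z, z ^+ n = a & one_unit v d z.
Proof.
pose z k := iter k step 1.
have zu k : one_unit v d (z k).
  elim: k => [|k IH]; first by rewrite /one_unit subrr vge0.
  exact: root_step_unit.
have zS k : vge v (d *+ k) (z k.+1 - z k).
  elim: k => [|k IH].
    by rewrite mulr0n; apply: (vge_le (ltW d0)); exact: (zu 1%N).
  by rewrite mulrS; exact: (root_step_contract (zu k.+1) (zu k) IH).
have zD k j : vge v (d *+ k) (z (k + j)%N - z k).
  elim: j => [|j IH]; first by rewrite addn0 subrr vge0.
  rewrite addnS -(subrKA (z (k + j)%N)); apply: (vgeD hv) => //.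
  by apply: vge_le (zS _); apply: ler_wpMn2l; rewrite ?leq_addr // ltW.
have [|l lP] := @cv z.
  move=> M; have [N hN] := rat_archi M d0; exists N => i j Ni Nj.
  apply: (vge_le hN); rewrite -(subrKA (z N)); apply: (vgeD hv).
    by rewrite -(subnKC Ni).
  by rewrite -(vgeN hv) opprB -(subnKC Nj).
have lu : one_unit v d l.
  have [N hN] := lP d; have := hN N (leqnn N) => h.
  rewrite /one_unit -(subrKA (z N)) ; apply: (vgeD hv); last exact: zu.
  by rewrite -(vgeN hv) opprB.
exists l => //; have fix_l : step l = l.
  apply/eqP; rewrite -subr_eq0; apply/eqP; apply: (vge_all_eq0 (v := v)) => M.
  have [N hN] := lP M; rewrite -(subrKA (z N.+1)); apply: (vgeD hv).
    rewrite -[z _]/(step (z N)); apply: (vge_le (M := d + M)).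
      by rewrite lerDr ltW.
    apply: root_step_contract => //.
    by rewrite -(vgeN hv) opprB; apply: hN.
  by apply: hN; exact: leqnSn.
move: fix_l; rewrite /step => /eqP; rewrite -subr_eq0 addrAC subrr add0r oppr_eq0.
by rewrite mulf_eq0 invr_eq0 (negbTE n0) orbF subr_eq0 => /eqP.
Qed.

End Roots.

(** * Completeness of finite extensions and uniqueness of the valuation *)

Section FiniteExtension.
Variables (k : fieldType) (K : cdvField k) (L : fieldExtType K).

Definition extends_vK (w : L -> rat) : Prop :=
  valuation w /\ forall a : K, a != 0 -> w a%:A = (vK a)%:~R.

Definition vR (a : K) : rat := (vK a)%:~R.

Lemma vR_complete : vcomplete vR.
Proof.
move=> u hu; have [|l lP] := @vK_complete _ K u.
  move=> M; have [N hN] := hu M%:~R; exists N => m n Nm Nn.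
  by have := hN m n Nm Nn; rewrite /vge /vR ler_int.
exists l => M; have [N hN] := lP (Num.ceil M); exists N => n Nn.
have := hN n Nn; rewrite /vge => /orP[-> //|h].
by rewrite (le_trans (ceil_ge M)) ?orbT // /vR ler_int.
Qed.

Section OneExtension.
Variable w : L -> rat.
Hypothesis hw : extends_vK w.
Let vw := hw.1.

Lemma ext_val_alg (a : K) : a != 0 -> w a%:A = vR a.
Proof. exact: hw.2. Qed.

Lemma vge_scale M M' (a : K) x : vge vR M a -> vge w M' x -> vge w (M + M') (a *: x).
Proof.
move=> ha hx; rewrite -mulr_algl; apply: (vgeM vw) => //.
have [->|a0] := eqVneq a 0; first by rewrite scale0r vge0.
by move: ha; rewrite /vge (negbTE a0) /= ext_val_alg // => ->; rewrite orbT.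
Qed.

Definition comb (X : seq L) (c : nat -> K) : L := \sum_(i < size X) c i *: X`_i.

Lemma comb_cons x X c : comb (x :: X) c = c 0%N *: x + comb X (fun i => c i.+1).
Proof. by rewrite /comb /= big_ord_recl. Qed.

Lemma combB X c d : comb X c - comb X d = comb X (fun i => c i - d i).
Proof. by rewrite /comb -sumrB; apply: eq_bigr => i _; rewrite scalerBl. Qed.

Lemma comb_mem X c : comb X c \in <<X>>%VS.
Proof.
apply: memv_suml => i _; apply: memvZ; apply: memv_span.
by rewrite mem_nth.
Qed.

Lemma val_lower_bound (X : seq L) : exists B, forall i, (i < size X)%N -> vge w B X`_i.
Proof.
elim: X => [|x X [B hB]]; first by exists 0.
exists (Num.min B (w x)) => -[|i] /=; rewrite ?ltnS => hi.
  by apply: vge_le (vge_val _ _); rewrite ge_min lexx orbT.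
by apply: vge_le (hB i hi); rewrite ge_min lexx.
Qed.

(** Equivalence of norms over a complete field. By induction, elements [x + comb X c] of ever larger
    value have coefficients forming Cauchy sequences; their limits would put [x] into the span of
    [X]. So the values of all [x + comb X c] stay below some [B1]. *)
Lemma norm_equivalence X : free X ->
  exists B, forall c M, vge w M (comb X c) ->
    forall i, (i < size X)%N -> vge vR (M - B) (c i).
Proof.
elim: X => [|x X IH]; first by exists 0.
rewrite free_cons => /andP[xX /IH[B hB]].
have [B1 hB1] : exists B1, forall c, ~~ vge w B1 (x + comb X c).
  apply: contrapT => /forallNP near; case/negP: xX.
  have {}near M : exists c, vge w M (x + comb X c).
    by have /existsNP[c /negP/negPn h] := near M; exists c.
  have [c cP] := choice (fun n : nat => near n%:R).
  have cau i : (i < size X)%N -> exists l, forall M, exists N, forall n,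
      (N <= n)%N -> vge vR M (c n i - l).
    move=> iX; apply: (vR_complete (u := fun n => c n i)) => M.
    have [N hN] := rat_archi (M + B) ltr01; exists N => m n Nm Nn.
    apply: (vge_le (M := M + B - B)); first by rewrite addrK.
    apply: (hB (fun i => c m i - c n i)) => //.
    rewrite -combB -[comb X (c m)](addKr x) -[comb X (c n)](addKr x).
    rewrite [- x + _]addrC [- x + _]addrC opprB addrA subrK.
    have ge (j : nat) : (N <= j)%N -> M + B <= j%:R.
      by move=> Nj; apply: (le_trans hN); rewrite ler_nat.
    apply: (vgeB vw); [exact: vge_le (ge _ Nm) (cP m) | exact: vge_le (ge _ Nn) (cP n)].
  have /choice[l lP] : forall i, exists l, (i < size X)%N -> forall M, exists N, forall n,
      (N <= n)%N -> vge vR M (c n i - l).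
    move=> i; have [iX|iX] := boolP (i < size X)%N; last by exists 0.
    by have [l h] := cau i iX; exists l.
  suff /eqP : x + comb X l = 0.
    rewrite addr_eq0 => /eqP ->; rewrite rpredN; exact: comb_mem.
  apply: (vge_all_eq0 (v := w)) => M.
  have [b bP] := val_lower_bound X.
  have /choice[N NP] : forall i, exists N, (i < size X)%N -> forall n,
      (N <= n)%N -> vge vR (M - b) (c n i - l i).
    move=> i; have [iX|iX] := boolP (i < size X)%N; last by exists 0%N.
    by have [N h] := lP i iX (M - b); exists N.
  have [N0 hN0] := rat_archi M ltr01.
  pose n := maxn N0 (\max_(i < size X) N i).
  have -> : x + comb X l = (x + comb X (c n)) - (comb X (c n) - comb X l).
    by rewrite opprB addrA addrAC addrK.
  apply: (vgeB vw).
    by apply: vge_le (cP n); apply: (le_trans hN0); rewrite ler_nat leq_maxl.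
  rewrite combB; apply: (vge_sum vw) => i _; rewrite -(subrK b M).
  apply: vge_scale; last exact: bP.
  apply: NP => //; apply: leq_trans (leq_maxr _ _).
  exact: (leq_bigmax (F := fun i : 'I__ => N i)).
(* The coefficient of [x] loses [B1]. The others lose [B] in addition to what is lost when the term
   in [x] is subtracted. Absolute values make one constant serve for both. *)
pose B2 := `|B1| + `|B| + `|w x|.
exists B2 => c M; rewrite comb_cons => h.
have h0 : vge vR (M - B1) (c 0%N).
  have [->|c0] := eqVneq (c 0%N) 0; first by rewrite vge0.
  have := hB1 (fun i => (c 0%N)^-1 * c i.+1); set y := x + _.
  have yE : c 0%N *: y = c 0%N *: x + comb X (fun i => c i.+1).
    rewrite scalerDr; congr (_ + _); rewrite /comb scaler_sumr.
    by apply: eq_bigr => i _; rewrite scalerA mulrA divff // mul1r.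
  rewrite /vge negb_or -ltNge => /andP[y0 yB]; rewrite (negbTE c0) /=.
  move: h; rewrite -yE /vge scaler_eq0 (negbTE c0) (negbTE y0) /=.
  rewrite -mulr_algl (v_mul vw) ?ext_val_alg //; last first.
    by rewrite scaler_eq0 negb_or c0 oner_neq0.
  move: yB; set p := w y; set q := vR _; lra.
have b1 := ler_norm B1; have b2 := ler_norm B; have b3 := ler_norm (w x).
have b4 := ler_norm (- w x); rewrite normrN in b4.
have p1 := normr_ge0 B1; have p2 := normr_ge0 B; have p3 := normr_ge0 (w x).
move=> [|i] /=; rewrite ?ltnS => hi.
  by apply: vge_le h0; rewrite /B2; lra.
apply: (vge_le (M := (M - `|B1| - `|w x|) - B)); first by rewrite /B2; lra.
apply: (hB (fun i => c i.+1)) => //.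
have -> : comb X (fun i => c i.+1) = (c 0%N *: x + comb X (fun i => c i.+1)) - c 0%N *: x.
  by rewrite addrAC subrr add0r.
apply: (vgeB vw); first by apply: vge_le h; lra.
apply: (vge_le (M := (M - B1) + w x)); first by lra.
by apply: vge_scale => //; apply: vge_val.
Qed.

Lemma coord_bound : exists B, forall y M, vge w M y ->
  forall i, vge vR (M - B) (coord (vbasis {:L}) i y).
Proof.
have [B hB] := norm_equivalence (basis_free (vbasisP {:L})).
exists B => y M hy i.
pose c j := oapp (fun i => coord (vbasis {:L}) i y) 0 (insub j).
have cE j : c (val j) = coord (vbasis {:L}) j y by rewrite /c valK.
rewrite -cE; apply: hB; last by rewrite size_tuple ltn_ord.
suff -> : comb (vbasis {:L}) c = y by [].
rewrite [RHS](coord_vbasis (memvf y)) /comb.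
rewrite -(big_mkord xpredT (fun j => c j *: (vbasis {:L})`_j)) size_tuple big_mkord.
by apply: eq_bigr => j _; rewrite cE.
Qed.

Lemma ext_complete : vcomplete w.
Proof.
move=> u hu; have [B hB] := coord_bound; pose X := vbasis {:L}.
have cau i : exists l, forall M, exists N, forall n,
    (N <= n)%N -> vge vR M (coord X i (u n) - l).
  apply: (vR_complete (u := fun n => coord X i (u n))) => M.
  have [N hN] := hu (M + B); exists N => m n Nm Nn.
  rewrite -linearB /=; have := hB _ _ (hN m n Nm Nn) i.
  by rewrite addrK.
have [l lP] := choice cau.
pose y := \sum_i l i *: X`_i; exists y => M.
have [b bP] := val_lower_bound X.
have [N NP] := choice (fun i => lP i (M - b)).
exists (\max_i N i) => n Nn.
rewrite (coord_vbasis (memvf (u n))) /y -sumrB; apply: (vge_sum vw) => i _.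
rewrite -scalerBl -(subrK b M); apply: vge_scale.
  by apply: NP; apply: leq_trans Nn; apply: leq_bigmax.
by apply: bP; rewrite size_tuple.
Qed.

End OneExtension.

(** Bounded coordinates give [w1 - w2 <= B - b] on nonzero elements. Applied to [x^n], whose values
    are multiplied by [n], this leaves no room for [w1 x > w2 x]. *)
Lemma ext_val_le (w1 w2 : L -> rat) : extends_vK w1 -> extends_vK w2 ->
  forall x, x != 0 -> w1 x <= w2 x.
Proof.
move=> h1 h2; have [B hB] := coord_bound h1.
have [b bP] := val_lower_bound w2 (vbasis {:L}).
have main y : y != 0 -> w1 y - B + b <= w2 y.
  move=> y0; suff : vge w2 (w1 y - B + b) y by rewrite /vge (negbTE y0).
  rewrite {2}(coord_vbasis (memvf y)); apply: (vge_sum h2.1) => i _.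
  apply: (vge_scale h2); first by apply: hB; apply: vge_val.
  by apply: bP; rewrite size_tuple.
move=> x x0; rewrite leNgt; apply/negP; rewrite -subr_gt0 => gt.
have [n hn] := rat_archi (B - b + 1) gt.
have := main (x ^+ n) (expf_neq0 _ x0).
rewrite (v_exp h1.1) // (v_exp h2.1) // => hl.
move: hn; rewrite mulrnBl; move: hl; set p := _ *+ n; set q := _ *+ n => hl hn.
lra.
Qed.

Lemma ext_val_uniq (w1 w2 : L -> rat) : extends_vK w1 -> extends_vK w2 ->
  forall x, x != 0 -> w1 x = w2 x.
Proof. by move=> h1 h2 x x0; apply/eqP; rewrite eq_le !ext_val_le. Qed.

End FiniteExtension.

(** * Hensel lifting and leading coefficients in the tame extension *)

Section Tame.
Variables (p : nat) (k ksep : fieldType) (ik : {rmorphism k -> ksep}).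
Hypothesis p_char : p \in [pchar k].
Variables (K : cdvField k) (D : tameChoice p ik K).
Local Notation v := (vt D).
Local Notation red := (redt D).
Let hv : valuation v := vt_valuation D.

Lemma redt_spec : residue_map v red. Proof. exact: redt_residue. Qed.

(** [Kt] need not be complete, being a union of finite extensions; arguments by completeness take
    place in such an [L]. *)
Lemma tame_subext (x : Kt D) : exists (L : fieldExtType K) (g : {rmorphism L -> Kt D}),
  [/\ tamely_ramified p L, forall a : K, g a%:A = iKt D a & exists y, g y = x].
Proof.
have /Kt_max [L [h [hK tL [y hy]]]] : exists z, jKt D z = jKt D x by exists x.
have /choice[g gP] : forall z : L, exists t : Kt D, jKt D t = h z.
  by move=> z; apply/Kt_max; exists L, h; split=> //; exists z.
have inj := fmorph_inj (jKt D).
have gB : zmod_morphism g.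
  by move=> a b; apply: inj; rewrite rmorphB !gP rmorphB.
have gM : GRing.monoid_morphism g.
  by split=> [|a b]; apply: inj; rewrite ?rmorphM !gP ?rmorphM ?rmorph1.
pose gm : {rmorphism L -> Kt D} := HB.pack g
  (GRing.isZmodMorphism.Build L (Kt D) g gB)
  (GRing.isMonoidMorphism.Build L (Kt D) g gM).
exists L, gm; split=> //; last by exists y; apply: inj; rewrite gP.
by move=> a; apply: inj; rewrite gP hK jKt_iKt.
Qed.

Definition extends_to_Kt (w : Kt D -> rat) : Prop :=
  valuation w /\ forall a : K, a != 0 -> w (iKt D a) = (vK a)%:~R.

Lemma extends_restrict (w : Kt D -> rat) (L : fieldExtType K) (g : {rmorphism L -> Kt D}) :
  extends_to_Kt w -> (forall a : K, g a%:A = iKt D a) -> extends_vK (w \o g).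
Proof.
move=> [[wM wD] wK] gK; split; last by move=> a a0 /=; rewrite gK wK.
split=> [x y x0 y0|x y x0 y0 xy0] /=; first by rewrite rmorphM wM ?fmorph_eq0.
by rewrite rmorphD wD ?fmorph_eq0 // -rmorphD fmorph_eq0.
Qed.

Lemma vt_extends : extends_to_Kt v.
Proof. by split; [exact: vt_valuation | exact: vt_vK]. Qed.

Lemma vt_uniq (w : Kt D -> rat) x : extends_to_Kt w -> x != 0 -> w x = v x.
Proof.
move=> hw; have [L [g [_ gK [y <-]]]] := tame_subext x; rewrite fmorph_eq0 => y0.
exact: (ext_val_uniq (extends_restrict hw gK) (extends_restrict vt_extends gK)).
Qed.

(** [v \o s] also extends the valuation of [K], and the extension is unique. *)
Lemma vt_gal (s : tameGal D) x : v (s x) = v x.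
Proof.
have [->|x0] := eqVneq x 0; first by rewrite rmorph0.
apply: (@vt_uniq (v \o s)) => //; split; last first.
  by move=> a a0 /=; rewrite gal_fix vt_vK.
have [vM vD] := hv; split=> [y z y0 z0|y z y0 z0 yz0] /=.
  by rewrite rmorphM vM ?fmorph_eq0.
by rewrite rmorphD vD ?fmorph_eq0 // -rmorphD fmorph_eq0.
Qed.

Lemma p_prime : prime p. Proof. exact: pcharf_prime p_char. Qed.

(** Tameness enters here: the ramification index of a tame [L] is prime to [p], so a power of some
    [rt N] scales [x] to a unit. *)
Lemma vt_coprime x : x != 0 ->
  exists N (m : int), [/\ (0 < N)%N, coprime N p & v x = m%:~R / N%:R].
Proof.
have [L [g [tL gK [y <-]]]] := tame_subext x; rewrite fmorph_eq0 => y0.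
have [w [kL [redL [ikL [e [hw _ [e0 he] ep _]]]]]] := tL.
have -> : v (g y) = w y.
  exact: (ext_val_uniq (extends_restrict vt_extends gK) hw).
have /he [m ->] : exists2 x, x != 0 & w x = w y by exists y.
by exists e, m.
Qed.

Lemma natr_k_neq0 n : coprime n p -> n%:R != 0 :> k.
Proof.
move=> np; rewrite -(dvdn_pcharf p_char) -prime_coprime ?p_prime //.
by rewrite coprime_sym.
Qed.

Lemma redK_nat n : vintegral (@vK _ K) n%:R /\ redK (n%:R : K) = n%:R.
Proof.
have hvK := @vK_valuation _ K; have [r1 rD _ _ r0] := redK_residue K.
elim: n => [|n [IH1 IH2]].
  by split; [exact: vge0 | apply/r0; [exact: vge0 | rewrite eqxx]].
have i1 : vintegral (@vK _ K) 1 by rewrite /vintegral /vge (v_one hvK) lexx orbT.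
rewrite -natr1; split; first exact: (vgeD hvK).
by rewrite rD // IH2 r1 natr1.
Qed.

Lemma natr_K_neq0 n : coprime n p -> n%:R != 0 :> K /\ vK (n%:R : K) = 0.
Proof.
move=> np; have [i e] := redK_nat n; have [_ _ _ _ r0] := redK_residue K.
have : ~~ ((n%:R == 0 :> K) || (0 < vK (n%:R : K))).
  apply/negP => /r0 -/(_ i) h; rewrite e in h.
  by have := natr_k_neq0 np; rewrite h eqxx.
rewrite negb_or -leNgt => /andP[n0 nv]; split=> //; apply/eqP.
by rewrite eq_le nv; move: i; rewrite /vintegral /vge (negbTE n0).
Qed.

Lemma natr_Kt n : coprime n p -> n%:R != 0 :> Kt D /\ v (n%:R : Kt D) = 0.
Proof.
move=> /natr_K_neq0[n0 vn]; rewrite -(rmorph_nat (iKt D)); split.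
  by rewrite fmorph_eq0.
by rewrite vt_vK // vn.
Qed.

Lemma natr_ksep n : coprime n p -> n%:R != 0 :> ksep.
Proof. by move=> /natr_k_neq0 n0; rewrite -(rmorph_nat ik) fmorph_eq0. Qed.

Lemma red1 : red 1 = 1. Proof. by case: redt_spec. Qed.
Lemma int1 : vintegral v 1. Proof. by rewrite /vintegral /vge (v_one hv) lexx orbT. Qed.
Lemma redD x y : vintegral v x -> vintegral v y -> red (x + y) = red x + red y.
Proof. by case: redt_spec => _ h *; apply: h. Qed.
Lemma redM x y : vintegral v x -> vintegral v y -> red (x * y) = red x * red y.
Proof. by case: redt_spec => _ _ h *; apply: h. Qed.
Lemma red_eq0 x : vintegral v x -> red x = 0 <-> (x == 0) || (0 < v x).
Proof. by case: redt_spec => _ _ _ _; apply. Qed.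
Lemma red_onto c : exists2 x, vintegral v x & red x = c.
Proof. by case: redt_spec. Qed.
Lemma intM x y : vintegral v x -> vintegral v y -> vintegral v (x * y).
Proof. by move=> hx hy; have := vgeM hv hx hy; rewrite addr0. Qed.
Lemma redN x : vintegral v x -> red (- x) = - red x.
Proof.
move=> hx; have hNx : vintegral v (- x) by rewrite /vintegral (vgeN hv).
apply/eqP; rewrite -addr_eq0 addrC -redD // subrr; apply/eqP.
by apply/red_eq0; [exact: vge0 | rewrite eqxx].
Qed.
Lemma int_unit x : v x = 0 -> vintegral v x.
Proof. by move=> e; rewrite /vintegral /vge e lexx orbT. Qed.
Lemma red_unit x : x != 0 -> v x = 0 -> red x != 0.
Proof.
move=> x0 e; apply/eqP => /(red_eq0 (int_unit e)).
by rewrite (negbTE x0) e ltxx.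
Qed.
Lemma redV x : x != 0 -> v x = 0 -> red x^-1 = (red x)^-1.
Proof.
move=> x0 e; have eV : v x^-1 = 0 by rewrite (v_inv hv) // e oppr0.
apply: (mulfI (red_unit x0 e)); rewrite -redM ?int_unit //.
by rewrite !divff ?red1 // red_unit.
Qed.
Lemma redX x n : vintegral v x -> vintegral v (x ^+ n) /\ red (x ^+ n) = red x ^+ n.
Proof.
move=> hx; elim: n => [|n [IH1 IH2]]; first by rewrite !expr0 red1 int1.
by rewrite !exprS redM // IH2; split=> //; apply: intM.
Qed.
Lemma redXz x (n : int) : x != 0 -> v x = 0 -> red (x ^ n) = red x ^ n.
Proof.
move=> x0 e; have hX j : v (x ^+ j) = 0 by rewrite (v_exp hv) // e mul0rn.
case: n => n; first by rewrite -!exprnP (redX n (int_unit e)).2.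
rewrite NegzE -!exprnN redV ?expf_neq0 //.
by rewrite (redX n.+1 (int_unit e)).2.
Qed.

Lemma red_lift c : c != 0 -> exists x, [/\ x != 0, v x = 0 & red x = c].
Proof.
move=> c0; have [x ix xc] := red_onto c; exists x.
have : ~~ ((x == 0) || (0 < v x)).
  by apply/negP => /(red_eq0 ix) e; rewrite -xc e eqxx in c0.
rewrite negb_or -leNgt => /andP[x0 vx]; split=> //; apply/eqP.
by rewrite eq_le vx; move: ix; rewrite /vintegral /vge (negbTE x0).
Qed.

Lemma red1_root n a : (0 < n)%N -> coprime n p -> a != 0 -> v a = 0 -> red a = 1 ->
  exists z, [/\ z ^+ n = a, z != 0, v z = 0 & red z = 1].
Proof.
move=> n0 np a0 va ra.
have ia : vintegral v (a - 1) by apply: (vgeB hv); [exact: int_unit | exact: int1].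
have /(red_eq0 ia) : red (a - 1) = 0.
  by rewrite redD ?int_unit // ?(v_opp hv) ?(v_one hv) // redN ?int1 // ra red1 subrr.
(* The iteration runs with [d = v (a - 1) > 0]. As [v 0] is junk, [a = 1] is treated apart. *)
have [e _|a1 /= va1] := eqVneq (a - 1) 0.
  by exists 1; rewrite expr1n oner_neq0 (v_one hv) red1 (subr0_eq e).
have [L [g [_ gK [y ya]]]] := tame_subext a.
have hw := extends_restrict vt_extends gK.
have n0L : n%:R != 0 :> L by rewrite -(fmorph_eq0 g) rmorph_nat; case: (natr_Kt np).
have vnL : (v \o g) n%:R = 0 by rewrite /= rmorph_nat; case: (natr_Kt np).
have [|z zn z1] := one_unit_root hw.1 (ext_complete hw) n0L vnL va1 (a := y).
  by rewrite /one_unit /vge /= rmorphB ya rmorph1 lexx orbT.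
have gz : g z ^+ n = a by rewrite -rmorphXn zn.
have gz0 : g z != 0 by apply: contraNneq a0 => e; rewrite -gz e expr0n eqn0Ngt n0.
have i1 : vge v (v (a - 1)) (g z - 1).
  by move: z1; rewrite /one_unit /vge /= rmorphB rmorph1 -(fmorph_eq0 g) rmorphB rmorph1.
have vz : v (g z) = 0.
  have : v (g z) *+ n = 0 by rewrite -(v_exp hv) // gz.
  by move/eqP; rewrite mulrn_eq0 eqn0Ngt n0 => /eqP.
exists (g z); split=> //.
have iz : vintegral v (g z - 1) by apply: (vge_le _ i1); apply: ltW.
have : red (g z - 1) = 0.
  apply/(red_eq0 iz); move: i1; rewrite /vge => /orP[-> //|h].
  by rewrite (lt_le_trans va1 h) orbT.
rewrite redD ?int_unit // ?(v_opp hv) ?(v_one hv) // redN ?int1 // red1.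
by move/eqP; rewrite subr_eq0 => /eqP.
Qed.

Lemma unit_root n a c : (0 < n)%N -> coprime n p -> a != 0 -> v a = 0 ->
  red a = c ^+ n -> exists z, [/\ z ^+ n = a, z != 0, v z = 0 & red z = c].
Proof.
move=> n0 np a0 va ra.
have c0 : c != 0.
  have := red_unit a0 va; rewrite ra; apply: contraNneq => ->.
  by rewrite expr0n eqn0Ngt n0.
have [b [b0 vb rb]] := red_lift c0.
have bn0 := expf_neq0 n b0.
have vbn : v (b ^+ n) = 0 by rewrite (v_exp hv) // vb mul0rn.
have [|||z [zn z0 vz rz]] := @red1_root n (a / b ^+ n) n0 np.
- by rewrite mulf_neq0 ?invr_eq0.
- by rewrite (v_mul hv) ?invr_eq0 // (v_inv hv) // va vbn subrr.
- rewrite redM ?int_unit ?(v_inv hv) ?vbn ?oppr0 //.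
  rewrite redV // (redX n (int_unit vb)).2 ra rb divff // expf_neq0 //.
exists (z * b); rewrite exprMn zn divfK // mulf_neq0 // (v_mul hv) // vz vb addr0.
by rewrite redM ?int_unit // rz rb mul1r.
Qed.

Lemma unif_Kt_neq0 : iKt D (unif D) != 0.
Proof. by rewrite fmorph_eq0 unif_neq0. Qed.

Lemma rt_neq0 n : (0 < n)%N -> coprime n p -> rt D n != 0.
Proof.
move=> n0 np; apply: contraNneq unif_Kt_neq0 => e.
by rewrite -(rtX D n0 np) e expr0n eqn0Ngt n0.
Qed.

Lemma rt_val n : (0 < n)%N -> coprime n p -> v (rt D n) = n%:R^-1.
Proof.
move=> n0 np; have nr0 := rt_neq0 n0 np.
have : v (rt D n) *+ n = 1.
  by rewrite -(v_exp hv) // rtX // vt_vK ?unif_neq0 // vK_unif.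
have n0' : n%:R != 0 :> rat by rewrite pnatr_eq0 -lt0n.
by move=> e; apply: (mulIf n0'); rewrite mulVf // mulr_natr.
Qed.

Lemma rt_pow_val n (m : int) : (0 < n)%N -> coprime n p ->
  v (rt D n ^ m) = m%:~R / n%:R.
Proof.
by move=> n0 np; rewrite (v_expz hv) ?rt_neq0 // rt_val // -mulrzl.
Qed.

(** If [n / d] is the value in lowest terms, then [N = q d] and [m = q n], and the compatibility of
    the roots gives [rt N ^ q = rt d]. So any denominator prime to [p] may be used, in particular a
    common one for several elements. *)
Lemma tildeE x N (m : int) : (0 < N)%N -> coprime N p -> x != 0 ->
  v x = m%:~R / N%:R -> tilde x = red (x / rt D N ^ m).
Proof.
move=> N0 Np x0 vx; rewrite /tilde.
set d := `|denq (v x)|%N; set n := numq (v x).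
have N0' : N%:R != 0 :> rat by rewrite pnatr_eq0 -lt0n.
have dE : d%:R = (denq (v x))%:~R :> rat.
  by rewrite /d -{2}[denq (v x)]gez0_abs ?denq_ge0.
have dn0 : d%:R != 0 :> rat by rewrite dE intr_eq0 denq_neq0.
have vE : v x = n%:~R / d%:R by rewrite dE divq_num_den.
have nm : (n * N%:Z = m * d%:Z)%R.
  apply/eqP; rewrite -(eqr_int rat) !rmorphM /=; apply/eqP.
  apply: (mulIf (mulf_neq0 (invr_neq0 N0') (invr_neq0 dn0))).
  move: vx; rewrite vE => h; rewrite -[LHS]mulrA [N%:~R * _]mulrA divff // mul1r h.
  by rewrite -[RHS]mulrA; congr (_ * _); rewrite mulrCA divff // mulr1.
have dN : (d %| N)%N.
  have : (d %| `|n| * N)%N.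
    by apply/dvdnP; exists `|m|%N; move/(congr1 absz): nm; rewrite !abszM.
  rewrite Gauss_dvdr // /d /n coprime_sym; exact: coprime_num_den.
have [q NE] := dvdnP dN.
have q0 : (0 < q)%N by move: N0; rewrite NE; case: (q).
have d0 : (0 < d)%N by move: N0; rewrite NE; case: (d); rewrite ?muln0.
have [qp dp] : coprime q p /\ coprime d p by apply/andP; rewrite -coprimeMl -NE.
have mE : m = q%:Z * n.
  have dz : d%:Z != 0 by rewrite eqz_nat -lt0n.
  by apply: (mulIf dz); rewrite -nm NE PoszM; ring.
by rewrite mE -exprz_exp NE -exprnP rt_compat.
Qed.

End Tame.

(** * Roots and roots of unity in separably closed fields *)

Section SeparablyClosed.
Variable F : fieldType.
Hypothesis F_closed : forall q : {poly F}, (1 < size q)%N -> separable_poly q ->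
  exists x, root q x.

Lemma separable_splits (q : {poly F}) : separable_poly q ->
  exists2 rs, uniq rs & q = lead_coef q *: \prod_(z <- rs) ('X - z%:P).
Proof.
move=> sq; suff [rs e] : exists rs, q = lead_coef q *: \prod_(z <- rs) ('X - z%:P).
  exists rs => //; have q0 : lead_coef q != 0.
    by rewrite lead_coef_eq0; apply: separable_poly_neq0.
  rewrite -separable_prod_XsubC -(eqp_separable (p := q)) //.
  by rewrite [X in X %= _]e eqp_scale.
have [n] := ubnP (size q); elim: n q sq => // n IH q sq; rewrite ltnS => qn.
have [q1|q1] := leqP (size q) 1.
  exists [::]; rewrite big_nil (size1_polyC q1) lead_coefC.
  by rewrite alg_polyC.
have [x /factor_theorem[r qE]] := F_closed q1 sq.
have r0 : r != 0.
  by apply: contraTneq sq => r0; rewrite qE r0 mul0r; apply/negP => /separable_poly_neq0; rewrite eqxx.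
have sr : separable_poly r by move: sq; rewrite qE separable_mul => /and3P[].
have [|rs rE] := IH r sr.
  by apply: leq_trans qn; rewrite qE size_Mmonic ?monicXsubC // size_XsubC addn2 ltnS leqnn.
have lq : lead_coef q = lead_coef r by rewrite qE lead_coefM lead_coefXsubC mulr1.
by exists (x :: rs); rewrite big_cons lq qE {1}rE -scalerAl [_ * ('X - _)]mulrC.
Qed.

Lemma separable_XnsubC n (a : F) : n%:R != 0 :> F -> a != 0 ->
  separable_poly ('X^n - a%:P).
Proof.
move=> n0 a0; rewrite unlock derivB derivXn derivC subr0.
rewrite -scaler_nat coprimepZr // coprimep_expr // coprimepX.
rewrite /root !hornerE; case: n n0 => [|n _]; first by rewrite eqxx.
by rewrite expr0n /= sub0r oppr_eq0.
Qed.

Lemma sep_root n (a : F) : n%:R != 0 :> F -> a != 0 -> exists x, x ^+ n = a.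
Proof.
move=> n0 a0; have n1 : (0 < n)%N by case: n n0 => //; rewrite eqxx.
have [|x] := F_closed _ (separable_XnsubC n0 a0).
  by rewrite size_XnsubC.
by rewrite /root !hornerE subr_eq0 => /eqP; exists x.
Qed.

Lemma sep_prim_root n : (0 < n)%N -> n%:R != 0 :> F -> exists z : F, n.-primitive_root z.
Proof.
move=> n1 n0; have sp := separable_XnsubC n0 (oner_neq0 F).
have [rs urs e] := separable_splits sp.
have lc : lead_coef ('X^n - 1%:P : {poly F}) = 1 by apply/eqP; exact: monicXnsubC.
rewrite lc scale1r in e.
have un : all n.-unity_root rs.
  apply/allP => z zr; rewrite unity_rootE.
  have : root ('X^n - 1%:P) z by rewrite e root_prod_XsubC.
  by rewrite /root !hornerE subr_eq0.
have sz : (n <= size rs)%N.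
  by rewrite -ltnS -(size_prod_XsubC rs id) -e size_XnsubC.
by have /hasP[z _ pz] := has_prim_root n1 un urs sz; exists z.
Qed.

End SeparablyClosed.

(** * Leading terms in the maximal tame extension *)

Section LeadingTerms.
Variables (p : nat) (k ksep : fieldType) (ik : {rmorphism k -> ksep}).
Hypothesis p_char : p \in [pchar k].
Hypothesis p_odd : odd p.
Hypothesis ksep_closed : separable_closure ik.

Lemma coprime2p : coprime 2 p. Proof. by rewrite coprime2n. Qed.

Lemma two_ksep : 2%:R != 0 :> ksep.
Proof. exact: (natr_ksep ik p_char coprime2p). Qed.

Lemma ksep_root n (a : ksep) : coprime n p -> a != 0 -> exists x, x ^+ n = a.
Proof. by move=> np; apply: (sep_root ksep_closed.2 (natr_ksep ik p_char np)). Qed.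

Lemma opp_ksep (a : ksep) : a = - a -> a = 0.
Proof.
move/eqP; rewrite -subr_eq0 opprK -mulr2n -mulr_natl mulf_eq0.
by rewrite (negbTE two_ksep) => /eqP.
Qed.

Section OneField.
Variables (K : cdvField k) (D : tameChoice p ik K).
Local Notation v := (vt D).
Local Notation red := (redt D).
Let hv : valuation v := vt_valuation D.

Lemma unit_part (x : Kt D) : x != 0 -> exists N (m : int),
  [/\ (0 < N)%N, coprime N p, v x = m%:~R / N%:R, x / rt D N ^ m != 0 &
      v (x / rt D N ^ m) = 0].
Proof.
move=> x0; have [N [m [N0 Np vx]]] := vt_coprime x0.
have r0 : rt D N ^ m != 0 by rewrite expfz_neq0 // rt_neq0.
exists N, m; split=> //; first by rewrite mulf_neq0 // invr_eq0.
by rewrite (v_mul hv) ?invr_eq0 // (v_inv hv) // rt_pow_val // vx subrr.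
Qed.

Lemma unit_part2 (x y : Kt D) : x != 0 -> y != 0 -> exists N (m m' : int),
  [/\ (0 < N)%N, coprime N p, v x = m%:~R / N%:R & v y = m'%:~R / N%:R].
Proof.
move=> x0 y0; have [N [m [N0 Np vx]]] := vt_coprime x0.
have [N' [m' [N0' Np' vy]]] := vt_coprime y0.
exists (N * N')%N, (m * N'%:Z), (m' * N%:Z).
have n0 : N%:R != 0 :> rat by rewrite pnatr_eq0 -lt0n.
have n0' : N'%:R != 0 :> rat by rewrite pnatr_eq0 -lt0n.
rewrite muln_gt0 N0 N0' coprimeMl Np Np' vx vy natrM !rmorphM /=.
by split=> //; field; apply/andP.
Qed.

Lemma rt_pow_neq0 N (m : int) : (0 < N)%N -> coprime N p -> rt D N ^ m != 0.
Proof. by move=> N0 Np; rewrite expfz_neq0 // (rt_neq0 D). Qed.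

Lemma unit_val (x : Kt D) N (m : int) : x != 0 -> (0 < N)%N -> coprime N p ->
  v x = m%:~R / N%:R -> x / rt D N ^ m != 0 /\ v (x / rt D N ^ m) = 0.
Proof.
move=> x0 N0 Np vx; have r0 := rt_pow_neq0 m N0 Np.
rewrite mulf_neq0 ?invr_eq0 //; split=> //.
by rewrite (v_mul hv) ?invr_eq0 // (v_inv hv) // rt_pow_val // vx subrr.
Qed.

Lemma tilde_neq0 (x : Kt D) : x != 0 -> tilde x != 0.
Proof.
move=> x0; have [N [m [N0 Np vx u0 vu]]] := unit_part x0.
by rewrite (tildeE N0 Np x0 vx); apply: red_unit.
Qed.

Lemma tildeM (x y : Kt D) : x != 0 -> y != 0 -> tilde (x * y) = tilde x * tilde y.
Proof.
move=> x0 y0; have [N [m [m' [N0 Np vx vy]]]] := unit_part2 x0 y0.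
have [ux0 vux] := unit_val x0 N0 Np vx; have [uy0 vuy] := unit_val y0 N0 Np vy.
have r0 := rt_neq0 D N0 Np.
have xy0 : x * y != 0 by rewrite mulf_neq0.
have vxy : v (x * y) = (m + m')%:~R / N%:R.
  by rewrite (v_mul hv) // vx vy rmorphD mulrDl.
rewrite (tildeE N0 Np xy0 vxy) (tildeE N0 Np x0 vx) (tildeE N0 Np y0 vy).
rewrite -redM ?int_unit //; congr (red _).
by rewrite expfzDr // invfM mulrACA.
Qed.

Lemma tildeN (x : Kt D) : tilde (- x) = - tilde x.
Proof.
have [->|x0] := eqVneq x 0.
  rewrite oppr0 /tilde mul0r.
  have [_ _ _ _ h] := redt_spec D.
  have -> : red 0 = 0 by apply/h; rewrite ?eqxx // /vintegral vge0.
  by rewrite oppr0.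
have [N [m [N0 Np vx u0 vu]]] := unit_part x0.
have nx0 : - x != 0 by rewrite oppr_eq0.
have vnx : v (- x) = m%:~R / N%:R by rewrite (v_opp hv).
by rewrite (tildeE N0 Np nx0 vnx) (tildeE N0 Np x0 vx) mulNr redN // int_unit.
Qed.

Lemma tilde1 : tilde (1 : Kt D) = 1.
Proof.
have v1 : v 1 = (0 : int)%:~R / (1%N)%:R by rewrite (v_one hv) mul0r.
by rewrite (tildeE (ltn0Sn 0) (coprime1n p) (oner_neq0 _) v1) divr1 red1.
Qed.

Lemma tildeV (x : Kt D) : x != 0 -> tilde x^-1 = (tilde x)^-1.
Proof.
move=> x0; apply: (mulfI (tilde_neq0 x0)).
by rewrite -tildeM ?invr_eq0 // !divff ?tilde1 // tilde_neq0.
Qed.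

Lemma tilde_unit (x : Kt D) : x != 0 -> v x = 0 -> tilde x = red x.
Proof.
move=> x0 vx; have v0 : v x = (0 : int)%:~R / (1%N)%:R by rewrite vx mul0r.
by rewrite (tildeE (ltn0Sn 0) (coprime1n p) x0 v0) divr1.
Qed.

(** One power [rt N ^ m] scales both terms to units, and a nonzero sum of residues means that the
    scaled sum is a unit again. *)
Lemma tildeD (x y : Kt D) : x != 0 -> y != 0 -> v x = v y -> tilde x + tilde y != 0 ->
  [/\ x + y != 0, v (x + y) = v x & tilde (x + y) = tilde x + tilde y].
Proof.
move=> x0 y0 vxy; have [N [m [N0 Np vx u0 vu]]] := unit_part x0.
have vy := vx; rewrite vxy in vy; have [uy0 vuy] := unit_val y0 N0 Np vy.
rewrite (tildeE N0 Np x0 vx) (tildeE N0 Np y0 vy) -redD ?int_unit //.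
rewrite -mulrDl => n0; have r0 := rt_pow_neq0 m N0 Np.
have isum : vintegral v ((x + y) / rt D N ^ m).
  by rewrite mulrDl; apply: (vgeD hv); apply: int_unit.
have [z0 vz] : (x + y) / rt D N ^ m != 0 /\ v ((x + y) / rt D N ^ m) = 0.
  have : ~~ (((x + y) / rt D N ^ m == 0) || (0 < v ((x + y) / rt D N ^ m))).
    by apply/negP => /(red_eq0 isum) e; rewrite e eqxx in n0.
  rewrite negb_or -leNgt => /andP[z0 vz]; split=> //; apply/eqP.
  by rewrite eq_le vz; move: isum; rewrite /vintegral /vge (negbTE z0).
have xy0 : x + y != 0 by apply: contraNneq z0 => ->; rewrite mul0r.
have vxy' : v (x + y) = m%:~R / N%:R.
  move: vz; rewrite (v_mul hv) ?invr_eq0 // (v_inv hv) // rt_pow_val //.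
  by move/eqP; rewrite subr_eq0 => /eqP.
by split=> //; [rewrite vx | rewrite (tildeE N0 Np xy0 vxy')].
Qed.

Lemma tilde_dominant (x z : Kt D) : x != 0 -> z = 0 \/ v x < v z -> tilde (x + z) = tilde x.
Proof.
move=> x0 h; have [xz0 vxz] := valD_dominant hv x0 h.
have [N [m [N0 Np vx u0 vu]]] := unit_part x0.
have vxz' := vx; rewrite -vxz in vxz'.
rewrite (tildeE N0 Np xz0 vxz') (tildeE N0 Np x0 vx) mulrDl.
have r0 := rt_pow_neq0 m N0 Np.
have iz : vintegral v (z / rt D N ^ m) /\ red (z / rt D N ^ m) = 0.
  case: h => [->|h].
    by rewrite mul0r; split; [exact: vge0 | apply/red_eq0; [exact: vge0 | rewrite eqxx]].
  have [->|z0] := eqVneq z 0.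
    by rewrite mul0r; split; [exact: vge0 | apply/red_eq0; [exact: vge0 | rewrite eqxx]].
  have vz : 0 < v (z / rt D N ^ m).
    by rewrite (v_mul hv) ?invr_eq0 // (v_inv hv) // rt_pow_val // -vx subr_gt0.
  have iz : vintegral v (z / rt D N ^ m) by rewrite /vintegral /vge (ltW vz) orbT.
  by split=> //; apply/red_eq0 => //; rewrite vz orbT.
by rewrite redD; [rewrite iz.2 addr0 | exact: int_unit | exact: iz.1].
Qed.

(** A power of [rt (2 N)] has half the value of [x], as [2 N] is still prime to the odd [p]. The
    remaining unit has a residue that is a square in [ksep], and its root lifts by [unit_root]. *)
Lemma Kt_sqrt (x : Kt D) : exists y, y ^+ 2 = x.
Proof.
have [->|x0] := eqVneq x 0; first by exists 0; rewrite expr0n.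
have [N [m [N0 Np vx _ _]]] := unit_part x0.
have N20 : (0 < 2 * N)%N by rewrite muln_gt0.
have N2p : coprime (2 * N) p by rewrite coprimeMl coprime2p.
have r0 : rt D (2 * N) ^ m != 0 by apply: rt_pow_neq0.
have vr : v (rt D (2 * N) ^ m) *+ 2 = v x.
  rewrite rt_pow_val // vx natrM; have n0 : N%:R != 0 :> rat by rewrite pnatr_eq0 -lt0n.
  by field.
have r20 := expf_neq0 2 r0.
have u0 : x / (rt D (2 * N) ^ m) ^+ 2 != 0 by rewrite mulf_neq0 ?invr_eq0.
have vu : v (x / (rt D (2 * N) ^ m) ^+ 2) = 0.
  by rewrite (v_mul hv) ?invr_eq0 // (v_inv hv) // (v_exp hv) // vr subrr.
have [c cE] := ksep_root coprime2p (red_unit u0 vu).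
have [z [zE _ _ _]] := unit_root p_char (isT : (0 < 2)%N) coprime2p u0 vu (esym cE).
by exists (z * rt D (2 * N) ^ m); rewrite exprMn zE divfK.
Qed.

Lemma Kt_two : 2%:R != 0 :> Kt D.
Proof. by case: (natr_Kt p_char D coprime2p). Qed.

Lemma Kt_infinite (s : seq (Kt D)) : exists x, x \notin s.
Proof.
apply: contrapT => /forallNP h.
pose t := [seq iKt D (unif D) ^+ i | i <- iota 0 (size s).+1].
have : (size t <= size s)%N.
  apply: uniq_leq_size; last by move=> x _; have /negP := h x; rewrite negbK.
  rewrite map_inj_uniq ?iota_uniq // => i j /(congr1 v).
  rewrite !(v_exp hv) ?unif_Kt_neq0 // vt_vK ?unif_neq0 // vK_unif.
  by move/eqP; rewrite eqr_nat => /eqP.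
by rewrite size_map size_iota ltnn.
Qed.

End OneField.

Section SimTheory.
Variables (K1 K2 : cdvField k) (D1 : tameChoice p ik K1) (D2 : tameChoice p ik K2).
Let hv1 : valuation (vt D1) := vt_valuation D1.
Let hv2 : valuation (vt D2) := vt_valuation D2.

Lemma sim0 : sim (0 : Kt D1) (0 : Kt D2). Proof. by left. Qed.

Lemma sim0l (x' : Kt D2) : sim (0 : Kt D1) x' -> x' = 0.
Proof. by case=> [[]//|[]]; rewrite eqxx. Qed.

Lemma sim0r (x : Kt D1) : sim x (0 : Kt D2) -> x = 0.
Proof. by case=> [[]//|[_]]; rewrite eqxx. Qed.

Lemma simM (x y : Kt D1) (x' y' : Kt D2) : sim x x' -> sim y y' -> sim (x * y) (x' * y').
Proof.
case=> [[-> ->]|[x0 x0' vx tx]]; first by rewrite !mul0r => _; left.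
case=> [[-> ->]|[y0 y0' vy ty]]; first by rewrite !mulr0; left.
right; rewrite !mulf_neq0 // (v_mul hv1) // (v_mul hv2) // vx vy.
by rewrite !tildeM // tx ty.
Qed.

Lemma simV (x : Kt D1) (x' : Kt D2) : sim x x' -> sim x^-1 x'^-1.
Proof.
case=> [[-> ->]|[x0 x0' vx tx]]; first by rewrite !invr0; left.
by right; rewrite !invr_eq0 (v_inv hv1) // (v_inv hv2) // vx !tildeV // tx.
Qed.

Lemma simN (x : Kt D1) (x' : Kt D2) : sim x x' -> sim (- x) (- x').
Proof.
case=> [[-> ->]|[x0 x0' vx tx]]; first by rewrite !oppr0; left.
by right; rewrite !oppr_eq0 (v_opp hv1) (v_opp hv2) vx !tildeN tx.
Qed.

Lemma sim_sym (x : Kt D1) (x' : Kt D2) : sim x x' -> sim x' x.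
Proof. by case=> [[-> ->]|[? ? ? ?]]; [left | right]. Qed.

(** If the values differ, the term of smaller value dominates on both sides. If they agree, the
    residues add up, and their sum vanishes exactly in the second alternative. *)
Lemma simD (x y : Kt D1) (x' y' : Kt D2) :
  sim x x' -> sim y y' -> sim (x + y) (x' + y') \/ sim x (- y).
Proof.
move=> hx hy; case: (hx) => [[-> ->]|[x0 x0' vx tx]]; first by left; rewrite !add0r.
case: (hy) => [[-> ->]|[y0 y0' vy ty]]; first by left; rewrite !addr0.
have dom (z w : Kt D1) (z' w' : Kt D2) : z != 0 -> z' != 0 -> vt D1 z = vt D2 z' ->
    tilde z = tilde z' -> vt D1 w = vt D2 w' -> vt D1 z < vt D1 w -> sim (z + w) (z' + w').
  move=> z0 z0' vz tz vw zw; have h : w = 0 \/ vt D1 z < vt D1 w by right.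
  have h' : w' = 0 \/ vt D2 z' < vt D2 w' by right; rewrite -vz -vw.
  have [n1 v1] := valD_dominant hv1 z0 h; have [n2 v2] := valD_dominant hv2 z0' h'.
  by right; rewrite v1 v2 !tilde_dominant.
have [lt|gt|e] := ltgtP (vt D1 x) (vt D1 y).
- by left; apply: dom.
- by left; rewrite addrC [x' + _]addrC; apply: dom.
have [t0|t0] := eqVneq (tilde x + tilde y) 0.
  right; right; rewrite oppr_eq0 (v_opp hv1) tildeN; split=> //.
  by apply/eqP; rewrite -addr_eq0 t0.
have e' : vt D2 x' = vt D2 y' by rewrite -vx -vy.
have t0' : tilde x' + tilde y' != 0 by rewrite -tx -ty.
have [n1 v1 t1] := tildeD x0 y0 e t0; have [n2 v2 t2] := tildeD x0' y0' e' t0'.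
by left; right; rewrite v1 v2 t1 t2 tx ty.
Qed.

Lemma sim_sqr (x : Kt D1) (x' : Kt D2) :
  sim (x ^+ 2) (x' ^+ 2) -> sim x x' \/ sim x (- x').
Proof.
case=> [[/eqP + /eqP]|[]]; rewrite !expf_eq0 /=.
  by move=> /eqP -> /eqP ->; left; left.
move=> x0 x0' vx; rewrite !expr2 !tildeM // -!expr2 => /eqP.
have {}vx : vt D1 x = vt D2 x'.
  by move: vx; rewrite (v_exp hv1) // (v_exp hv2) // => /eqP; rewrite eqrMn2r => /eqP.
rewrite eqf_sqr => /orP[] /eqP tx; [left | right]; right; split=> //.
- by rewrite oppr_eq0.
- by rewrite (v_opp hv2).
- by rewrite tildeN.
Qed.

Lemma sim_sign (x : Kt D1) (x' : Kt D2) : sim x x' -> sim x (- x') -> x = 0.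
Proof.
case=> [[]//|[x0 x0' vx tx]] [[]//|[_ _ _]]; rewrite tildeN -tx => /opp_ksep e.
by have := tilde_neq0 x0; rewrite e eqxx.
Qed.

End SimTheory.

Lemma sim_refl (K : cdvField k) (D : tameChoice p ik K) (x : Kt D) : sim x x.
Proof. by have [->|x0] := eqVneq x 0; [left | right]. Qed.

Lemma sim_trans (K1 K2 K3 : cdvField k) (D1 : tameChoice p ik K1)
    (D2 : tameChoice p ik K2) (D3 : tameChoice p ik K3)
    (x : Kt D1) (y : Kt D2) (z : Kt D3) : sim x y -> sim y z -> sim x z.
Proof.
case=> [[-> ->] /sim0l ->|[x0 y0 vxy txy]]; first by left.
case=> [[y0']|[_ z0 vyz tyz]]; first by rewrite y0' eqxx in y0.
by right; split=> //; [rewrite vxy | rewrite txy].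
Qed.

Lemma sim_leading (K1 K2 : cdvField k) (D1 : tameChoice p ik K1) (D2 : tameChoice p ik K2) :
  leading (@sim p k ksep ik K1 K1 D1 D1) (@sim p k ksep ik K1 K2 D1 D2).
Proof.
split.
- exact: sim0.
- exact: sim0l.
- exact: sim0r.
- exact: simM.
- exact: simV.
- exact: simN.
- exact: simD.
- exact: sim_sqr.
- by move=> x y x'; apply: sim_trans.
- exact: sim_sign.
Qed.

Lemma sim_lead_equiv (K : cdvField k) (D : tameChoice p ik K) :
  lead_equiv (@sim p k ksep ik K K D D).
Proof.
split; [exact: sim_leading | exact: sim_refl | exact: sim_sym |].
move=> x; have [->//|x0] := eqVneq x 0.
case=> [[]//|[_ _ _]]; have t0 := tilde_neq0 x0.
have n0 : tilde x + tilde x != 0.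
  by rewrite -mulr2n -mulr_natl mulf_neq0 // two_ksep.
have [_ _ ->] := tildeD x0 x0 erefl n0.
by rewrite -[X in _ = X]addr0 => /addrI e; rewrite e eqxx in t0.
Qed.

(** * Compatibility of leading terms with the identification of Galois groups *)

Section Equivariance.
Variables (K K' : cdvField k) (D : tameChoice p ik K) (D' : tameChoice p ik K').
Variable Psi : tameGal D -> tameGal D'.
Hypothesis HPsi : tame_identification Psi.

Lemma lift_prim_root (K1 : cdvField k) (D1 : tameChoice p ik K1) n (w : ksep) :
  (0 < n)%N -> coprime n p -> n.-primitive_root w ->
  exists z : Kt D1, [/\ n.-primitive_root z, vt D1 z = 0 & redt D1 z = w].
Proof.
move=> n0 np pw; have v1 : vt D1 1 = 0 by rewrite (v_one (vt_valuation D1)).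
have r1 : redt D1 1 = w ^+ n by rewrite red1 (prim_expr_order pw).
have [z [zn z0 vz rz]] := unit_root p_char n0 np (oner_neq0 _) v1 r1.
exists z; split=> //.
have [m pm mn] := prim_order_exists n0 zn.
suff -> : n = m by [].
apply/eqP; rewrite eqn_dvd mn andbT (prim_order_dvd pw).
by rewrite -rz -(redX m (int_unit vz)).2 (prim_expr_order pm) red1.
Qed.

(** Both quotients are [n]-th roots of unity, hence powers of primitive ones with a common
    reduction, and [Psi] matches the exponents. The outcome no longer depends on a choice of root of
    unity. *)
Lemma rt_quotient (s : tameGal D) n : (0 < n)%N -> coprime n p ->
  [/\ vt D (s (rt D n) / rt D n) = 0, vt D' (Psi s (rt D' n) / rt D' n) = 0 &
      redt D (s (rt D n) / rt D n) = redt D' (Psi s (rt D' n) / rt D' n)].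
Proof.
move=> n0 np; have [w pw] := sep_prim_root ksep_closed.2 n0 (natr_ksep ik p_char np).
have [z [pz vz rz]] := lift_prim_root D n0 np pw.
have [z' [pz' vz' rz']] := lift_prim_root D' n0 np pw.
have r0 := rt_neq0 D n0 np; have r0' := rt_neq0 D' n0 np.
have e : (s (rt D n) / rt D n) ^+ n = 1.
  by rewrite expr_div_n -rmorphXn (rtX D n0 np) /= gal_fix divff // unif_Kt_neq0.
have [b bE] := prim_rootP pz e.
have sE : s (rt D n) = z ^+ b * rt D n by rewrite -bE divfK.
have [_ _ _ h] := HPsi.
have sE' := (h s n z z' b n0 np pz pz' (etrans rz (esym rz'))).1 sE.
have bE' : Psi s (rt D' n) / rt D' n = z' ^+ b by rewrite sE' mulfK.
have z0 : z != 0 by rewrite (prim_root_eq0 pz) -lt0n.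
have z0' : z' != 0 by rewrite (prim_root_eq0 pz') -lt0n.
rewrite bE bE' (v_exp (vt_valuation D)) // (v_exp (vt_valuation D')) // vz vz' !mul0rn.
by rewrite (redX b (int_unit vz)).2 (redX b (int_unit vz')).2 rz rz'.
Qed.

(** With [rho = rt D N] and [m / N] the value of [x], [tilde (s x)] is the reduction of
    [s (x / rho^m)] times that of [(s rho / rho)^m]. The first factor is governed by the residual
    action, the second by [rt_quotient]. *)
Lemma sim_gal (s : tameGal D) (x : Kt D) (x' : Kt D') :
  sim x x' -> sim (s x) (Psi s x').
Proof.
case=> [[-> ->]|[x0 x0' vx tx]]; first by rewrite !rmorph0; left.
right; rewrite !fmorph_eq0 !vt_gal; split=> //.
have [N [m [N0 Np vxm u0 vu]]] := unit_part x0.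
have vxm' := vxm; rewrite vx in vxm'; have [u0' vu'] := unit_val x0' N0 Np vxm'.
have [vq vq' rq] := rt_quotient s N0 Np.
have r0 := rt_neq0 D N0 Np; have r0' := rt_neq0 D' N0 Np.
have q0 : s (rt D N) / rt D N != 0 by rewrite mulf_neq0 ?invr_eq0 ?fmorph_eq0.
have q0' : Psi s (rt D' N) / rt D' N != 0 by rewrite mulf_neq0 ?invr_eq0 ?fmorph_eq0.
have key (K1 : cdvField k) (D1 : tameChoice p ik K1) (t : tameGal D1) (y : Kt D1) :
    y != 0 -> vt D1 y = m%:~R / N%:R ->
    t (rt D1 N) / rt D1 N != 0 -> vt D1 (t (rt D1 N) / rt D1 N) = 0 ->
    tilde (t y) = redt D1 (t (y / rt D1 N ^ m)) * redt D1 (t (rt D1 N) / rt D1 N) ^ m.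
  move=> y0 vy qq0 vqq; have t0 : t y != 0 by rewrite fmorph_eq0.
  have vty : vt D1 (t y) = m%:~R / N%:R by rewrite vt_gal.
  have [uy0 vuy] := unit_val y0 N0 Np vy.
  rewrite (tildeE N0 Np t0 vty) -redXz // -redM; last 2 first.
  - by apply: int_unit; rewrite vt_gal.
  - by apply: int_unit; rewrite (v_expz (vt_valuation D1)) // vqq mul0rz.
  have tr0 : t (rt D1 N) ^ m != 0 by rewrite expfz_neq0 // fmorph_eq0 (rt_neq0 D1).
  have e1 : t (y / rt D1 N ^ m) = t y / t (rt D1 N) ^ m by rewrite fmorph_div fmorphXz.
  have e2 : (t (rt D1 N) / rt D1 N) ^ m = t (rt D1 N) ^ m / rt D1 N ^ m.
    by rewrite expfzMl exprz_inv invr_expz.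
  by congr (redt D1 _); rewrite e1 e2 mulrA divfK.
rewrite (key _ _ _ _ x0 vxm q0 vq) (key _ _ _ _ x0' vxm' q0' vq') rq; congr (_ * _).
have [_ _ h _] := HPsi; apply: h; do ?exact: int_unit.
by rewrite -(tildeE N0 Np x0 vxm) -(tildeE N0 Np x0' vxm').
Qed.

End Equivariance.

End LeadingTerms.

(** * Tate modules *)

(** A field morphism combined with a rescaling of coordinates. It serves for the passage from [Kt]
    to [Ks], for Galois actions, and for the change to a monic equation. *)
Definition ec_map (L1 L2 : fieldType) (j : L1 -> L2) (al be : L2)
    (P : ec_point L1) : ec_point L2 :=
  omap (fun xy => (al * j xy.1, be * j xy.2)) P.

Section Transfer.
Variables (L1 L2 : fieldType) (j : {rmorphism L1 -> L2}) (al be la : L2).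
Variables (G : {poly L1}) (g g0 : {poly L2}) (a b c : L1).
Hypothesis sG : splits3 G a b c.
Hypothesis sg : splits3 g0 (al * j a) (al * j b) (al * j c).
Hypothesis gE : g = la *: g0.
Hypothesis al0 : al != 0.
Hypothesis be0 : be != 0.
Hypothesis scale : la * al ^+ 3 = be ^+ 2.

Lemma ec_map_inj : injective (ec_map j al be).
Proof.
move=> [[x y]|] [[x' y']|] //= [/(mulfI al0)/fmorph_inj -> /(mulfI be0)/fmorph_inj ->].
by [].
Qed.

Lemma transfer_la_neq0 : la != 0.
Proof.
by apply: contraNneq (expf_neq0 2 be0) => e; rewrite -scale e mul0r.
Qed.

Lemma transfer_horner x : g.[al * j x] = be ^+ 2 * j G.[x].
Proof.
rewrite gE hornerZ (splits3_horner _ sg) (splits3_horner _ sG) !rmorphM !rmorphB.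
rewrite -scale; ring.
Qed.

Lemma transfer_deriv x : g^`().[al * j x] * al = be ^+ 2 * j G^`().[x].
Proof.
rewrite gE derivZ hornerZ (splits3_deriv _ sg) (splits3_deriv _ sG).
rewrite !(rmorphD, rmorphM, rmorphN) -scale; ring.
Qed.

Lemma ec_map_on P : on_curve G P <-> on_curve g (ec_map j al be P).
Proof.
case: P => [[x y]|] //=; rewrite transfer_horner exprMn -rmorphXn.
have b2 := expf_neq0 2 be0; split=> [-> //|/(mulfI b2)].
exact: fmorph_inj.
Qed.

Lemma ec_map_add P Q :
  ec_map j al be (ec_add G P Q) = ec_add g (ec_map j al be P) (ec_map j al be Q).
Proof.
case: P Q => [[x1 y1]|] [[x2 y2]|] //=.
rewrite (inj_eq (mulfI al0)) -mulrN -rmorphN (inj_eq (mulfI be0)) !(inj_eq (fmorph_inj j)).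
case: ifP => //= c0.
set l := if x1 == x2 then _ else _; set l' := if x1 == x2 then _ else _.
have l'E : l' = be / al * j l.
  rewrite /l' /l; case: eqP => _.
    rewrite fmorph_div -mulrnAr -rmorphMn.
    have -> : g^`().[al * j x1] = be ^+ 2 / al * j G^`().[x1].
      by apply: (mulIf al0); rewrite transfer_deriv; field.
    by rewrite invfM; set u := (j (_ *+ 2))^-1; field; apply/andP.
  rewrite -mulrBr -rmorphB -mulrBr -rmorphB fmorph_div invfM.
  by rewrite !mulrA; congr (_ * _); rewrite -!mulrA [al^-1 * _]mulrC.
have la0 := transfer_la_neq0.
have g2 : g`_2 = la * al * j G`_2.
  rewrite gE coefZ (splits3_coef2 sg) (splits3_coef2 sG) rmorphN !rmorphD; ring.
have g3 : g`_3 = la by rewrite gE coefZ (splits3_coef3 sg) mulr1.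
have x3E : (l' ^+ 2 - g`_2) / g`_3 - al * j x1 - al * j x2 =
    al * j ((l ^+ 2 - G`_2) / G`_3 - x1 - x2).
  rewrite g2 g3 (splits3_coef3 sG) divr1 !rmorphB rmorphXn l'E exprMn.
  have -> : (be / al) ^+ 2 = la * al.
    by rewrite expr_div_n -scale; field.
  by rewrite !mulrBr; congr (_ - _ - _); field.
rewrite x3E; congr Some; congr pair.
rewrite rmorphN rmorphD rmorphM mulrN mulrDr; congr (- (_ + _)).
by rewrite l'E -mulrBr -rmorphB; move: (j (_ - x1)) => w; field.
Qed.

End Transfer.

Section Transfer1.
Variables (L1 L2 : fieldType) (j : {rmorphism L1 -> L2}).
Variables (G : {poly L1}) (g : {poly L2}) (a b c : L1).
Hypothesis sG : splits3 G a b c.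
Hypothesis sg : splits3 g (j a) (j b) (j c).

Let sg1 : splits3 g (1 * j a) (1 * j b) (1 * j c).
Proof. by rewrite !mul1r. Qed.
Let scale1 : 1 * 1 ^+ 3 = 1 ^+ 2 :> L2. Proof. by rewrite !expr1n mulr1. Qed.
Let g1 : g = 1 *: g. Proof. by rewrite scale1r. Qed.

Lemma ec_map1_on P : on_curve G P <-> on_curve g (ec_map j 1 1 P).
Proof. exact: (ec_map_on sG sg1 g1 (oner_neq0 L2) scale1). Qed.

Lemma ec_map1_add P Q :
  ec_map j 1 1 (ec_add G P Q) = ec_add g (ec_map j 1 1 P) (ec_map j 1 1 Q).
Proof. exact: (ec_map_add sG sg1 g1 (oner_neq0 L2) (oner_neq0 L2) scale1). Qed.

End Transfer1.

(** By [models_tors] all 2-power torsion over [L] is already visible on [C]. Questions on [tate2 g]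
    thus move to the abelian group [mpoint C], and no group axioms are needed on [ec_point L]. *)
Record models (C : mcurve) (L : fieldType) (g : {poly L}) (i : mpoint C -> ec_point L)
    : Prop := Models {
  models_inj : injective i;
  models_on : forall P, on_curve g (i P);
  models0 : i 0 = None;
  modelsD : forall P Q, i (P + Q) = ec_add g (i P) (i Q);
  models_tors : forall n Z, ec_torsion g (2 ^ n) Z -> exists P, i P = Z }.

Section Lift.
Variables (C : mcurve) (L : fieldType) (g : {poly L}) (i : mpoint C -> ec_point L).
Hypothesis Hi : models g i.

Definition unmodel (Z : ec_point L) : mpoint C :=
  if pselect (exists P, i P = Z) is left h then sval (cid h) else 0.

Lemma unmodelK P : unmodel (i P) = P.
Proof.
rewrite /unmodel; case: pselect => [h|]; last by case; exists P.
by case: cid => Q /= /(models_inj Hi).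
Qed.

Lemma models_muln n P : i (P *+ n) = ec_muln g n (i P).
Proof.
elim: n => [|n IH]; first by rewrite mulr0n (models0 Hi).
by rewrite mulrS (modelsD Hi) IH.
Qed.

Lemma models_torsE n P : ec_torsion g (2 ^ n) (i P) <-> P *+ (2 ^ n) = 0.
Proof.
rewrite /ec_torsion /= -models_muln -(models0 Hi); split=> [[_ /(models_inj Hi)] //|->].
by split=> //; apply: (models_on Hi).
Qed.

Lemma tate_points Z : tate2 g Z -> exists P : nat -> mpoint C,
  [/\ forall n, Z n = i (P n), forall n, P n *+ (2 ^ n) = 0 &
      forall n, P n.+1 *+ 2 = P n].
Proof.
move=> hZ; have /choice[P PE] : forall n, exists P, i P = Z n.
  by move=> n; apply: (models_tors Hi) (hZ n).1.
exists P; split=> [//|n|n].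
  by apply/models_torsE; rewrite PE; case: (hZ n).
by apply: (models_inj Hi); rewrite models_muln !PE; case: (hZ n).
Qed.

Lemma tate_of_points (P : nat -> mpoint C) :
  (forall n, P n *+ (2 ^ n) = 0) -> (forall n, P n.+1 *+ 2 = P n) ->
  tate2 g (fun n => i (P n)).
Proof.
move=> h1 h2 n; split; first by apply/models_torsE.
by rewrite -models_muln h2.
Qed.

End Lift.

(** Restricted to 2-power torsion because [theta_map] takes the default value 0 elsewhere. *)
Definition tors_additive (C C' : mcurve) (f : mpoint C -> mpoint C') : Prop :=
  f 0 = 0 /\ forall n P Q, P *+ (2 ^ n) = 0 -> Q *+ (2 ^ n) = 0 -> f (P + Q) = f P + f Q.

Section LiftMap.
Variables (C C' : mcurve) (L L' : fieldType) (g : {poly L}) (g' : {poly L'}).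
Variables (i : mpoint C -> ec_point L) (i' : mpoint C' -> ec_point L').
Hypotheses (Hi : models g i) (Hi' : models g' i').

Definition tate_lift (f : mpoint C -> mpoint C') (Z : nat -> ec_point L) :
  nat -> ec_point L' := fun n => i' (f (unmodel i (Z n))).

Variable f : mpoint C -> mpoint C'.
Hypothesis fA : tors_additive f.

Lemma tors_additive_muln n m P : P *+ (2 ^ n) = 0 -> f (P *+ m) = f P *+ m.
Proof.
move=> tP; elim: m => [|m IH]; first by rewrite !mulr0n fA.1.
rewrite !mulrS (fA.2 n) ?IH //.
by rewrite -mulrnA mulnC mulrnA tP mul0rn.
Qed.

Lemma tate_lift_linear : Z2_linear g g' (tate_lift f).
Proof.
split.
- move=> Z /(tate_points Hi)[P [ZE t1 t2]].
  have -> : tate_lift f Z = fun n => i' (f (P n)).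
    by apply/funext => n; rewrite /tate_lift ZE (unmodelK Hi).
  apply: (tate_of_points Hi') => n.
    by rewrite -(tors_additive_muln _ (t1 n)) t1 fA.1.
  by rewrite -(tors_additive_muln _ (t1 n.+1)) t2.
- move=> Z W /(tate_points Hi)[P [ZE t1 _]] /(tate_points Hi)[Q [WE t2 _]].
  apply/funext => n; rewrite /tate_lift /tate_add ZE WE -(modelsD Hi).
  by rewrite !(unmodelK Hi) (fA.2 n) // (modelsD Hi').
- move=> m Z _ /(tate_points Hi)[P [ZE t1 _]].
  apply/funext => n; rewrite /tate_lift /tate_scale ZE -(models_muln Hi).
  by rewrite !(unmodelK Hi) (tors_additive_muln _ (t1 n)) (models_muln Hi').
Qed.

End LiftMap.

(** * Automorphisms acting on points, and equivariance of the pairing *)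

Section FieldAction.
Variables (C : mcurve) (t : {rmorphism C -> C}).
Local Notation G := (mpol C).
Hypothesis tG : forall a b c, splits3 G a b c -> splits3 G (t a) (t b) (t c).

Lemma maction_on (P : mpoint C) : on_curve G (ec_map t 1 1 P).
Proof.
have [a [b [c s]]] := mpol_splits C.
exact: (proj1 (ec_map1_on s (tG s) P) (mvalP P)).
Qed.

Definition maction (P : mpoint C) : mpoint C := MPoint (maction_on P).

Lemma maction0 : maction 0 = 0.
Proof. exact: mval_inj. Qed.

Lemma mactionD P Q : maction (P + Q) = maction P + maction Q.
Proof.
have [a [b [c s]]] := mpol_splits C.
apply: mval_inj; exact: (ec_map1_add s (tG s)).
Qed.

Lemma maction_muln P n : maction (P *+ n) = maction P *+ n.
Proof.
elim: n => [|n IH]; first by rewrite !mulr0n maction0.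
by rewrite !mulrS mactionD IH.
Qed.

Lemma xc_maction P : xc (maction P) = t (xc P).
Proof. by rewrite /xc /=; case: (mval P) => [[x y]|] /=; rewrite ?mul1r ?rmorph0. Qed.

Lemma yc_maction P : yc (maction P) = t (yc P).
Proof. by rewrite /yc /=; case: (mval P) => [[x y]|] /=; rewrite ?mul1r ?rmorph0. Qed.

Lemma maction_eq0 P : (maction P == 0) = (P == 0).
Proof.
apply/eqP/eqP => [|->]; last exact: maction0.
move=> /(congr1 (@mval C)) /=; case e: (mval P) => [[]|] //= _.
exact: mval_eq0.
Qed.

Lemma halfroot_maction e P : halfroot (t e) (maction P) = t (halfroot e P).
Proof.
have [a [b [c s]]] := mpol_splits C; have s' := tG s.
rewrite /halfroot xc_maction yc_maction (splits3_deriv _ s') (splits3_deriv _ s).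
by rewrite !(rmorphB, fmorph_div, rmorphD, rmorphM, rmorph_nat).
Qed.

Lemma root_action_surj e : root G e -> exists2 e0, root G e0 & t e0 = e.
Proof.
have [a [b [c s]]] := mpol_splits C; have s' := tG s.
rewrite (splits3_root _ s') => /or3P[] /eqP ->.
- by exists a; rewrite // (splits3_root _ s) eqxx.
- by exists b; rewrite // (splits3_root _ s) eqxx orbT.
- by exists c; rewrite // (splits3_root _ s) eqxx !orbT.
Qed.

End FieldAction.

(** The pairing is built from [mrt] and [mS] alone, so a pair of automorphisms respecting these
    respects it. *)
Lemma theta_action (C C' : mcurve) (X : matching C C')
    (t : {rmorphism C -> C}) (t' : {rmorphism C' -> C'})
    (tG : forall a b c, splits3 (mpol C) a b c -> splits3 (mpol C) (t a) (t b) (t c))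
    (tG' : forall a b c, splits3 (mpol C') a b c ->
       splits3 (mpol C') (t' a) (t' b) (t' c)) :
  (forall e e', mrt X e e' -> mrt X (t e) (t' e')) ->
  (forall x x', mS X x x' -> mS X (t x) (t' x')) ->
  forall P P', theta X P P' -> theta X (maction tG P) (maction tG' P').
Proof.
move=> hm hS P P'; elim=> {P P'}.
- by rewrite !maction0; apply: theta0.
- move=> T T' T0 T0' y0 y0' mT; apply: thetaT; rewrite ?maction_eq0 //.
  + by rewrite yc_maction y0 rmorph0.
  + by rewrite yc_maction y0' rmorph0.
  + by rewrite !xc_maction; apply: hm.
- move=> P P' y0 y0' _ IH h; apply: thetaS.
  + by rewrite yc_maction fmorph_eq0.
  + by rewrite yc_maction fmorph_eq0.
  + by rewrite -!maction_muln.
  (* The half root of the image of [P] at [e] is the image of the half root of [P] at the preimage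
     of [e], which is again a root. *)
  move=> e e' me; have [re _] := mrt_root me.
  have [e0 r0 te0] := root_action_surj tG re.
  have [e0' m0] := mrt_l X r0; have := hm _ _ m0; rewrite te0 => m1.
  rewrite -te0 (mrt_fun me m1) !halfroot_maction.
  by apply: hS; apply: h.
Qed.

Lemma theta_unflip C C' (X : matching C C') P P' :
  theta (matching_flip X) P' P -> theta X P P'.
Proof.
elim=> {P P'}.
- exact: theta0.
- by move=> T T' *; apply: thetaT.
- move=> P P' y0 y0' _ IH h; apply: thetaS => // e e' /h.
  by move=> /(mS_sym X).
Qed.

Section ThetaMap.
Variables (C C' : mcurve) (X : matching C C').

Definition theta_map (P : mpoint C) : mpoint C' :=
  if pselect (exists P', theta X P P') is left h then sval (cid h) else 0.

Lemma theta_mapE P P' : theta X P P' -> theta_map P = P'.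
Proof.
rewrite /theta_map => h; case: pselect => [h2|]; last by case; exists P'.
by case: cid => Q /= hQ; apply: theta_fun hQ h.
Qed.

Lemma theta_mapP n P : P *+ (2 ^ n) = 0 -> theta X P (theta_map P).
Proof. by move=> /(theta_total X)[P' h]; rewrite (theta_mapE h). Qed.

Lemma theta_map_additive : tors_additive theta_map.
Proof.
split; first by apply: theta_mapE; exact: theta0.
move=> n P Q tP tQ; apply: theta_mapE.
exact: (theta_add tP tQ (theta_mapP tP) (theta_mapP tQ)).
Qed.

Variables (L L' : fieldType) (g : {poly L}) (g' : {poly L'}).
Variables (i : mpoint C -> ec_point L) (i' : mpoint C' -> ec_point L').
Hypotheses (Hi : models g i) (Hi' : models g' i').

(** For surjectivity, partners are chosen level by level; the pairing respects doubling and is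
    injective, which makes the choices torsion of the right order and compatible. *)
Lemma tate_lift_theta_bij : set_bij (tate2 g) (tate2 g') (tate_lift i i' theta_map).
Proof.
split.
- by case: (tate_lift_linear Hi Hi' theta_map_additive).
- move=> Z W /set_mem/(tate_points Hi)[P [ZE tP _]] /set_mem/(tate_points Hi)[Q [WE tQ _]] e.
  apply/funext => n; rewrite ZE WE; congr i.
  have := congr1 (fun u => u n) e; rewrite /tate_lift ZE WE !(unmodelK Hi).
  move=> /(models_inj Hi') e2; have h := theta_mapP (tP n); rewrite e2 in h.
  exact: theta_inj h (theta_mapP (tQ n)).
- move=> W /(tate_points Hi')[Q [WE tQ sQ]].
  have /choice[P hP] : forall n, exists P, theta X P (Q n).
    move=> n; have [P h] := theta_total (matching_flip X) (tQ n).
    by exists P; apply: theta_unflip.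
  have dbl k n : theta X (P n *+ (2 ^ k)) (Q n *+ (2 ^ k)).
    elim: k => [|k IH]; first by rewrite !mulr1n.
    by rewrite expnS mulnC !mulrnA; apply: theta_double.
  have tP n : P n *+ (2 ^ n) = 0.
    apply/eqP; apply: contraT => n0; have := theta_neq0 (dbl n n) n0.
    by rewrite tQ eqxx.
  have sP n : P n.+1 *+ 2 = P n.
    apply: (theta_inj (theta_double (hP n.+1))); rewrite sQ; exact: hP.
  exists (fun n => i (P n)); first exact: (tate_of_points Hi).
  by apply/funext => n; rewrite /tate_lift (unmodelK Hi) WE (theta_mapE (hP n)).
Qed.

End ThetaMap.

(** * Rationality of 2-power torsion over a field with square roots *)

Section Descent.
Variables (C C1 : mcurve) (j : {rmorphism C -> C1}) (a b c : C).
Hypothesis s : splits3 (mpol C) a b c.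
Hypothesis s1 : splits3 (mpol C1) (j a) (j b) (j c).

(** If [2Z] is rational over [C], the half roots of [Z] are square roots of elements of [C], hence
    lie in [C], and the coordinates of [Z] are polynomials in them. *)
Lemma tors_descent n (Z : mpoint C1) : Z *+ (2 ^ n) = 0 ->
  exists P : mpoint C, mval Z = ec_map j 1 1 (mval P).
Proof.
have build x y (W : mpoint C1) : W != 0 -> xc W = j x -> yc W = j y ->
    exists P : mpoint C, mval W = ec_map j 1 1 (mval P).
  move=> W0 xE yE; have e : mval W = ec_map j 1 1 (Some (x, y)).
    by rewrite (mval_neq0 W0) xE yE /= !mul1r.
  have on : on_curve (mpol C) (Some (x, y)).
    by apply/(ec_map1_on s s1); rewrite -e; apply: mvalP.
  by exists (@MPoint C _ on).
elim: n Z => [|n IH] Z; first by rewrite mulr1n => ->; exists 0.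
rewrite expnS mulrnA => tZ; have [->|Z0] := eqVneq Z 0; first by exists 0.
have [y0|y0] := eqVneq (yc Z) 0.
  have Z2 : Z *+ 2 = 0 by apply/eqP; rewrite yc_double y0.
  have [rZ _] := tpoint_root Z0 Z2.
  have [x xE] : exists x, xc Z = j x.
    by move: rZ; rewrite (splits3_root _ s1) => /or3P[] /eqP ->; eexists.
  by apply: (build x 0) => //; rewrite y0 rmorph0.
have [P PE] := IH _ tZ.
have Z20 : Z *+ 2 != 0 by rewrite yc_double.
have [x2 x2E] : exists x2, xc (Z *+ 2) = j x2.
  have := PE; rewrite (mval_neq0 Z20); case: (mval P) => [[x y]|] //= [-> _].
  by exists x; rewrite mul1r.
have half e f g : splits3 (mpol C1) (j e) f g -> exists r, halfroot (j e) Z = j r.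
  move=> t; have [xE _] := halfroot_double t y0.
  have [r rE] := mfield_sqrt (x2 - e).
  have : halfroot (j e) Z ^+ 2 = (j r) ^+ 2.
    by rewrite -rmorphXn rE rmorphB -x2E xE addrC addKr.
  move/eqP; rewrite eqf_sqr -rmorphN => /orP[] /eqP ->; by eexists.
have [p pE] := half _ _ _ s1.
have [q qE] := half _ _ _ (splits3_rot s1).
have [r rE] := half _ _ _ (splits3_rot (splits3_rot s1)).
have [xE yE _] := halfroot_coords s1 y0.
move: xE yE; rewrite pE qE rE -!rmorphD -!rmorphM -rmorphD => xE yE.
exact: build xE yE.
Qed.

End Descent.

Lemma infinite_embed (F F' : fieldType) (j : {rmorphism F -> F'}) :
  (forall s : seq F, exists x, x \notin s) -> forall s : seq F', exists x, x \notin s.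
Proof.
move=> h s; pose g (y : F') : F := if pselect (exists x, j x = y) is left e
  then sval (cid e) else 0.
have gK x : g (j x) = x.
  rewrite /g; case: pselect => [e|]; last by case; exists x.
  by case: cid => z /= /fmorph_inj.
have [x xs] := h (map g s); exists (j x); apply: contra xs => jxs.
by rewrite -(gK x); apply: map_f.
Qed.

(** * Monic models over the tame extension, and the tame Galois action *)

Section Model.
Variables (p : nat) (k ksep : fieldType) (ik : {rmorphism k -> ksep}).
Hypothesis p_char : p \in [pchar k].
Hypothesis p_odd : odd p.
Hypothesis ksep_closed : separable_closure ik.
Variables (K : cdvField k) (D : tameChoice p ik K).
Local Notation j := (jKt D).

Lemma Ks_two : 2%:R != 0 :> Ks D.
Proof.
by rewrite -(rmorph_nat j) fmorph_eq0; apply: Kt_two.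
Qed.

Lemma Ks_sqrt (x : Ks D) : exists y, y ^+ 2 = x.
Proof.
have [->|x0] := eqVneq x 0; first by exists 0; rewrite expr0n.
exact: (sep_root (Ks_closure D).2 Ks_two x0).
Qed.

Lemma Ks_infinite (s : seq (Ks D)) : exists x, x \notin s.
Proof. exact: (infinite_embed j (Kt_infinite (D := D))). Qed.

Definition Kt_curve (G : {poly Kt D}) (hG : exists a b c, splits3 G a b c) : mcurve :=
  MCurve hG (Kt_two p_char p_odd D) (Kt_sqrt p_char p_odd ksep_closed (D := D))
    (Kt_infinite (D := D)).

Definition Ks_curve (G : {poly Ks D}) (hG : exists a b c, splits3 G a b c) : mcurve :=
  MCurve hG Ks_two Ks_sqrt Ks_infinite.

(** [Kt] consists of the elements of [Ks] in the image of some finite tame extension. Following an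
    embedding by [s] is again an embedding, so [Kt] is stable under [s] and its inverse. *)
Lemma restrict_gal (s : absGal D) : exists t : tameGal D, forall x, j (t x) = s (j x).
Proof.
have stable (s' : absGal D) : forall x, exists y, j y = s' (j x).
  move=> x; apply/Kt_max.
  have /Kt_max [L [h [hK tL [y hy]]]] : exists z, j z = j x by exists x.
  exists L; exists (s' \o h : {rmorphism L -> Ks D}); split=> //.
    by move=> a /=; rewrite hK gal_fix.
  by exists y; rewrite /= hy.
have [t tE] := choice (stable s).
have [t' tE'] := choice (stable (s^-1)%g).
have inj := fmorph_inj j.
have sV x : s ((s^-1)%g x) = x.
  by have := congr1 (fun f : absGal D => f x) (gal_mulrV s).
have Vs x : (s^-1)%g (s x) = x.
  by have := congr1 (fun f : absGal D => f x) (gal_mulV s).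
have tB : zmod_morphism t by move=> x y; apply: inj; rewrite rmorphB !tE !rmorphB.
have tM : GRing.monoid_morphism t.
  by split=> [|x y]; apply: inj; rewrite ?rmorphM !tE ?rmorphM ?rmorph1.
have tbij : bijective t.
  by exists t' => x; apply: inj; rewrite ?tE' ?tE ?tE' ?Vs ?sV.
have tfix a : t (iKt D a) = iKt D a.
  by apply: inj; rewrite tE jKt_iKt gal_fix.
by exists (GalAut tB tM tbij tfix).
Qed.

Variable f : {poly K}.
Hypothesis f_cubic : size f = 4%N.
Hypothesis f_sep : separable_poly f.
Hypothesis f_tame : forall x : Ks D, root (map_poly (iKs D) f) x -> exists r, j r = x.
Local Notation c := (lead_coef f).

Lemma lead_neq0 : c != 0.
Proof. by rewrite lead_coef_eq0 -size_poly_eq0 f_cubic. Qed.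

Lemma cubic_roots : exists r1 r2 r3 : Kt D,
  splits3 (('X - r1%:P) * ('X - r2%:P) * ('X - r3%:P)) r1 r2 r3 /\
  map_poly (iKt D) f = iKt D c *: (('X - r1%:P) * ('X - r2%:P) * ('X - r3%:P)).
Proof.
have sep : separable_poly (map_poly (iKs D) f) by rewrite separable_map.
have [rs urs] := separable_splits (Ks_closure D).2 sep.
rewrite lead_coef_map => fE.
have c0 : iKs D c != 0 by rewrite fmorph_eq0 lead_neq0.
have : size rs = 3.
  have := congr1 (fun q : {poly _} => size q) fE.
  rewrite size_map_poly f_cubic size_scale // size_prod_XsubC.
  by case.
case: rs urs fE => [|x1 [|x2 [|x3 []]]] //= urs.
rewrite !big_cons big_nil mulr1 => fE _.
have rt x : x \in [:: x1; x2; x3] -> exists r, j r = x.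
  move=> xin; apply: f_tame; rewrite fE rootZ // !rootM !root_XsubC.
  by move: xin; rewrite !inE.
have [|r1 e1] := rt x1; first by rewrite !inE eqxx.
have [|r2 e2] := rt x2; first by rewrite !inE eqxx orbT.
have [|r3 e3] := rt x3; first by rewrite !inE eqxx !orbT.
move: urs; rewrite -e1 -e2 -e3 !inE !(inj_eq (fmorph_inj j)) negb_or andbT.
move=> /andP[/andP[n12 n13] n23].
exists r1, r2, r3; split; first by [].
apply: (map_poly_inj j); rewrite -map_poly_comp.
have -> : map_poly (j \o iKt D) f = map_poly (iKs D) f.
  by apply: eq_map_poly => x /=; rewrite jKt_iKt.
rewrite fE map_polyZ /= jKt_iKt !rmorphM /= !map_polyXsubC e1 e2 e3 /=.
by rewrite mulrA.
Qed.

Section Roots.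
Variables r1 r2 r3 : Kt D.
Local Notation F := (('X - r1%:P) * ('X - r2%:P) * ('X - r3%:P)).
Hypothesis sF : splits3 F r1 r2 r3.
Hypothesis fE : map_poly (iKt D) f = iKt D c *: F.
Variable u : K.
Hypothesis u0 : u != 0.

(* With [c] the leading coefficient of [f], [(x, y) |-> (c u^2 x, c u^3 y)] turns
   [y ^ 2 = f x] into a monic model. *)
Definition kappa : Kt D := iKt D (c * u ^+ 2).
Definition kappas : Ks D := iKs D (c * u ^+ 2).

Lemma kappa_neq0 : kappa != 0.
Proof. by rewrite fmorph_eq0 mulf_neq0 ?lead_neq0 ?expf_neq0. Qed.

Lemma kappas_neq0 : kappas != 0.
Proof. by rewrite fmorph_eq0 mulf_neq0 ?lead_neq0 ?expf_neq0. Qed.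

Definition modelG : {poly Kt D} :=
  ('X - (kappa * r1)%:P) * ('X - (kappa * r2)%:P) * ('X - (kappa * r3)%:P).

Lemma modelG_splits : splits3 modelG (kappa * r1) (kappa * r2) (kappa * r3).
Proof.
by split=> //; rewrite (inj_eq (mulfI kappa_neq0)); case: sF.
Qed.

Lemma modelG_exists : exists a b d, splits3 modelG a b d.
Proof. by exists (kappa * r1), (kappa * r2), (kappa * r3); apply: modelG_splits. Qed.

Definition model : mcurve := Kt_curve modelG_exists.

Lemma roots_KtE r : roots_Kt D f r <-> [|| r == r1, r == r2 | r == r3].
Proof.
rewrite /roots_Kt /= fE rootZ ?(splits3_root _ sF) //.
by rewrite fmorph_eq0 lead_neq0.
Qed.

Lemma modelG_root x : root modelG x <-> exists2 r, roots_Kt D f r & x = kappa * r.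
Proof.
rewrite (splits3_root _ modelG_splits); split=> [/or3P[] /eqP ->|[r /roots_KtE + ->]].
- by exists r1 => //; apply/roots_KtE; rewrite eqxx.
- by exists r2 => //; apply/roots_KtE; rewrite eqxx orbT.
- by exists r3 => //; apply/roots_KtE; rewrite eqxx !orbT.
by rewrite !(inj_eq (mulfI kappa_neq0)).
Qed.

Lemma roots_Kt_gal (t : tameGal D) r : roots_Kt D f r -> roots_Kt D f (t r).
Proof.
rewrite /roots_Kt /= -(fmorph_root t) -map_poly_comp.
by rewrite (@eq_map_poly _ _ (t \o iKt D) (iKt D)) // => x /=; apply: gal_fix.
Qed.

Lemma modelG_gal (t : tameGal D) a b d :
  splits3 modelG a b d -> splits3 modelG (t a) (t b) (t d).
Proof.
move=> s; have rt x : root modelG x -> root modelG (t x).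
  move=> /modelG_root[r hr ->]; apply/modelG_root; exists (t r).
    exact: roots_Kt_gal.
  by rewrite rmorphM /= /kappa gal_fix.
have [_ ab bd ad] := s; have rs x := splits3_root x s.
apply: (splits3_distinct_roots s); rewrite ?(inj_eq (fmorph_inj t)) //;
  apply: rt; by rewrite rs eqxx ?orbT.
Qed.

Definition model_map (P : mpoint model) : ec_point (Ks D) :=
  ec_map j kappas^-1 (kappas * iKs D u)^-1 (mval P).

Let us0 : iKs D u != 0. Proof. by rewrite fmorph_eq0. Qed.
Let al0 : kappas^-1 != 0. Proof. by rewrite invr_eq0 kappas_neq0. Qed.
Let be0 : (kappas * iKs D u)^-1 != 0.
Proof. by rewrite invr_eq0 mulf_neq0 // kappas_neq0. Qed.
Let scale : iKs D c * kappas^-1 ^+ 3 = (kappas * iKs D u)^-1 ^+ 2.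
Proof.
have c0 : iKs D c != 0 by rewrite fmorph_eq0 lead_neq0.
by rewrite /kappas rmorphM rmorphXn; field; apply/andP.
Qed.

Let Fs := ('X - (j r1)%:P) * ('X - (j r2)%:P) * ('X - (j r3)%:P).

Let sFs : splits3 Fs (j r1) (j r2) (j r3).
Proof. by split=> //; rewrite (inj_eq (fmorph_inj j)); case: sF. Qed.

Let curveE : curve_Ks D f = iKs D c *: Fs.
Proof.
rewrite /curve_Ks; have <- : map_poly (j \o iKt D) f = map_poly (iKs D) f.
  by apply: eq_map_poly => x /=; rewrite jKt_iKt.
rewrite map_poly_comp fE.
by rewrite map_polyZ /= jKt_iKt !rmorphM /= !map_polyXsubC.
Qed.

Let jkappa r : j (kappa * r) = kappas * j r.
Proof. by rewrite rmorphM /kappa jKt_iKt. Qed.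

Let sFs' : splits3 Fs (kappas^-1 * j (kappa * r1)) (kappas^-1 * j (kappa * r2))
  (kappas^-1 * j (kappa * r3)).
Proof. by rewrite !jkappa !mulKf ?kappas_neq0. Qed.

Lemma model_models : models (curve_Ks D f) model_map.
Proof.
have inj : injective model_map.
  by move=> P Q h; apply: mval_inj; exact: (ec_map_inj al0 be0 h).
split=> //.
- move=> P; apply: (proj1 (ec_map_on modelG_splits sFs' curveE be0 scale _)).
  exact: mvalP.
- by move=> P Q; apply: (ec_map_add modelG_splits sFs' curveE al0 be0 scale).
move=> n Z [onZ tZ].
(* A torsion point over [Ks] is first rescaled to the monic model over [Ks], where it descends to
   [Kt] by [tors_descent]. *)
pose Gs := ('X - (j (kappa * r1))%:P) * ('X - (j (kappa * r2))%:P) * ('X - (j (kappa * r3))%:P).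
have sGs : splits3 Gs (j (kappa * r1)) (j (kappa * r2)) (j (kappa * r3)).
  split=> //; rewrite (inj_eq (fmorph_inj j)) (inj_eq (mulfI kappa_neq0)); by case: sF.
have eGs : exists a b d, splits3 Gs a b d by do 3 eexists; exact: sGs.
pose C1 := Ks_curve eGs.
pose i1 (P : mpoint C1) : ec_point (Ks D) :=
  ec_map idfun kappas^-1 (kappas * iKs D u)^-1 (mval P).
pose Z1 : ec_point (Ks D) := ec_map idfun kappas (kappas * iKs D u) Z.
have Z1E : ec_map idfun kappas^-1 (kappas * iKs D u)^-1 Z1 = Z.
  rewrite /Z1; case: (Z) => [[x y]|] //=; rewrite mulKf ?kappas_neq0 //.
  by rewrite mulKf // mulf_neq0 // kappas_neq0.
have onZ1 : on_curve Gs Z1.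
  by apply: (proj2 (ec_map_on (j := idfun) sGs sFs' curveE be0 scale _)); rewrite Z1E.
pose W : mpoint C1 := @MPoint C1 Z1 onZ1.
have i1D P Q : i1 (P + Q) = ec_add (curve_Ks D f) (i1 P) (i1 Q).
  exact: (ec_map_add (j := idfun) sGs sFs' curveE al0 be0 scale).
have i1n m : i1 (W *+ m) = ec_muln (curve_Ks D f) m Z.
  elim: m => [|m IH]; first by rewrite mulr0n.
  by rewrite mulrS i1D IH {1}/i1 /= Z1E.
have tW : W *+ (2 ^ n) = 0.
  apply: mval_inj; apply: (ec_map_inj (j := idfun) al0 be0).
  by rewrite -/(i1 _) i1n tZ.
have [P PE] := @tors_descent model C1 j _ _ _ modelG_splits sGs n W tW.
exists P; rewrite -Z1E -[Z1]/(mval W) PE /model_map.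
by case: (mval P) => [[x y]|] //=; rewrite !mul1r.
Qed.

Definition model_gal (t : tameGal D) : mpoint model -> mpoint model :=
  @maction model t (@modelG_gal t).

Lemma model_gal_additive t : tors_additive (model_gal t).
Proof. by split=> [|n P Q _ _]; [apply: maction0 | apply: mactionD]. Qed.

Definition tame_action (t : tameGal D) := tate_lift model_map model_map (model_gal t).

(** The scaling factors of [model_map] come from [K] and are fixed by Galois, so the action on the
    model over [Kt] induces the action on coordinates over [Ks]. *)
Lemma tame_action_spec : tame_tate_action f tame_action.
Proof.
have Hi := model_models; split.
- by move=> t; apply: (tate_lift_linear Hi Hi (model_gal_additive t)).
- move=> Z /(tate_points Hi)[P [ZE _ _]]; apply/funext => n.
  rewrite /tame_action /tate_lift ZE (unmodelK Hi); congr model_map.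
  by apply: mval_inj => /=; case: (mval (P n)) => [[x y]|] //=; rewrite !mul1r.
- move=> t s Z /(tate_points Hi)[P [ZE _ _]]; apply/funext => n.
  rewrite /tame_action /tate_lift ZE !(unmodelK Hi); congr model_map.
  by apply: mval_inj => /=; case: (mval (P n)) => [[x y]|] //=; rewrite !mul1r.
- move=> s; have [t tE] := restrict_gal s; exists t => // Z.
  move=> /(tate_points Hi)[P [ZE _ _]]; apply/funext => n.
  rewrite /tame_action /tate_lift /tate_map ZE !(unmodelK Hi) /model_map /=.
  case: (mval (P n)) => [[x y]|] //=.
  by rewrite !mul1r !tE !rmorphM !fmorphV !rmorphM /= /kappas !gal_fix.
Qed.

End Roots.

End Model.

(** * Matching the leading coefficients up to a square *)

Section Twist.
Variables (p : nat) (k ksep : fieldType) (ik : {rmorphism k -> ksep}).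
Variables (K : cdvField k) (D : tameChoice p ik K).

Lemma tilde_unif (m : int) : tilde (iKt D (unif D ^ m)) = 1.
Proof.
have r1 : rt D 1 = iKt D (unif D) by rewrite -(rtX D (ltn0Sn 0) (coprime1n p)) expr1.
have um0 : unif D ^ m != 0 by rewrite expfz_neq0 // unif_neq0.
have v1 : vt D (iKt D (unif D ^ m)) = m%:~R / (1%N)%:R.
  by rewrite vt_vK // (v_expz (@vK_valuation _ K)) ?unif_neq0 // vK_unif intz divr1.
rewrite (tildeE (ltn0Sn 0) (coprime1n p) _ v1) ?fmorph_eq0 // r1 -fmorphXz.
by rewrite divff ?red1 // fmorph_eq0.
Qed.

(** If the values of [c] and [c'] differ by [2 m] and the ratio of their leading residues is [a^2],
    then [u = unif^(- m) e], with [e] a lift of [a^-1], corrects both. *)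
Lemma sim_sq_twist (K' : cdvField k) (D' : tameChoice p ik K') (c : K) (c' : K') :
  p \in [pchar k] -> c != 0 -> c' != 0 -> sim_sq D D' c c' ->
  exists2 u : K, u != 0 & sim (iKt D (c * u ^+ 2)) (iKt D' c').
Proof.
move=> p_char c0 c0' [/eqP + [a a0 aE]].
rewrite eqz_mod_dvd => /dvdzP[m mE].
have hvK := @vK_valuation _ K; have [_ _ _ onto red0] := redK_residue K.
have [e ie re] := onto a^-1.
have : ~~ ((e == 0) || (0 < vK e)).
  apply/negP => /(red0 _ ie) h; rewrite h in re.
  by move/eqP: re; rewrite eq_sym invr_eq0 (negbTE a0).
rewrite negb_or -leNgt => /andP[e0 ve].
have {}ve : vK e = 0.
  by apply/eqP; rewrite eq_le ve; move: ie; rewrite /vintegral /vge (negbTE e0).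
have um0 : unif D ^ (- m) != 0 by rewrite expfz_neq0 // unif_neq0.
have ue0 : unif D ^ (- m) * e != 0 by rewrite mulf_neq0.
exists (unif D ^ (- m) * e) => //.
have n0 : c * (unif D ^ (- m) * e) ^+ 2 != 0 by rewrite mulf_neq0 ?expf_neq0.
right; rewrite !fmorph_eq0; split=> //.
  rewrite !vt_vK //; congr (_%:~R).
  rewrite (v_mul hvK) ?expf_neq0 // (v_exp hvK) // (v_mul hvK) // ve addr0.
  rewrite (v_expz hvK) ?unif_neq0 // vK_unif intz.
  have -> : vK c = m * 2 + vK c' by rewrite -mE subrK.
  by rewrite mulr2n; ring.
have t' : tilde (iKt D' c') != 0 by rewrite tilde_neq0 ?fmorph_eq0.
have te : tilde (iKt D e) = (ik a)^-1.
  rewrite tilde_unit ?fmorph_eq0 //; last by rewrite vt_vK // ve.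
  by rewrite redt_redK // re fmorphV.
rewrite rmorphM rmorphXn rmorphM expr2 !tildeM ?mulf_neq0 ?fmorph_eq0 //.
rewrite tilde_unif te !mul1r -[tilde (iKt D c)](divfK t') aE rmorphXn.
have ia0 : ik a != 0 by rewrite fmorph_eq0.
by field.
Qed.

End Twist.

Theorem theorem2 (p : nat) (k ksep : fieldType) (ik : {rmorphism k -> ksep})
    (p_char : p \in [pchar k]) (p_odd : odd p)
    (ksep_closure : separable_closure ik)
    (K K' : cdvField k)
    (D : tameChoice p ik K) (D' : tameChoice p ik K')
    (Psi : tameGal D -> tameGal D') (HPsi : tame_identification Psi)
    (f : {poly K}) (f' : {poly K'})
    (f_cubic : size f = 4%N) (f'_cubic : size f' = 4%N)
    (f_sep : separable_poly f) (f'_sep : separable_poly f')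
    (f_tame : forall x : Ks D, root (map_poly (iKs D) f) x ->
                exists r : Kt D, jKt D r = x)
    (f'_tame : forall x : Ks D', root (map_poly (iKs D') f') x ->
                exists r : Kt D', jKt D' r = x)
    (H1 : sim_sq D D' (lead_coef f) (lead_coef f'))
    (phi : Kt D -> Kt D')
    (phi_bij : set_bij (roots_Kt D f) (roots_Kt D' f') phi)
    (phi_equiv : forall (s : tameGal D) (r : Kt D),
       roots_Kt D f r -> phi (s r) = Psi s (phi r))
    (phi_sim : forall r s : Kt D, roots_Kt D f r -> roots_Kt D f s -> r != s ->
       sim (r - s) (phi r - phi s)) :
  exists (rho : tameGal D -> (nat -> ec_point (Ks D)) -> nat -> ec_point (Ks D))
         (rho' : tameGal D' ->
                 (nat -> ec_point (Ks D')) -> nat -> ec_point (Ks D')),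
    tame_tate_action f rho /\ tame_tate_action f' rho' /\
    exists Phi : (nat -> ec_point (Ks D)) -> nat -> ec_point (Ks D'),
      [/\ Z2_linear (curve_Ks D f) (curve_Ks D' f') Phi,
          set_bij (tate2 (curve_Ks D f)) (tate2 (curve_Ks D' f')) Phi
        & forall (t : tameGal D) P, tate2 (curve_Ks D f) P ->
            Phi (rho t P) = rho' (Psi t) (Phi P)].
Proof.
have c0 := lead_neq0 f_cubic; have c0' := lead_neq0 f'_cubic.
have [u u0 kk] := sim_sq_twist p_char c0 c0' H1.
have [r1 [r2 [r3 [sF fE]]]] := cubic_roots f_cubic f_sep f_tame.
have [r1' [r2' [r3' [sF' fE']]]] := cubic_roots f'_cubic f'_sep f'_tame.
(* The first curve alone absorbs the correction [u]; the second is made monic with [u = 1]. The two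
   scaling factors then have the same leading term. *)
have u0' : (1 : K') != 0 := oner_neq0 K'.
have {}kk : sim (kappa D f u) (kappa D' f' 1) by rewrite /kappa expr1n mulr1.
pose C := model p_char p_odd ksep_closure f_cubic sF u0.
pose C' := model p_char p_odd ksep_closure f'_cubic sF' u0'.
have kn := kappa_neq0 D f_cubic u0; have kn' := kappa_neq0 D' f'_cubic u0'.
(* The roots of the monic models are the rescaled roots of the cubics, and [phi] matches them. *)
pose mr (e : C) (e' : C') := exists r, [/\ roots_Kt D f r, e = kappa D f u * r &
  e' = kappa D' f' 1 * phi r].
have [phi_fun phi_inj phi_surj] := phi_bij.
have rootE (e : C) : root (mpol C) e <-> exists2 r, roots_Kt D f r & e = kappa D f u * r.
  exact: (modelG_root f_cubic sF fE u0).
have rootE' (e : C') : root (mpol C') e <->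
    exists2 r, roots_Kt D' f' r & e = kappa D' f' 1 * r.
  exact: (modelG_root f'_cubic sF' fE' u0').
have [X [mXE SXE]] : exists X : matching C C', mrt X = mr /\
    mS X = @sim p k ksep ik K K' D D'.
  unshelve eexists; first apply: (@Matching C C' (@sim p k ksep ik K K D D)
    (@sim p k ksep ik K' K' D' D') (@sim p k ksep ik K K' D D')
    (@sim p k ksep ik K' K D' D) mr).
  - by move=> x x'; split; apply: sim_sym.
  - exact: sim_lead_equiv.
  - exact: sim_lead_equiv.
  - exact: sim_leading.
  - exact: sim_leading.
  - move=> e e' [r [hr -> ->]]; split; first by apply/rootE; exists r.
    by apply/rootE'; exists (phi r) => //; apply: phi_fun.
  - by move=> e /rootE[r hr ->]; exists (kappa D' f' 1 * phi r), r.
  - move=> e' /rootE'[r' hr' ->]; have [r hr <-] := phi_surj _ hr'.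
    by exists (kappa D f u * r), r.
  - move=> e e1 e2 [r [hr -> ->]] [s [hs + ->]].
    by move=> /(mulfI kn) ->.
  - move=> e' e1 e2 [r [hr -> ->]] [s [hs -> +]].
    by move=> /(mulfI kn')/phi_inj ->; rewrite ?inE.
  (* A difference of model roots is the scaling factor times a difference of original roots; the
     factors are related by [kk], the differences by [phi_sim]. *)
  - move=> e d e' d' [r [hr -> ->]] [s [hs -> ->]] ne.
    rewrite -!mulrBr; apply: simM => //; apply: phi_sim => //.
    by apply: contraNneq ne => ->.
  by [].
pose i := @model_map _ _ _ _ p_char p_odd ksep_closure _ D f f_cubic r1 r2 r3 sF u u0.
pose i' := @model_map _ _ _ _ p_char p_odd ksep_closure _ D' f' f'_cubic r1' r2' r3' sF' 1 u0'.
have Hi : models (curve_Ks D f) i by apply: model_models.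
have Hi' : models (curve_Ks D' f') i' by apply: model_models.
exists (tame_action p_char p_odd ksep_closure f_cubic sF fE u0).
exists (tame_action p_char p_odd ksep_closure f'_cubic sF' fE' u0').
split; first exact: tame_action_spec.
split; first exact: tame_action_spec.
exists (tate_lift i i' (theta_map X)); split.
- exact: (tate_lift_linear Hi Hi' (theta_map_additive X)).
- exact: (tate_lift_theta_bij X Hi Hi').
move=> t Z /(tate_points Hi)[P [ZE tP _]]; apply/funext => n.
rewrite /tame_action /tate_lift ZE !(unmodelK Hi) (unmodelK Hi'); congr i'.
apply: theta_mapE; apply: theta_action; last exact: theta_mapP (tP n).
  move=> e e'; rewrite mXE => -[r [hr -> ->]]; exists (t r); split.
  - exact: (roots_Kt_gal t hr).
  - by rewrite rmorphM /= /kappa gal_fix.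
  - by rewrite rmorphM /= /kappa gal_fix phi_equiv.
by move=> x x'; rewrite SXE; apply: sim_gal.
Qed.
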